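(* Let $F$ be a maximal abelian subgroup of $G=\mathrm O(n)/\langle -I\rangle$, with associated function $m$, integers $k,s_0,s_1$ and maps $\vec\mu=(\mu_1,\dots,\mu_{s_0})$ (unordered), and let $W(F)=N_G(F)/C_G(F)$. There is an exact sequence $$1\longrightarrow \mathrm{Hom}(F/\ker m,B_F)\rtimes S_{\vec\mu}\longrightarrow W(F)\longrightarrow \mathrm{Aut}(F/\ker m,m,\vec\mu)\times\bigl(\{\pm1\}^{s_1}\rtimes S_{s_1}\bigr)\longrightarrow 1.$$
   Context: Let $n\ge1$, $G=\mathrm O(n)/\langle -I\rangle$ and $\pi:\mathrm O(n)\to G$ the projection; $[A]=\pi(A)$. For a closed abelian subgroup $F\subset G$, define $m:F\times F\to\{\pm1\}$ by $m([A],[B])=\lambda$ where $ABA^{-1}B^{-1}=\lambda I$; let $\ker m=\{x\in F:m(x,y)=1\ \forall y\in F\}$, so $F/\ker m$ is an $\mathbb F_2$-vector space to which $m$ descends, and let $k=\frac12\mathrm{rank}(F/\ker m)$. Let $B_F=\{x\in\ker m: A^2=I\ \forall A\in\pi^{-1}(x)\}$. Every maximal abelian subgroup $F$ satisfies $\dim\mathfrak g_0^F=\dim F$ ($\mathfrak g_0$ the Lie algebra of $G$, fixed vectors under the adjoint action), and then: $\pi^{-1}(B_F)$ is simultaneously diagonalizable; let $\mathbb R^n=V_1\oplus\cdots\oplus V_s$ be the decomposition into its distinct nonzero simultaneous eigenspaces; each $\dim V_i$ is $2^k$ or $2^{k+1}$; order them so that $\dim V_i=2^k$ for $1\le i\le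 s_0$ and $2^{k+1}$ for $s_0<i\le s$, and put $s_1=s-s_0$, so $n=2^ks_0+2^{k+1}s_1$. Every $A\in\pi^{-1}(F)$ preserves each $V_i$, and for $1\le i\le s_0$, $(A|_{V_i})^2=\mu_i([A])\mathrm{id}$ with $\mu_i([A])\in\{\pm1\}$; $\mu_i$ descends to $F/\ker m$. For a map $\mu:F\to\{\pm1\}$ let $a_\mu$ be the number of $i\in\{1,\dots,s_0\}$ with $\mu_i=\mu$, and $S_{\vec\mu}=\prod_\mu S_{a_\mu}$, regarded as the group of permutations $\sigma$ of $\{1,\dots,s_0\}$ with $\mu_{\sigma(i)}=\mu_i$. For $F$ maximal abelian, $\pi^{-1}(B_F)=\{\sum_i\varepsilon_i\mathrm{id}_{V_i}:\varepsilon_i=\pm1\}$, and $S_{\vec\mu}$ acts on $B_F$ (hence on $\mathrm{Hom}(F/\ker m,B_F)$) by permuting the coordinates $\varepsilon_1,\dots,\varepsilon_{s_0}$. $\mathrm{Aut}(F/\ker m,m,\vec\mu)$ is the group of linear automorphisms $f$ of $F/\ker m$ preserving $m$ and such that, for some permutation $\rho$ of $\{1,\dots,s_0\}$, $\mu_{\rho(i)}\circ f=\mu_i$ for all $i$. $S_{s_1}$ acts on $\{\pm1\}^{s_1}$ by permuting coordinates. *)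

(* Defs.v *)
From HB Require Import structures.
From mathcomp Require Import all_boot all_order all_fingroup all_algebra alt.
From mathcomp Require Import generic_quotient boolp classical_sets reals.

Set Implicit Arguments.
Unset Strict Implicit.
Unset Printing Implicit Defensive.

Import GRing.Theory Num.Theory.

Local Open Scope group_scope.

(* The subgroups of a group G are the predicates S : groupClosed G, and
   subgrp S is S regarded as a group in its own right. *)
Record subgrp (G : groupType) (S : {pred G}) :=
  SubGrp { sgval :> G; sgvalP : sgval \in S }.

Arguments sgval {G S} _.

HB.instance Definition _ (G : groupType) (S : {pred G}) :=
  [isSub for (@sgval G S)].
HB.instance Definition _ (G : groupType) (S : {pred G}) :=
  [Choice of subgrp S by <:].

Fact subgrp_closed (G : groupType) (S : groupClosed G) : 
  group_closed (fun x : G => x \in S).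
Proof. by split; [exact: gpred1 | exact: gpredF]. Qed.

HB.instance Definition _ (G : groupType) (S : groupClosed G) :=
  SubChoice_isSubGroup.Build G _ (subgrp S) (@subgrp_closed G S).

Section SgvalTheory.
Variables (G : groupType) (S : groupClosed G).
Implicit Types x y : subgrp S.

Lemma sgvalM x y : sgval (x * y) = sgval x * sgval y. Proof. by []. Qed.
Lemma sgval1 : sgval (1 : subgrp S) = 1. Proof. by []. Qed.
Lemma sgvalV x : sgval x^-1 = (sgval x)^-1. Proof. by []. Qed.
Lemma sgvalJ x y : sgval (x ^ y) = sgval x ^ sgval y. Proof. by []. Qed.

End SgvalTheory.

HB.mixin Record isAbelianGroup G of monoid.Group G := {
  abmulgC : commutative (@monoid.mul G)
}.

#[short(type="abGroupType")]
HB.structure Definition AbelianGroup := {G of isAbelianGroup G & monoid.Group G}.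

HB.mixin Record isConjClosed (G : groupType) (S : {pred G}) := {
  gpredNJ : forall x y : G, x \in S -> x ^ y \in S
}.

#[short(type="normalClosed")]
HB.structure Definition NormalClosed (G : groupType) :=
  {S of isConjClosed G S & monoid.GroupClosed G S}.

HB.mixin Record isCommClosed (G : groupType) (S : {pred G}) := {
  gpredC : forall x y : G, x \in S -> y \in S -> x * y = y * x
}.

#[short(type="abelianClosed")]
HB.structure Definition AbelianClosed (G : groupType) :=
  {S of isCommClosed G S & monoid.GroupClosed G S}.

Fact subgrp_abelian (G : groupType) (S : abelianClosed G) :
  commutative (@monoid.mul (subgrp S)).
Proof.
by move=> x y; apply: val_inj; apply: gpredC; apply: sgvalP.
Qed.

HB.instance Definition _ (G : groupType) (S : abelianClosed G) :=
  isAbelianGroup.Build (subgrp S) (@subgrp_abelian G S).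

(* In a Hausdorff topological group the closure of an abelian subgroup is
   abelian, so this is the same as being maximal among the closed abelian
   subgroups, and such an S is closed. *)
Definition maximal_abelian (G : groupType) (S : abelianClosed G) :=
  forall S' : abelianClosed G, {subset S <= S'} -> {subset S' <= S}.

Section Quotient.
Variables (G : groupType) (K : normalClosed G).

Definition coset_rel (x y : G) := x^-1 * y \in K.

Fact coset_rel_equiv : equiv_class_of coset_rel.
Proof.
split=> [x | x y | y x z]; rewrite /coset_rel.
- by rewrite mulVg gpred1.
- by rewrite -gpredV invgM invgK.
- move=> xy yz.
  have -> : x^-1 * z = (x^-1 * y) * (y^-1 * z).
    by rewrite mulgA -[x^-1 * y * y^-1]mulgA mulgV mulg1.
  exact: gpredM.
Qed.

Canonical coset_equiv := EquivRelPack coset_rel_equiv.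

Definition quot := {eq_quot coset_equiv}%qT.

HB.instance Definition _ := Choice.on quot.

Definition qproj (x : G) : quot := (\pi_quot x)%qT.
Definition qrepr (u : quot) : G := repr u.

Lemma qreprK u : qproj (qrepr u) = u.
Proof. exact: reprK. Qed.

Lemma qprojP (x y : G) : qproj x = qproj y <-> x^-1 * y \in K.
Proof.
by split=> [|h]; [move/eqmodP | apply/eqmodP].
Qed.

Lemma qrepr_qproj x : x^-1 * qrepr (qproj x) \in K.
Proof. by apply/qprojP; rewrite qreprK. Qed.

Definition qone : quot := qproj 1.
Definition qmul (u v : quot) : quot := qproj (qrepr u * qrepr v).
Definition qinv (u : quot) : quot := qproj (qrepr u)^-1.

Lemma qprojM x y : qproj (x * y) = qmul (qproj x) (qproj y).
Proof.
apply/qprojP; set x' := qrepr _; set y' := qrepr _.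
have -> : (x * y)^-1 * (x' * y') = (x^-1 * x') ^ y * (y^-1 * y').
  by rewrite invgM /conjg !mulgA mulgK.
by rewrite gpredM ?gpredNJ ?qrepr_qproj.
Qed.

Lemma qprojV x : qproj x^-1 = qinv (qproj x).
Proof.
apply/qprojP; set x' := qrepr _.
have -> : (x^-1)^-1 * x'^-1 = ((x^-1 * x') ^ x^-1)^-1.
  by rewrite /conjg !invgM !invgK !mulgA mulgK.
by rewrite gpredV gpredNJ ?qrepr_qproj.
Qed.

Fact qmulA : associative qmul.
Proof.
move=> u v w; rewrite -(qreprK u) -(qreprK v) -(qreprK w).
by rewrite -!qprojM mulgA.
Qed.
Fact qmul1 : left_id qone qmul.
Proof. by move=> u; rewrite -(qreprK u) -qprojM mul1g. Qed.
Fact q1mul : right_id qone qmul.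
Proof. by move=> u; rewrite -(qreprK u) -qprojM mulg1. Qed.
Fact qmulV : left_inverse qone qinv qmul.
Proof. by move=> u; rewrite -(qreprK u) -qprojV -qprojM mulVg. Qed.
Fact qVmul : right_inverse qone qinv qmul.
Proof. by move=> u; rewrite -(qreprK u) -qprojV -qprojM mulgV. Qed.

HB.instance Definition _ := isGroup.Build quot qmulA qmul1 q1mul qmulV qVmul.

Fact qproj_morph : {morph qproj : x y / x * y}.
Proof. exact: qprojM. Qed.
HB.instance Definition _ := monoid.isMultiplicative.Build G quot qproj qproj_morph.

End Quotient.

Section HomGroup.
Variables (G : groupType) (B : abGroupType).

HB.instance Definition _ := gen_eqMixin {multiplicative G -> B}.
HB.instance Definition _ := gen_choiceMixin {multiplicative G -> B}.

Lemma multiplicativeP (f g : {multiplicative G -> B}) :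
  (forall x, f x = g x) -> f = g.
Proof.
case: f g => f [[fP]] [g [[gP]]] /= fg.
have {}fg : f = g by apply: funext.
by subst g; rewrite (Prop_irrelevance fP gP).
Qed.

Definition hom_one_fun (_ : G) : B := 1.
Definition hom_mul_fun (f g : G -> B) (x : G) : B := f x * g x.
Definition hom_inv_fun (f : G -> B) (x : G) : B := (f x)^-1.

Fact hom_one_morph : {morph hom_one_fun : x y / x * y}.
Proof. by move=> x y; rewrite /hom_one_fun mulg1. Qed.
Fact hom_mul_morph (f g : {multiplicative G -> B}) :
  {morph hom_mul_fun f g : x y / x * y}.
Proof.
move=> x y; rewrite /hom_mul_fun !gmulfM -!mulgA; congr (_ * _).
by rewrite !mulgA [f y * _]abmulgC.
Qed.
Fact hom_inv_morph (f : {multiplicative G -> B}) :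
  {morph hom_inv_fun f : x y / x * y}.
Proof.
by move=> x y; rewrite /hom_inv_fun gmulfM invgM abmulgC.
Qed.

HB.instance Definition _ := monoid.isMultiplicative.Build G B hom_one_fun hom_one_morph.
HB.instance Definition _ (f g : {multiplicative G -> B}) :=
  monoid.isMultiplicative.Build G B (hom_mul_fun f g) (hom_mul_morph f g).
HB.instance Definition _ (f : {multiplicative G -> B}) :=
  monoid.isMultiplicative.Build G B (hom_inv_fun f) (hom_inv_morph f).

Definition hom_one : {multiplicative G -> B} := hom_one_fun.
Definition hom_mul (f g : {multiplicative G -> B}) : {multiplicative G -> B} :=
  hom_mul_fun f g.
Definition hom_inv (f : {multiplicative G -> B}) : {multiplicative G -> B} :=
  hom_inv_fun f.

Fact hom_mulA : associative hom_mul.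
Proof. by move=> f g h; apply: multiplicativeP => x; apply: mulgA. Qed.
Fact hom_mul1 : left_id hom_one hom_mul.
Proof. by move=> f; apply: multiplicativeP => x; apply: mul1g. Qed.
Fact hom_1mul : right_id hom_one hom_mul.
Proof. by move=> f; apply: multiplicativeP => x; apply: mulg1. Qed.
Fact hom_mulV : left_inverse hom_one hom_inv hom_mul.
Proof. by move=> f; apply: multiplicativeP => x; apply: mulVg. Qed.
Fact hom_Vmul : right_inverse hom_one hom_inv hom_mul.
Proof. by move=> f; apply: multiplicativeP => x; apply: mulgV. Qed.

HB.instance Definition _ := isGroup.Build {multiplicative G -> B}
  hom_mulA hom_mul1 hom_1mul hom_mulV hom_Vmul.

End HomGroup.

(* Group automorphisms, with the product f * g = f \o g. *)
Record autgrp (G : groupType) := AutGrp {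
  aut_fun :> G -> G;
  aut_inv : G -> G;
  aut_funK : cancel aut_fun aut_inv;
  aut_invK : cancel aut_inv aut_fun;
  aut_morph : {morph aut_fun : x y / x * y}
}.

Section AutGroup.
Variable G : groupType.

HB.instance Definition _ := gen_eqMixin (autgrp G).
HB.instance Definition _ := gen_choiceMixin (autgrp G).

Lemma autgrpP (f g : autgrp G) : (forall x, f x = g x) -> f = g.
Proof.
case: f g => f f' fK f'K fM [g g' gK g'K gM] /= fg.
have {}fg : f = g by apply: funext.
subst g.
have f'g' : f' = g' by apply: funext => x; rewrite -{1}(g'K x) fK.
subst g'.
by rewrite (Prop_irrelevance fK gK) (Prop_irrelevance f'K g'K)
  (Prop_irrelevance fM gM).
Qed.

Definition aut_one : autgrp G :=
  @AutGrp G id id (fun=> erefl) (fun=> erefl) (fun _ _ => erefl).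

Fact aut_mul_morph (f g : autgrp G) : {morph f \o g : x y / x * y}.
Proof. by move=> x y; rewrite /= !aut_morph. Qed.

Definition aut_mul (f g : autgrp G) : autgrp G :=
  AutGrp (can_comp (@aut_funK _ f) (@aut_funK _ g))
         (can_comp (@aut_invK _ g) (@aut_invK _ f)) (aut_mul_morph f g).

Fact aut_inv_morph (f : autgrp G) : {morph aut_inv f : x y / x * y}.
Proof.
by move=> x y; apply: (can_inj (@aut_funK _ f)); rewrite aut_morph !aut_invK.
Qed.

Definition aut_V (f : autgrp G) : autgrp G :=
  AutGrp (@aut_invK _ f) (@aut_funK _ f) (aut_inv_morph f).

Fact aut_mulA : associative aut_mul.
Proof. by move=> f g h; apply: autgrpP. Qed.
Fact aut_mul1 : left_id aut_one aut_mul.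
Proof. by move=> f; apply: autgrpP. Qed.
Fact aut_1mul : right_id aut_one aut_mul.
Proof. by move=> f; apply: autgrpP. Qed.
Fact aut_mulV : left_inverse aut_one aut_V aut_mul.
Proof. by move=> f; apply: autgrpP => x; apply: aut_funK. Qed.
Fact aut_Vmul : right_inverse aut_one aut_V aut_mul.
Proof. by move=> f; apply: autgrpP => x; apply: aut_invK. Qed.

HB.instance Definition _ := isGroup.Build (autgrp G)
  aut_mulA aut_mul1 aut_1mul aut_mulV aut_Vmul.

End AutGroup.

(* extsdprod phi is the external semidirect product N ><|_phi H. *)
Record extsdprod (N H : groupType) (phi : {multiplicative H -> autgrp N}) :=
  SdProd { sdn : N; sdh : H }.

Arguments SdProd {N H phi} _ _.

Section SdProdGroup.
Variables (N H : groupType) (phi : {multiplicative H -> autgrp N}).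

Let sd := extsdprod phi.

Definition sd_pair (x : sd) := (sdn x, sdh x).
Definition pair_sd (x : N * H) : sd := SdProd x.1 x.2.
Lemma sd_pairK : cancel sd_pair pair_sd. Proof. by case. Qed.

HB.instance Definition _ := Choice.copy (extsdprod phi) (can_type sd_pairK).

Definition sd_one : sd := SdProd 1 1.
Definition sd_mul (x y : sd) : sd :=
  SdProd (sdn x * phi (sdh x) (sdn y)) (sdh x * sdh y).
Definition sd_inv (x : sd) : sd :=
  SdProd (phi (sdh x)^-1 (sdn x)^-1) (sdh x)^-1.

Let phi1 n : phi 1 n = n.
Proof.
have e : phi 1 = 1 by apply: (mulgI (phi 1)); rewrite -gmulfM !mulg1.
by rewrite e.
Qed.
Let phiM h k n : phi (h * k) n = phi h (phi k n).
Proof. by rewrite gmulfM. Qed.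
Let phin1 h : phi h 1 = 1.
Proof. by apply: (mulgI (phi h 1)); rewrite -aut_morph !mulg1. Qed.

Fact sd_mulA : associative sd_mul.
Proof.
by move=> x y z; rewrite /sd_mul /= aut_morph phiM !mulgA.
Qed.
Fact sd_mul1 : left_id sd_one sd_mul.
Proof. by case=> n h; rewrite /sd_mul /= phi1 !mul1g. Qed.
Fact sd_1mul : right_id sd_one sd_mul.
Proof. by case=> n h; rewrite /sd_mul /= phin1 !mulg1. Qed.
Fact sd_mulV : left_inverse sd_one sd_inv sd_mul.
Proof.
by case=> n h; rewrite /sd_mul /= -aut_morph mulVg phin1 mulVg.
Qed.
Fact sd_Vmul : right_inverse sd_one sd_inv sd_mul.
Proof.
by case=> n h; rewrite /sd_mul /= -phiM mulgV phi1 !mulgV.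
Qed.

HB.instance Definition _ := isGroup.Build (extsdprod phi)
  sd_mulA sd_mul1 sd_1mul sd_mulV sd_Vmul.

End SdProdGroup.

(* The action on Hom(G, B) by postcomposition induced by an action on B. *)
Section HomAction.
Variables (G H : groupType) (B : abGroupType).
Variable phi : {multiplicative H -> autgrp B}.

Definition post_fun (a : autgrp B) (f : G -> B) (x : G) : B := a (f x).

Fact post_morph (a : autgrp B) (f : {multiplicative G -> B}) :
  {morph post_fun a f : x y / x * y}.
Proof. by move=> x y; rewrite /post_fun gmulfM aut_morph. Qed.

HB.instance Definition _ (a : autgrp B) (f : {multiplicative G -> B}) :=
  monoid.isMultiplicative.Build G B (post_fun a f) (post_morph a f).

Definition post (a : autgrp B) (f : {multiplicative G -> B}) :
  {multiplicative G -> B} := post_fun a f.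

Fact postK (a : autgrp B) : cancel (post a) (post a^-1).
Proof. by move=> f; apply: multiplicativeP => x; apply: aut_funK. Qed.
Fact postVK (a : autgrp B) : cancel (post a^-1) (post a).
Proof. by move=> f; apply: multiplicativeP => x; apply: aut_invK. Qed.
Fact postM (a : autgrp B) : {morph post a : f g / f * g}.
Proof. by move=> f g; apply: multiplicativeP => x; apply: aut_morph. Qed.

Definition hom_act (h : H) : autgrp {multiplicative G -> B} :=
  AutGrp (postK (phi h)) (postVK (phi h)) (@postM (phi h)).

Fact hom_act_morph : {morph hom_act : h k / h * k}.
Proof.
by move=> h k; apply: autgrpP => f; apply: multiplicativeP => x;
  rewrite /= /post_fun gmulfM.
Qed.

HB.instance Definition _ :=
  monoid.isMultiplicative.Build H (autgrp {multiplicative G -> B}) hom_act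
    hom_act_morph.

End HomAction.

(* The group {1, -1} is bool with addb, true standing for -1. MathComp composes permutations
   from left to right, (s * t) i = t (s i), so s . e = e \o s is a left
   action. *)
Section PermSigns.
Variable I : finType.

Definition perm_signs (s : {perm I}) (e : {ffun I -> bool}) : {ffun I -> bool} :=
  [ffun i => e (s i)].

Fact perm_signsK s : cancel (perm_signs s) (perm_signs s^-1).
Proof. by move=> e; apply/ffunP=> i; rewrite !ffunE permKV. Qed.
Fact perm_signsVK s : cancel (perm_signs s^-1) (perm_signs s).
Proof. by move=> e; apply/ffunP=> i; rewrite !ffunE permK. Qed.
Fact perm_signsM s : {morph perm_signs s : e f / e * f}.
Proof. by move=> e f; apply/ffunP=> i; rewrite !ffunE. Qed.

Definition perm_signs_act (s : {perm I}) : autgrp {ffun I -> bool} :=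
  AutGrp (perm_signsK s) (perm_signsVK s) (@perm_signsM s).

Fact perm_signs_act_morph : {morph perm_signs_act : s t / s * t}.
Proof.
by move=> s t; apply: autgrpP => e; apply/ffunP=> i; rewrite !ffunE permM.
Qed.

HB.instance Definition _ :=
  monoid.isMultiplicative.Build {perm I} (autgrp {ffun I -> bool}) perm_signs_act
    perm_signs_act_morph.

End PermSigns.

Definition signed_perm (s : nat) := extsdprod (@perm_signs_act 'I_s).
HB.instance Definition _ s := monoid.Group.on (signed_perm s).

Definition centg (G : groupType) (S : {pred G}) : {pred G} :=
  [pred x | `[< forall y, y \in S -> x * y = y * x >]].

Definition normg (G : groupType) (S : {pred G}) : {pred G} :=
  [pred x | `[< forall y, (y ^ x \in S) = (y \in S) >]].

Section Weyl.
Variables (G : groupType) (S : {pred G}).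

Fact normg_mul : mulg_closed (normg S).
Proof.
move=> x y /asboolP xN /asboolP yN; apply/asboolP => z.
by rewrite conjgM yN xN.
Qed.
Fact normg_one : 1 \in normg S.
Proof. by apply/asboolP => z; rewrite conjg1. Qed.
Fact normg_inv : invg_closed (normg S).
Proof.
move=> x /asboolP xN; apply/asboolP => z.
by rewrite -[LHS]xN -conjgM mulVg conjg1.
Qed.
HB.instance Definition _ := isMulClosed.Build G (normg S) normg_mul.
HB.instance Definition _ := isMul1Closed.Build G (normg S) normg_one.
HB.instance Definition _ := isInvClosed.Build G (normg S) normg_inv.

Definition cent_in_norm : {pred subgrp (normg S)} :=
  [pred x | sgval x \in centg S].

Fact cent_in_norm_mul : mulg_closed cent_in_norm.
Proof.
move=> x y /asboolP xC /asboolP yC; apply/asboolP => z Sz.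
by rewrite sgvalM -mulgA yC // mulgA xC // mulgA.
Qed.
Fact cent_in_norm_one : 1 \in cent_in_norm.
Proof. by apply/asboolP => z Sz; rewrite sgval1 mul1g mulg1. Qed.
Fact cent_in_norm_inv : invg_closed cent_in_norm.
Proof.
move=> x /asboolP xC; apply/asboolP => z Sz; rewrite sgvalV.
by apply: (mulgI (sgval x)); rewrite mulVKg mulgA xC // mulgK.
Qed.
Fact cent_in_norm_conj (x y : subgrp (normg S)) :
  x \in cent_in_norm -> x ^ y \in cent_in_norm.
Proof.
move=> /asboolP xC; apply/asboolP => z Sz.
rewrite sgvalJ; set g := sgval y; set h := sgval x in xC *.
have Sz' : z ^ g^-1 \in S.
  by have /asboolP -> := normg_inv (sgvalP y).
rewrite -{1 2}(conjgKV g z) -!conjMg xC //.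
Qed.
HB.instance Definition _ :=
  isMulClosed.Build (subgrp (normg S)) cent_in_norm cent_in_norm_mul.
HB.instance Definition _ :=
  isMul1Closed.Build (subgrp (normg S)) cent_in_norm cent_in_norm_one.
HB.instance Definition _ :=
  isInvClosed.Build (subgrp (normg S)) cent_in_norm cent_in_norm_inv.
HB.instance Definition _ :=
  isConjClosed.Build (subgrp (normg S)) cent_in_norm cent_in_norm_conj.

(* N_G(S) / C_G(S) *)
Definition weyl := quot cent_in_norm.
HB.instance Definition _ := monoid.Group.on weyl.

End Weyl.

(* 1 -> A -> B -> C -> 1 *)
Definition short_exact (A B C : groupType)
    (i : {multiplicative A -> B}) (p : {multiplicative B -> C}) :=
  [/\ injective i,
      forall b, p b = 1 <-> exists a, i a = b
    & forall c, exists b, p b = c].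

(* For an elementary abelian 2-group these are the bases and the dimension as a
   vector space over F_2, where linear maps are just group morphisms. The
   default value 0 is taken when there is no finite basis. *)
Definition F2_basis (G : groupType) (r : nat) (e : 'I_r -> G) :=
  forall x, exists! c : {ffun 'I_r -> bool}, x = \prod_(i < r) e i ^+ c i.

Definition F2_rank (G : groupType) : nat :=
  xget 0%N [set r | exists e : 'I_r -> G, F2_basis e]%classic.

Local Open Scope ring_scope.
Local Open Scope group_scope.

Section Orthogonal.
Variables (R : realType) (n : nat).

Record orth := Orth { omx :> 'M[R]_n; orthP : omx^T *m omx == 1%:M }.

HB.instance Definition _ := [isSub for omx].
HB.instance Definition _ := [Choice of orth by <:].

Lemma omxTK (A : orth) : A^T *m A = 1%:M.
Proof. exact/eqP/orthP. Qed.
Lemma omxKT (A : orth) : A *m A^T = 1%:M.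
Proof. exact/mulmx1C/omxTK. Qed.

Fact orth_one_subproof : (1%:M : 'M[R]_n)^T *m 1%:M == 1%:M.
Proof. by rewrite trmx1 mulmx1. Qed.
Fact orth_mul_subproof (A B : orth) : (A *m B)^T *m (A *m B) == 1%:M.
Proof. by rewrite trmx_mul -mulmxA [A^T *m _]mulmxA omxTK mul1mx omxTK. Qed.
Fact orth_inv_subproof (A : orth) : (A^T)^T *m A^T == 1%:M.
Proof. by rewrite trmxK omxKT. Qed.

Definition orth_one := Orth orth_one_subproof.
Definition orth_mul A B := Orth (orth_mul_subproof A B).
Definition orth_inv A := Orth (orth_inv_subproof A).

Fact orth_mulA : associative orth_mul.
Proof. by move=> A B C; apply: val_inj; apply: mulmxA. Qed.
Fact orth_mul1 : left_id orth_one orth_mul.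
Proof. by move=> A; apply: val_inj; apply: mul1mx. Qed.
Fact orth_1mul : right_id orth_one orth_mul.
Proof. by move=> A; apply: val_inj; apply: mulmx1. Qed.
Fact orth_mulV : left_inverse orth_one orth_inv orth_mul.
Proof. by move=> A; apply: val_inj; apply: omxTK. Qed.
Fact orth_Vmul : right_inverse orth_one orth_inv orth_mul.
Proof. by move=> A; apply: val_inj; apply: omxKT. Qed.

HB.instance Definition _ :=
  isGroup.Build orth orth_mulA orth_mul1 orth_1mul orth_mulV orth_Vmul.

Lemma omx1 : omx 1 = 1%:M. Proof. by []. Qed.
Lemma omxM (A B : orth) : omx (A * B) = A *m B. Proof. by []. Qed.
Lemma omxV (A : orth) : omx A^-1 = A^T. Proof. by []. Qed.

(* The subgroup generated by -I. *)
Definition pmI : {pred orth} :=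
  [pred A | (omx A == 1%:M) || (omx A == (- 1%:M)%R)].

Lemma pmIP (A : orth) :
  reflect (exists b : bool, omx A = ((-1) ^+ b)%:M%R) (A \in pmI).
Proof.
apply: (iffP orP) => [[]/eqP AE | [[] AE]].
- by exists false; rewrite expr0.
- by exists true; rewrite expr1 AE raddfN.
- by right; rewrite AE expr1 raddfN.
- by left; rewrite AE expr0.
Qed.

Lemma pmI_comm (A B : orth) : A \in pmI -> A * B = B * A.
Proof.
by case/pmIP=> b AE; apply: val_inj; rewrite /= AE scalar_mxC.
Qed.

Fact pmI_mul : mulg_closed pmI.
Proof.
move=> A B /pmIP[a AE] /pmIP[b BE]; apply/pmIP; exists (a (+) b).
by rewrite omxM AE BE -scalar_mxM signr_addb.
Qed.
Fact pmI_one : 1 \in pmI.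
Proof. by rewrite inE eqxx. Qed.
Fact pmI_inv : invg_closed pmI.
Proof.
by move=> A /pmIP[a AE]; apply/pmIP; exists a; rewrite omxV AE tr_scalar_mx.
Qed.
Fact pmI_conj (A B : orth) : A \in pmI -> A ^ B \in pmI.
Proof. by move=> AI; rewrite /conjg [A * B]pmI_comm // mulKg. Qed.

HB.instance Definition _ := isMulClosed.Build orth pmI pmI_mul.
HB.instance Definition _ := isMul1Closed.Build orth pmI pmI_one.
HB.instance Definition _ := isInvClosed.Build orth pmI pmI_inv.
HB.instance Definition _ := isConjClosed.Build orth pmI pmI_conj.

Definition PO := quot pmI.
HB.instance Definition _ := monoid.Group.on PO.

(* po_proj A is [A]. *)
Definition po_proj (A : orth) : PO := qproj pmI A.

Lemma po_projM A B : po_proj (A * B) = po_proj A * po_proj B.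
Proof. exact: qprojM. Qed.

Lemma po_projV A : po_proj A^-1 = (po_proj A)^-1.
Proof. exact: qprojV. Qed.

Lemma po_projP A B : po_proj A = po_proj B <-> exists2 Z, Z \in pmI & B = A * Z.
Proof.
rewrite /po_proj qprojP; split=> [h | [Z ZI ->]]; last by rewrite mulKg.
by exists (A^-1 * B); rewrite ?mulVKg.
Qed.

End Orthogonal.

Section CommutatorForm.
Variables (R : realType) (n : nat) (F : abelianClosed (PO R n)).
Implicit Types (x y : subgrp F) (A B : orth R n).

(* mform x y = true stands for m(x, y) = -1; see mform_signP. *)
Definition mform x y : bool :=
  let A := qrepr (sgval x) in let B := qrepr (sgval y) in
  omx (A * B * A^-1 * B^-1) != 1%:M.

Let comm_lift A Z B : Z * B = B * Z ->
  (A * Z) * B * (A * Z)^-1 * B^-1 = A * B * A^-1 * B^-1.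
Proof.
move=> ZB; rewrite invgM !mulgA; congr (_ * _ * _).
by rewrite -[A * Z * B]mulgA ZB mulgA mulgK.
Qed.
Let comm_lift' A B Z : Z * A = A * Z ->
  A * (B * Z) * A^-1 * (B * Z)^-1 = A * B * A^-1 * B^-1.
Proof.
move=> ZA; have ZV : Z * A^-1 = A^-1 * Z.
  by apply: (mulgI A); rewrite mulgA -ZA mulgK mulVKg.
by rewrite invgM !mulgA -[_ * Z * A^-1]mulgA ZV !mulgA mulgK.
Qed.

Lemma mform_lift x y A B : po_proj A = sgval x -> po_proj B = sgval y ->
  mform x y = (omx (A * B * A^-1 * B^-1) != 1%:M).
Proof.
move=> Ax By; rewrite /mform.
have /po_projP[Z ZI ->] : po_proj A = po_proj (qrepr (sgval x)).
  by rewrite Ax [RHS]qreprK.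
have /po_projP[Y YI ->] : po_proj B = po_proj (qrepr (sgval y)).
  by rewrite By [RHS]qreprK.
by rewrite comm_lift ?comm_lift' // pmI_comm.
Qed.

Lemma mform_signP x y A B : po_proj A = sgval x -> po_proj B = sgval y ->
  omx (A * B * A^-1 * B^-1) = ((-1) ^+ mform x y)%:M%R.
Proof.
move=> Ax By; rewrite (mform_lift Ax By).
have : A * B * A^-1 * B^-1 \in @pmI R n.
  have : po_proj (A * B) = po_proj (B * A).
    by rewrite !po_projM Ax By (@gpredC _ F) ?sgvalP.
  case/po_projP=> Z ZI BA.
  have -> : A * B * A^-1 * B^-1 = Z^-1.
    apply: (mulIg (B * A)); rewrite {2}BA.
    have -> : A * B * A^-1 * B^-1 * (B * A) = A * B.
      by rewrite -!mulgA mulKg mulVg mulg1.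
    by rewrite [RHS]pmI_comm ?mulgK // gpredV.
  by rewrite gpredV.
by case: eqP => [-> _ | C1 /pmIP[[] CE]] /=.
Qed.

Lemma mform_falseP x y A B : po_proj A = sgval x -> po_proj B = sgval y ->
  mform x y = false <-> A * B = B * A.
Proof.
move=> Ax By; rewrite (mform_lift Ax By); split=> [/negbFE/eqP C1 | AB].
  have {}C1 : A * B * A^-1 * B^-1 = 1 by apply: val_inj.
  by apply: (mulIg A^-1); rewrite mulgK; apply: (mulIg B^-1); rewrite C1 mulgV.
by rewrite AB mulgK mulgV eqxx.
Qed.

Definition kerm : {pred subgrp F} := [pred x | `[< forall y, mform x y = false >]].

Lemma kermP x A : po_proj A = sgval x ->
  x \in kerm <-> forall B, po_proj B \in F -> A * B = B * A.
Proof.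
move=> Ax; split=> [/asboolP xK B BF | AC].
  exact: (mform_falseP Ax (erefl : po_proj B = sgval (SubGrp BF))).1 (xK _).
apply/asboolP => y.
have By : po_proj (qrepr (sgval y)) = sgval y by exact: qreprK.
by apply/(mform_falseP Ax By)/AC; rewrite By sgvalP.
Qed.

Fact kerm_mul : mulg_closed kerm.
Proof.
move=> x y; have [Ax By] := (qreprK (sgval x), qreprK (sgval y)).
move=> /(kermP Ax) xC /(kermP By) yC.
apply/(@kermP _ (qrepr (sgval x) * qrepr (sgval y))).
  by rewrite po_projM [po_proj _]Ax [po_proj _]By.
by move=> B BF; rewrite -mulgA yC // mulgA xC // mulgA.
Qed.
Fact kerm_one : 1 \in kerm.
Proof. by apply/(@kermP _ 1) => // B _; rewrite mul1g mulg1. Qed.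
Fact kerm_inv : invg_closed kerm.
Proof.
move=> x; have Ax := qreprK (sgval x); move=> /(kermP Ax) xC.
apply/(@kermP _ (qrepr (sgval x))^-1); first by rewrite po_projV [po_proj _]Ax.
move=> B BF; apply: (mulgI (qrepr (sgval x))).
by rewrite mulVKg mulgA xC // mulgK.
Qed.
Fact kerm_conj x y : x \in kerm -> x ^ y \in kerm.
Proof. by rewrite /conjg [x * y]abmulgC mulKg. Qed.

HB.instance Definition _ := isMulClosed.Build (subgrp F) kerm kerm_mul.
HB.instance Definition _ := isMul1Closed.Build (subgrp F) kerm kerm_one.
HB.instance Definition _ := isInvClosed.Build (subgrp F) kerm kerm_inv.
HB.instance Definition _ := isConjClosed.Build (subgrp F) kerm kerm_conj.

(* F / ker m *)
Definition Fbar := quot kerm.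
HB.instance Definition _ := monoid.Group.on Fbar.

Definition mform_bar (u v : Fbar) : bool := mform (qrepr u) (qrepr v).

Lemma mform_barE x y : mform_bar (qproj kerm x) (qproj kerm y) = mform x y.
Proof.
rewrite /mform_bar; move: (qrepr_qproj kerm x) (qrepr_qproj kerm y).
set x' := qrepr _; set y' := qrepr _ => xK yK.
have [Ax By] := (qreprK (sgval x), qreprK (sgval y)).
have [Zx Zy] := (qreprK (sgval (x^-1 * x')), qreprK (sgval (y^-1 * y'))).
move: Ax By Zx Zy; set A := qrepr (sgval x); set B := qrepr (sgval y).
set Z := qrepr (sgval (x^-1 * x')); set Y := qrepr _ => Ax By Zx Zy.
have /(kermP Zx) ZC := xK; have /(kermP Zy) YC := yK.
have Ax' : po_proj (A * Z) = sgval x'.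
  by rewrite po_projM [po_proj A]Ax [po_proj Z]Zx -sgvalM mulVKg.
have By' : po_proj (B * Y) = sgval y'.
  by rewrite po_projM [po_proj B]By [po_proj Y]Zy -sgvalM mulVKg.
rewrite (mform_lift Ax' By') (mform_lift Ax By) comm_lift ?comm_lift' //.
- by rewrite YC // [po_proj A]Ax sgvalP.
- by rewrite ZC // By' sgvalP.
Qed.

Definition BF : {pred subgrp F} :=
  [pred x | (x \in kerm) &&
            `[< forall A, po_proj A = sgval x -> A * A = 1 >]].

Lemma BFP x A : po_proj A = sgval x ->
  x \in BF <-> x \in kerm /\ A * A = 1.
Proof.
move=> Ax; split=> [/andP[xK /asboolP xB] | [xK A2]]; first by split; auto.
apply/andP; split=> //; apply/asboolP => B; rewrite -Ax => /esym.
case/po_projP=> Z ZI ->; rewrite mulgA -[A * Z * A]mulgA [Z * A]pmI_comm // mulgA A2.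
rewrite mul1g.
by case/pmIP: ZI => b ZE; apply: val_inj; rewrite /= ZE -scalar_mxM -expr2
  sqrr_sign.
Qed.

Fact BF_mul : mulg_closed BF.
Proof.
move=> x y; have [Ax By] := (qreprK (sgval x), qreprK (sgval y)).
move=> /(BFP Ax)[xK A2] /(BFP By)[yK B2].
apply/(@BFP _ (qrepr (sgval x) * qrepr (sgval y))).
  by rewrite po_projM [po_proj _]Ax [po_proj _]By.
split; first exact: kerm_mul.
have /(kermP Ax) xC := xK.
rewrite -mulgA [_ * (_ * qrepr (sgval y))]mulgA -xC; last first.
  by rewrite [po_proj _]By sgvalP.
by rewrite -[_ * _ * qrepr (sgval y)]mulgA B2 mulg1 A2.
Qed.
Fact BF_one : 1 \in BF.
Proof. by apply/(@BFP _ 1); rewrite ?mulg1 //; split=> //; exact: kerm_one. Qed.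
Fact BF_inv : invg_closed BF.
Proof.
move=> x; have Ax := qreprK (sgval x); move=> /(BFP Ax)[xK A2].
apply/(@BFP _ (qrepr (sgval x))^-1); first by rewrite po_projV [po_proj _]Ax.
by split; [exact: kerm_inv | rewrite -invgM A2 invg1].
Qed.
Fact BF_comm x y : x \in BF -> y \in BF -> x * y = y * x.
Proof. by rewrite abmulgC. Qed.

HB.instance Definition _ := isMulClosed.Build (subgrp F) BF BF_mul.
HB.instance Definition _ := isMul1Closed.Build (subgrp F) BF BF_one.
HB.instance Definition _ := isInvClosed.Build (subgrp F) BF BF_inv.
HB.instance Definition _ := isCommClosed.Build (subgrp F) BF BF_comm.

Definition k_of : nat := (F2_rank Fbar)./2.

End CommutatorForm.

Arguments kerm {R n} F _.
Arguments BF {R n} F _.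

Section Eigenspaces.
Variables (R : realType) (n : nat).

(* Only the values of chi on S matter. *)
Definition simult_eigenspace (S : orth R n -> Prop) (U : {vspace 'cV[R]_n}) :=
  U != 0%VS /\
  exists chi : orth R n -> R,
    forall v, v \in U <-> forall A, S A -> A *m v = (chi A *: v)%R.

(* The preimage of B_F under O(n) -> O(n)/<-I>. *)
Definition BF_lift (F : abelianClosed (PO R n)) (A : orth R n) :=
  exists2 x : subgrp F, x \in BF F & po_proj A = sgval x.

(* V lists the distinct simultaneous eigenspaces of the preimage of B_F, those
   of dimension 2^k first. *)
Definition eigenspace_ordering (F : abelianClosed (PO R n)) (s0 s1 : nat)
    (V : 'I_(s0 + s1) -> {vspace 'cV[R]_n}) :=
  [/\ injective V,
      forall U, simult_eigenspace (BF_lift F) U <-> exists i, V i = U,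
      forall i : 'I_s0, \dim (V (lshift s1 i)) = (2 ^ k_of F)%N
    & forall j : 'I_s1, \dim (V (rshift s0 j)) = (2 ^ (k_of F).+1)%N].

Variables (F : abelianClosed (PO R n)) (s0 s1 : nat).
Variable V : 'I_(s0 + s1) -> {vspace 'cV[R]_n}.

(* mu_of i x = false stands for mu_i(x) = 1 and true for mu_i(x) = -1: the square
   of A restricted to V_i is 1 or -1 for every A with [A] = x. *)
Definition mu_of (i : 'I_s0) (x : subgrp F) : bool :=
  ~~ `[< forall A, po_proj A = sgval x ->
         forall v, v \in V (lshift s1 i) -> A *m (A *m v) = v >].

(* The map induced on F / ker m, since mu_of i is constant on the cosets of
   ker m. *)
Definition mu_bar (i : 'I_s0) (u : Fbar F) : bool := mu_of i (qrepr u).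

Definition S_mu : {pred {perm 'I_s0}} :=
  [pred s : {perm 'I_s0} | `[< forall i, mu_of (s i) = mu_of i >]].

Fact S_mu_mul : mulg_closed S_mu.
Proof.
by move=> s t /asboolP sS /asboolP tS; apply/asboolP => i; rewrite permM tS sS.
Qed.
Fact S_mu_one : 1 \in S_mu.
Proof. by apply/asboolP => i; rewrite perm1. Qed.
Fact S_mu_inv : invg_closed S_mu.
Proof.
by move=> s /asboolP sS; apply/asboolP => i; rewrite -[LHS]sS permKV.
Qed.
HB.instance Definition _ := isMulClosed.Build {perm 'I_s0} S_mu S_mu_mul.
HB.instance Definition _ := isMul1Closed.Build {perm 'I_s0} S_mu S_mu_one.
HB.instance Definition _ := isInvClosed.Build {perm 'I_s0} S_mu S_mu_inv.

Definition Aut_mu : {pred autgrp (Fbar F)} :=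
  [pred f : autgrp (Fbar F) |
    `[< (forall u v, mform_bar (f u) (f v) = mform_bar u v) /\
        exists r : {perm 'I_s0}, forall i u, mu_bar (r i) (f u) = mu_bar i u >]].

Fact Aut_mu_mul : mulg_closed Aut_mu.
Proof.
move=> f g /asboolP[fm [r fr]] /asboolP[gm [t gt]]; apply/asboolP; split.
  by move=> u v; rewrite fm gm.
by exists (t * r) => i u; rewrite permM fr gt.
Qed.
Fact Aut_mu_one : 1 \in Aut_mu.
Proof. by apply/asboolP; split=> //; exists 1 => i u; rewrite perm1. Qed.
Fact Aut_mu_inv : invg_closed Aut_mu.
Proof.
move=> f /asboolP[fm [r fr]]; apply/asboolP; split.
  by move=> u v; rewrite -fm !aut_invK.
by exists r^-1 => i u; rewrite -fr permKV aut_invK.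
Qed.
HB.instance Definition _ := isMulClosed.Build (autgrp (Fbar F)) Aut_mu Aut_mu_mul.
HB.instance Definition _ := isMul1Closed.Build (autgrp (Fbar F)) Aut_mu Aut_mu_one.
HB.instance Definition _ := isInvClosed.Build (autgrp (Fbar F)) Aut_mu Aut_mu_inv.

(* A = \sum_i (-1)^(e i) id_(V i), as R^n is the direct sum of the V i. *)
Definition acts_by_signs (e : {ffun 'I_(s0 + s1) -> bool}) (A : orth R n) :=
  forall i v, v \in V i -> A *m v = ((-1) ^+ e i *: v)%R.

Definition perm_coords (s : {perm 'I_s0}) (e : {ffun 'I_(s0 + s1) -> bool}) :
    {ffun 'I_(s0 + s1) -> bool} :=
  [ffun i => match split i with
             | inl i0 => e (lshift s1 (s i0))
             | inr _ => e i
             end].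

(* The first s0 coordinates are permuted as in perm_signs. The matrices
   acts_by_signs e are exactly the elements of the preimage of B_F, so this
   determines phi. *)
Definition permutes_coords
    (phi : {multiplicative subgrp S_mu -> autgrp (subgrp (BF F))}) :=
  forall (s : subgrp S_mu) (b : subgrp (BF F)),
    exists A A' e,
      [/\ po_proj A = sgval (sgval b), acts_by_signs e A,
          po_proj A' = sgval (sgval (phi s b))
        & acts_by_signs (perm_coords (sgval s) e) A'].

End Eigenspaces.

Arguments Aut_mu {R n} F {s0 s1} V _.

(* Main.v *)
From HB Require Import structures.
From mathcomp Require Import all_boot all_order all_fingroup all_algebra alt.
From mathcomp Require Import boolp classical_sets reals.
From mathcomp Require Import complex ring lra.
Require Import Defs.

(** Let E be the preimage of F in O(n). Since F is maximal abelian, E is a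
    maximal set of orthogonal matrices that commute pairwise up to sign
    ([lifted_max]): an orthogonal matrix that commutes up to sign with all of E
    belongs to E. The proof takes place inside the matrix algebra, through E and
    its commutant.

    The symmetric idempotents P of the commutant correspond, by P |-> 1 - 2P, to
    the elements of the preimage of B_F, so the minimal ones are the orthogonal
    projections P_i onto the eigenspaces V_i ([frame_exists]). A form of Schur's
    lemma ([schur_sym], [commutant_atom]) shows that the commutant of E acts on
    V_i as R or as R + R J_i, with J_i a skew complex structure; both cases are
    treated together by putting J_i = 0 in the first. Schur orthogonality gives
    (dim V_i)^2 = |F / ker m| * c_i^2, where c_i in {1, 2} is the dimension
    of that commutant ([sqr_mxtrace_atom]). Hence the eigenspaces of dimension 2^k
    are those of real type and the ones of dimension 2^(k+1) those of complex
    type ([frame_J]).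

    An orthogonal matrix g that normalises E permutes the P_i, preserves types,
    and sends J_i to a complex structure of the same kind, which is plus or minus
    some J_j ([normalizer_perm], [normalizer_J]). The permutation of the complex
    eigenspaces together with these signs is an element of the signed permutation
    group, and g also acts on F / ker m, preserving m and permuting the mu_i.
    This is the map p ([weyl_action_exists]).

    All elements of the normaliser are obtained by gluing: if T_i maps V_i
    isometrically onto V_(pi i) and intertwines a lift of u with a lift of f u, up
    to the commutant, for every u in F / ker m, then the sum of the T_i normalises
    E and induces f and pi ([normalizer_of_family]). Such T_i exist as soon as f
    preserves m and is compatible with the mu_i, and J_i can be sent to either of
    J_(pi i), - J_(pi i) ([intertwiner_exists]). Indeed, let X_u be a lift of u and
    Y_u one of f u, multiplied by elements of the commutant so that their squares
    agree; the operators T |-> +- Y_u T X_u are commuting involutions, and a joint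
    eigenvector is an intertwiner up to signs, hence a multiple of an isometry by
    Schur's lemma. This proves that p is onto.

    In the kernel of p, a homomorphism eta from F / ker m to B_F is realised by
    x |-> eta(x) x. The element realising it acts on each V_i as some matrix of E,
    because every character of F / ker m is of the form m(c, -)
    ([character_mform], [hom_realized]). The group S_mu is split by fixing one
    eigenspace in each class of equal mu_i and an isometry Th_i from it to each
    V_i of the class: the matrices with blocks Th_j Th_i^T compose like the
    permutations ([S_mu_section_exists]). Conversely, if an element of the
    kernel fixes all the P_i and J_i, conjugation by it fixes the commutant, and
    in particular the squares of the elements of E, so it multiplies every x of F
    by an element of B_F that depends on the class of x only
    ([kernel_hom_exists]). *)

Set Implicit Arguments.
Unset Strict Implicit.
Unset Printing Implicit Defensive.

Import Order.TTheory GRing.Theory Num.Theory.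

(** * Real linear algebra *)

Section RealLinearAlgebra.
Local Open Scope ring_scope.
Variable R : rcfType.

Lemma half2 (W : lmodType R) (x : W) : 2%:R^-1 *: (x + x) = x.
Proof. by rewrite -mulr2n -scaler_nat scalerA mulVf ?scale1r // pnatr_eq0. Qed.

Lemma trmxZ m n c (M : 'M[R]_(m, n)) : (c *: M)^T = c *: M^T.
Proof. by rewrite linearZ. Qed.

Lemma signZK (V : lmodType R) (e : bool) (x : V) : (-1) ^+ e *: ((-1) ^+ e *: x) = x.
Proof. by rewrite scalerA -expr2 sqrr_sign scale1r. Qed.

Lemma eq_mulmx_col m n (M N : 'M[R]_(m, n)) : (forall x : 'cV[R]_n, M *m x = N *m x) -> M = N.
Proof.
move=> MN; apply/matrixP => i j.
by have /colP/(_ i) := MN (delta_mx j 0); rewrite -!colE !mxE.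
Qed.

Lemma mul_delta_mxE n (A B : 'M[R]_n) k l i j : (A *m delta_mx k l *m B) i j = A i k * B l j.
Proof.
rewrite -(mul_delta_mx (0 : 'I_1)) mulmxA -colE -mulmxA -rowE mxE big_ord1.
by rewrite !mxE.
Qed.

Lemma mxtrace_mul_delta n (A : 'M[R]_n) k l : \tr (A *m delta_mx k l) = A l k.
Proof.
rewrite -(mul_delta_mx (0 : 'I_1)) mulmxA mxtrace_mulC mulmxA -rowE -colE.
by rewrite trace_mx11 !mxE.
Qed.

Lemma mxtrace_gram m n (M : 'M[R]_(m, n)) :
  \tr (M^T *m M) = \sum_j \sum_i M i j ^+ 2.
Proof.
by apply: eq_bigr => j _; rewrite mxE; apply: eq_bigr => i _; rewrite mxE.
Qed.

Lemma mxtrace_gram_ge0 m n (M : 'M[R]_(m, n)) : 0 <= \tr (M^T *m M).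
Proof.
by rewrite mxtrace_gram sumr_ge0 // => j _; rewrite sumr_ge0 // => i _; apply: sqr_ge0.
Qed.

Lemma mxtrace_gram_eq0 m n (M : 'M[R]_(m, n)) : (\tr (M^T *m M) == 0) = (M == 0).
Proof.
apply/eqP/eqP=> [|->]; last by rewrite mulmx0 mxtrace0.
rewrite mxtrace_gram => /psumr_eq0P M0; apply/matrixP => i j; rewrite mxE.
have /psumr_eq0P Mj : \sum_i M i j ^+ 2 = 0.
  by apply: M0 => // l _; rewrite sumr_ge0 // => l' _; apply: sqr_ge0.
by apply/eqP; rewrite -sqrf_eq0; apply/eqP/Mj => // l _; apply: sqr_ge0.
Qed.

Lemma mxtrace_gram_gt0 m n (M : 'M[R]_(m, n)) : (0 < \tr (M^T *m M)) = (M != 0).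
Proof. by rewrite lt_def mxtrace_gram_ge0 mxtrace_gram_eq0 andbT. Qed.

(** The projection is the Gram formula B (B^T B)^-1 B^T for a matrix B whose
    columns form a basis of V; its trace is the rank. *)
Lemma orth_projection_exists n (V : {vspace 'cV[R]_n}) :
  exists P : 'M[R]_n, [/\ P^T = P, P *m P = P,
    forall v, v \in V <-> P *m v = v & \tr P = (\dim V)%:R].
Proof.
pose B := \matrix_(i < n, j < \dim V) (vbasis V)`_j i 0.
have BE (x : 'cV_(\dim V)) : B *m x = \sum_j x j 0 *: (vbasis V)`_j.
  apply/colP=> i; rewrite mxE summxE; apply: eq_bigr => j _.
  by rewrite !mxE mulrC.
pose G := B^T *m B.
have GT : G^T = G by rewrite trmx_mul trmxK.
have Gu : G \in unitmx.
  rewrite -row_free_unit; apply: inj_row_free => x xG.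
  have : (B *m x^T) = 0.
    apply/eqP; rewrite -mxtrace_gram_eq0 trmx_mul trmxK mulmxA.
    by rewrite -[x *m _ *m _]mulmxA xG mul0mx mxtrace0.
  have /freeP Vfree := basis_free (vbasisP V); rewrite BE => /Vfree x0.
  by apply/rowP => j; have := x0 j; rewrite !mxE.
exists (B *m invmx G *m B^T); split.
- by rewrite !trmx_mul trmxK trmx_inv GT mulmxA.
- by rewrite !mulmxA -[_ *m B^T *m B]mulmxA -/G mulmxKV.
- move=> v; split=> [vV|<-].
    have -> : v = B *m (\col_j coord (vbasis V) j v).
      rewrite BE {1}(coord_vbasis vV); apply: eq_bigr => j _; by rewrite mxE.
    by rewrite !mulmxA -[_ *m B^T *m B]mulmxA -/G mulmxKV.
  rewrite -!mulmxA BE; apply: memv_suml => j _; apply/memvZ.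
  by apply: vbasis_mem; apply: mem_nth; rewrite size_tuple.
- by rewrite mxtrace_mulC mulmxA -/G mulmxV // mxtrace1.
Qed.

(** This is the spectral theorem on the range of P. The compression of S to
    that range has a complex eigenvector; its real and imaginary parts span an
    S-invariant subspace on which S acts by a scaled rotation, and a symmetric
    operator cannot rotate. *)
Lemma sym_eigenvector n (S P : 'M[R]_n) :
    S^T = S -> P *m P = P -> S *m P = S -> P != 0 ->
  exists c, exists2 v : 'rV[R]_n, v != 0 & v *m P = v /\ v *m S = c *: v.
Proof.
move=> ST PP SP Pn0; pose U := row_base P.
have Uf : row_free U by rewrite row_base_free.
have UP : U *m P = U.
  have /submxP[D ->] : (U <= P)%MS by rewrite eq_row_base.
  by rewrite -mulmxA PP.
have /submxP[D US] : (U *m S <= U)%MS by rewrite eq_row_base -SP mulmxA submxMl.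
have rn0 : (0 < \rank P)%N by rewrite lt0n mxrank_eq0.
pose toC := real_complex R.
(* D is the matrix of S on the range of P in the basis U; x + i y is an
   eigenvector of D for the eigenvalue a + i b. *)
have /closed_rootP[z zr] : size (map_poly toC (char_poly D)) != 1.
  by rewrite size_map_poly size_char_poly eqSS -lt0n.
have /eigenvalueP[w wD wn0] : eigenvalue (map_mx toC D) z.
  by rewrite eigenvalue_root_char -map_char_poly.
pose a := complex.Re z; pose b := complex.Im z.
pose x := map_mx (@complex.Re R) w; pose y := map_mx (@complex.Im R) w.
have wDE j : \sum_i w 0 i * toC (D i j) = z * w 0 j.
  move/rowP/(_ j): wD; rewrite !mxE => <-.
  by apply: eq_bigr => i _; rewrite mxE.
have xD : x *m D = a *: x - b *: y.
  apply/rowP => j; move/(congr1 (@complex.Re R)): (wDE j).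
  rewrite (big_morph (@complex.Re R) (id1 := 0) (op1 := +%R)) //; last by move=> [? ?] [? ?].
  rewrite !mxE {1}/a {1}/b; case: (z) (w 0 j) => [z1 z2] [w1 w2] /= <-.
  by apply: eq_bigr => i _; rewrite mxE /=; case: (w 0 i) => w3 w4 /=; rewrite mulr0 subr0.
have yD : y *m D = b *: x + a *: y.
  apply/rowP => j; move/(congr1 (@complex.Im R)): (wDE j).
  rewrite (big_morph (@complex.Im R) (id1 := 0) (op1 := +%R)) //; last by move=> [? ?] [? ?].
  rewrite !mxE {1}/a {1}/b; case: (z) (w 0 j) => [z1 z2] [w1 w2] /=; rewrite addrC => <-.
  by apply: eq_bigr => i _; rewrite mxE /=; case: (w 0 i) => w3 w4 /=; rewrite mulr0 add0r mulrC.
pose v1 := x *m U; pose v2 := y *m U.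
have v1S : v1 *m S = a *: v1 - b *: v2.
  by rewrite -mulmxA US mulmxA xD mulmxBl -!scalemxAl.
have v2S : v2 *m S = b *: v1 + a *: v2.
  by rewrite -mulmxA US mulmxA yD mulmxDl -!scalemxAl.
have vn0 : (v1 != 0) || (v2 != 0).
  rewrite -negb_and; apply: contraNN wn0 => /andP[/eqP v10 /eqP v20].
  have x0 : x = 0 by apply: (row_free_inj Uf); rewrite mul0mx.
  have y0 : y = 0 by apply: (row_free_inj Uf); rewrite mul0mx.
  apply/eqP/rowP => j; move/rowP/(_ j): x0; move/rowP/(_ j): y0.
  by rewrite !mxE; case: (w 0 j) => ? ? /= -> ->.
(* Symmetry of S compares v1 S v2^T with v2 S v1^T and gives b (|v1|^2 +
   |v2|^2) = 0. *)
have b0 : b = 0.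
  have sym : v1 *m S *m v2^T = (v2 *m S *m v1^T)^T.
    by rewrite (trmx_mul (v2 *m S)) trmxK (trmx_mul v2) ST mulmxA.
  move: sym; rewrite v1S v2S mulmxBl mulmxDl -!scalemxAl linearD /= !linearZ /=.
  rewrite (trmx_mul v1) (trmx_mul v2) !trmxK addrC => /addIr /eqP.
  rewrite eq_sym scalerN -addr_eq0 -scalerDr scaler_eq0 => /orP[/eqP //|].
  move=> /eqP /(congr1 mxtrace); rewrite mxtrace0 mxtraceD.
  have tr v : \tr (v *m v^T) = \tr (v^T^T *m v^T) :> R by rewrite trmxK.
  rewrite !tr => /eqP; rewrite paddr_eq0 ?mxtrace_gram_ge0 // !mxtrace_gram_eq0.
  by rewrite !trmx_eq0 => /andP[/eqP v20 /eqP v10]; rewrite v10 v20 eqxx in vn0.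
exists a; have v1P : v1 *m P = v1 by rewrite -mulmxA UP.
have v2P : v2 *m P = v2 by rewrite -mulmxA UP.
case/orP: vn0 => vn0; [exists v1|exists v2] => //; split=> //.
  by rewrite v1S b0 scale0r subr0.
by rewrite v2S b0 scale0r add0r.
Qed.

(** The involutions are treated one at a time: unless L w = - w, the vector w
    + L w is nonzero and fixed by L, and it stays an eigenvector of the
    involutions already treated. The predicate U restricts the argument to a
    subspace on which alone the L i need to be commuting involutions. *)
Lemma joint_sign_eigenvector (W : lmodType R) (I : eqType) (L : I -> {linear W -> W})
    (U : W -> Prop) (l : seq I) (w0 : W) :
    (forall c x y, U x -> U y -> U (c *: x + y)) ->
    (forall i x, U x -> U (L i x)) ->
    (forall i x, U x -> L i (L i x) = x) ->
    (forall i j x, U x -> L i (L j x) = L j (L i x)) ->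
    U w0 -> w0 != 0 ->
  exists2 w, w != 0 & U w /\ forall i, i \in l -> exists e : bool, L i w = (-1) ^+ e *: w.
Proof.
move=> Uadd UL L2 LC Uw0 w0n0; elim: l => [|a l [w wn0 [Uw wl]]].
  by exists w0.
(* The components of w in the two eigenspaces of L a, up to a factor; their
   sum is 2 w. *)
pose we (e : bool) := (-1) ^+ e *: L a w + w.
have [e wen0] : exists e, we e != 0.
  have [wf0|] := eqVneq (we false) 0; last by exists false.
  exists true; apply: contraNneq wn0 => wt0.
  have : we false + we true = 0 by rewrite wf0 wt0 addr0.
  rewrite /we expr0 expr1 scale1r scaleN1r addrACA subrr add0r -mulr2n.
  by rewrite -scaler_nat => /eqP; rewrite scaler_eq0 pnatr_eq0.
exists (we e) => //; split=> [|i]; first by apply: Uadd => //; apply: UL.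
rewrite inE => /predU1P[->|/wl[d Liw]].
  exists e; rewrite /we linearP L2 // scalerDr scalerA -expr2 sqrr_sign scale1r.
  by rewrite addrC.
by exists d; rewrite /we linearP LC // Liw linearZ /= scalerDr !scalerA mulrC.
Qed.

End RealLinearAlgebra.

(** * Maximal families commuting up to sign, and Schur's lemma *)

Section MaximalCommuting.
Local Open Scope ring_scope.
Variables (R : rcfType) (n : nat).
Implicit Types (A B M P Q S : 'M[R]_n).

(** The properties of the preimage in O(n) of a maximal abelian subgroup. The
    last field is the source of all the existence results: in particular the
    orthogonal elements of the commutant belong to E. *)
Record max_commuting (E : 'M[R]_n -> Prop) : Prop := MaxCommuting {
  mc_orth A : E A -> A^T *m A = 1%:M;
  mc_one : E 1%:M;
  mc_mul A B : E A -> E B -> E (A *m B);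
  mc_tr A : E A -> E A^T;
  mc_comm A B : E A -> E B -> exists e : bool, A *m B = (-1) ^+ e *: (B *m A);
  mc_max M : M^T *m M = 1%:M ->
    (forall B, E B -> exists e : bool, M *m B = (-1) ^+ e *: (B *m M)) -> E M
}.

Variables (E : 'M[R]_n -> Prop) (hE : max_commuting E).

Lemma mc_orthT A : E A -> A *m A^T = 1%:M.
Proof. by move/(mc_orth hE)/mulmx1C. Qed.

Definition cent M := forall A, E A -> A *m M = M *m A.

Lemma cent1 : cent 1%:M.
Proof. by move=> A _; rewrite mulmx1 mul1mx. Qed.
Lemma centM M N : cent M -> cent N -> cent (M *m N).
Proof. by move=> cM cN A EA; rewrite mulmxA cM // -mulmxA cN // mulmxA. Qed.
Lemma centD M N : cent M -> cent N -> cent (M + N).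
Proof. by move=> cM cN A EA; rewrite mulmxDr mulmxDl cM ?cN. Qed.
Lemma centZ c M : cent M -> cent (c *: M).
Proof. by move=> cM A EA; rewrite -scalemxAr -scalemxAl cM. Qed.
Lemma centN M : cent M -> cent (- M).
Proof. by move=> cM; rewrite -scaleN1r; apply: centZ. Qed.
Lemma centB M N : cent M -> cent N -> cent (M - N).
Proof. by move=> cM cN; apply/centD/centN. Qed.
Lemma cent_sum (I : finType) (M : I -> 'M[R]_n) : (forall i, cent (M i)) -> cent (\sum_i M i).
Proof.
move=> cM; elim/big_ind: _ => [A _||i _ //]; first by rewrite mulmx0 mul0mx.
exact: centD.
Qed.
Lemma centT M : cent M -> cent M^T.
Proof.
move=> cM A EA; apply: trmx_inj; rewrite !trmx_mul trmxK cM //.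
exact: mc_tr.
Qed.

Lemma cent_orth_mem M : M^T *m M = 1%:M -> cent M -> E M.
Proof.
move=> MO cM; apply: (mc_max hE) => // B EB; exists false.
by rewrite expr0 scale1r cM.
Qed.

(** The symmetric idempotents of the commutant. They encode the preimage of
    B_F by P |-> 1 - 2P. *)
Definition cproj P := [/\ P^T = P, P *m P = P & cent P].

Lemma cprojC P : cproj P -> cproj (1%:M - P).
Proof.
case=> PT PP cP; split; last by apply: centB => //; apply: cent1.
  by rewrite linearB /= tr_scalar_mx PT.
by rewrite mulmxBl mul1mx mulmxBr PP mulmx1 subrr subr0.
Qed.

Lemma cproj_refl P : cproj P -> E (1%:M - P - P).
Proof.
case=> PT PP cP; apply: cent_orth_mem; last by do 2!apply: centB => //; apply: cent1.
have -> : (1%:M - P - P)^T = 1%:M - P - P by rewrite !linearB /= tr_scalar_mx PT.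
rewrite !mulmxBl !mulmxBr !mul1mx mulmx1 PP.
by rewrite !subrr !sub0r !opprK !subrK.
Qed.

(** The reflection 1 - 2P is orthogonal and in the commutant, so it belongs to
    E by maximality; hence it commutes with the commutant. This is why the
    symmetric idempotents of the commutant are central in it. *)
Lemma cproj_cent P M : cproj P -> cent M -> P *m M = M *m P.
Proof.
move=> /cproj_refl EP cM; have := cM _ EP.
rewrite !mulmxBl !mulmxBr mul1mx mulmx1 -!addrA => /addrI.
rewrite -!opprD -!mulr2n -!scaler_nat => /oppr_inj.
by apply: scalerI; rewrite pnatr_eq0.
Qed.

Lemma cproj_mul P Q : cproj P -> cproj Q -> cproj (P *m Q).
Proof.
move=> hP hQ; case: (hP) (hQ) => PT PP cP [QT QQ cQ]; split; last exact: centM.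
  by rewrite trmx_mul PT QT cproj_cent.
by rewrite mulmxA -[P *m Q *m P]mulmxA (cproj_cent hQ cP) mulmxA PP -mulmxA QQ.
Qed.

(** Minimal nonzero elements of [cproj], the order being inclusion of ranges.
    They will be the projections onto the simultaneous eigenspaces. *)
Definition atom P := [/\ cproj P, P != 0 &
  forall Q, cproj Q -> Q *m P = 0 \/ Q *m P = P].

(** Induction on the rank: a Q that is not itself minimal is cut by some Q'
    into a nonzero projection of smaller rank. *)
Lemma atom_below Q : cproj Q -> Q != 0 -> exists2 P, atom P & Q *m P = P.
Proof.
have [r] := ubnP (\rank Q); elim: r Q => // r IHr Q rQ hQ Qn0.
have [[Q' [hQ' n0 nQ]]|na] := pselect (exists Q', [/\ cproj Q', Q' *m Q != 0 & Q' *m Q != Q]).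
  have hP := cproj_mul hQ' hQ; have [_ PP _] := hP; have [_ QQ cQ] := hQ.
  have QP : Q *m (Q' *m Q) = Q' *m Q by rewrite mulmxA -(cproj_cent hQ' cQ) -mulmxA QQ.
  have [|P aP PE] := IHr _ _ hP n0; last first.
    by exists P => //; rewrite -PE mulmxA QP.
  rewrite ltnS in rQ; apply: leq_trans rQ; rewrite ltn_neqAle mxrankM_maxr andbT.
  apply: contra nQ => rE; have /submxP[D DE] : (Q <= Q' *m Q)%MS.
    by rewrite -(mxrank_leqif_sup (submxMl Q' Q)).
  move: (Q' *m Q) PP QP DE => N PP QP DE.
  by rewrite -QP DE -mulmxA PP.
exists Q; last by case: hQ.
split=> // Q' hQ'; apply: contrapT => /not_orP[/eqP n0 /eqP n1].
by apply: na; exists Q'.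
Qed.

(** The eigenspace of S for an eigenvalue c, inside the range of P, is stable
    under E, so the projection Q onto it belongs to [cproj]; minimality of P
    leaves no room for Q other than P itself. *)
Lemma schur_sym P S : atom P -> S^T = S -> cent S -> S *m P = S ->
  exists c, S = c *: P.
Proof.
move=> [hP Pn0 Pmin] ST cS SP; have [PT PP cP] := hP.
have [c [v vn0 [vP vS]]] := sym_eigenvector ST PP SP Pn0; exists c.
pose V := (lker (linfun (mulmx (P - 1%:M))) :&: lker (linfun (mulmx (S - c%:M))))%VS
  : {vspace 'cV[R]_n}.
have VP x : x \in V <-> P *m x = x /\ S *m x = c *: x.
  rewrite memv_cap !memv_ker !lfunE /= !mulmxBl mul1mx mul_scalar_mx !subr_eq0.
  by split=> [/andP[/eqP ? /eqP ?]|[/eqP ? /eqP ?]] //; apply/andP.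
have [Q [QT QQ VQ _]] := orth_projection_exists V.
have Qx (x : 'cV_n) : P *m (Q *m x) = Q *m x /\ S *m (Q *m x) = c *: (Q *m x).
  by apply/VP/VQ; rewrite mulmxA QQ.
have QAQ A : E A -> Q *m A *m Q = A *m Q.
  move=> EA; apply: eq_mulmx_col => x; rewrite -!mulmxA; apply/VQ/VP; have [Px Sx] := Qx x.
  by rewrite !mulmxA -cP // -cS // -!mulmxA Px Sx -scalemxAr.
have hQ : cproj Q.
  split=> // A EA; rewrite -QAQ // -[RHS]trmxK trmx_mul QT -(QAQ _ (mc_tr hE EA)).
  by rewrite !trmx_mul trmxK QT mulmxA.
have PQ : P *m Q = Q by apply: eq_mulmx_col => x; rewrite -mulmxA; case: (Qx x).
have QP : Q *m P = Q by rewrite (cproj_cent hQ cP).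
have [Q0|QE] := Pmin Q hQ.
  case/eqP: vn0; apply: trmx_inj; rewrite linear0.
  have /VQ <- : v^T \in V.
    by apply/VP; rewrite -{1}PT -{1}ST -!trmx_mul vP vS linearZ.
  by rewrite -QP Q0 mul0mx.
have {QE QP} QE : Q = P by rewrite -QE QP.
rewrite -SP -QE; apply: eq_mulmx_col => x; rewrite -mulmxA -scalemxAl.
by case: (Qx x).
Qed.

(** The symmetric part of an element of the commutant is a multiple of P by
    [schur_sym]. If there is a nonzero skew element K, then K^T K is a
    positive multiple of P, and K can be rescaled to J with J J = - P.
    Quaternions are excluded by maximality of E: the matrix 1 - P + J is an
    orthogonal element of the commutant, hence in E, so every skew K' of the
    commutant commutes with J; then J K' is symmetric, hence scalar. *)
Lemma commutant_atom P : atom P -> exists J : 'M[R]_n,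
  [/\ cent J, J^T = - J, P *m J = J, J = 0 \/ J *m J = - P &
      forall M, cent M -> P *m M = M -> exists x y, M = x *: P + y *: J].
Proof.
move=> aP; have [hP Pn0 _] := aP; have [PT PP cP] := hP.
(* Any element of the commutant is a multiple of P plus a skew part. *)
have symm M : cent M -> P *m M = M -> exists x, exists K : 'M[R]_n,
    [/\ M = x *: P + K, cent K, K^T = - K & P *m K = K].
  move=> cM PM; have MP : M *m P = M by rewrite -(cproj_cent hP cM).
  have PMT : P *m M^T = M^T by rewrite -{1}PT -trmx_mul MP.
  have MTP : M^T *m P = M^T by rewrite -{1}PT -trmx_mul PM.
  have [|||x xE] := @schur_sym P (2%:R^-1 *: (M + M^T)) aP.
  - by rewrite linearZ linearD /= trmxK addrC.
  - by apply/centZ/centD/centT.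
  - by rewrite -scalemxAl mulmxDl MP MTP.
  exists x, (2%:R^-1 *: (M - M^T)); split.
  - by rewrite -xE -scalerDr addrACA subrr addr0 half2.
  - by apply/centZ/centB/centT.
  - by rewrite linearZ linearB /= trmxK -scalerN opprB.
  - by rewrite -scalemxAr mulmxBr PM PMT.
have [[K [cK KT PK Kn0]]|none] :=
    pselect (exists K : 'M[R]_n, [/\ cent K, K^T = - K, P *m K = K & K != 0]); last first.
  exists 0; split=> [A _|||| M cM PM]; rewrite ?mulmx0 ?mul0mx ?linear0 ?oppr0 //; first by left.
  have [x [K [-> cK KT PK]]] := symm M cM PM; exists x, 0; rewrite scaler0.
  congr (_ + _); apply: contrapT => /eqP Kn0; apply: none; by exists K.
have KP : K *m P = K by rewrite -(cproj_cent hP cK).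
have [|||c cE] := @schur_sym P (K^T *m K) aP.
- by rewrite trmx_mul trmxK.
- by apply: centM => //; apply: centT.
- by rewrite -mulmxA KP.
have c0 : 0 < c.
  have : 0 < \tr (K^T *m K) by rewrite mxtrace_gram_gt0.
  rewrite cE mxtraceZ pmulr_lgt0 // -PP -{1}PT mxtrace_gram_gt0 //.
pose J : 'M[R]_n := (Num.sqrt c)^-1 *: K.
have s0 : Num.sqrt c != 0 by rewrite sqrtr_eq0 -ltNge.
have cJ : cent J by apply: centZ.
have JT : J^T = - J by rewrite linearZ /= KT scalerN.
have PJ : P *m J = J by rewrite -scalemxAr PK.
have JP : J *m P = J by rewrite -scalemxAl KP.
have fr_JTJ : J^T *m J = P.
  have -> : J^T = (Num.sqrt c)^-1 *: K^T by rewrite linearZ.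
  rewrite /J -scalemxAl -scalemxAr cE !scalerA.
  by rewrite -[X in _ * _ * X]sqr_sqrtr ?ltW // expr2 mulrA mulfVK // mulVf // scale1r.
have JJ : J *m J = - P by rewrite -fr_JTJ JT mulNmx opprK.
exists J; split=> //; first by right.
move=> M cM PM; have [x [K' [-> cK' K'T PK']]] := symm M cM PM.
have K'P : K' *m P = K' by rewrite -(cproj_cent hP cK').
have EJ : E (1%:M - P + J).
  have cC : cent (1%:M - P + J) by apply: centD cJ; apply: centB cP; apply: cent1.
  apply: cent_orth_mem cC.
  have [CT CC _] : cproj (1%:M - P) by apply: cprojC.
  have CP : (1%:M - P) *m P = 0 by rewrite mulmxBl PP mul1mx subrr.
  have CJ : (1%:M - P) *m J = 0 by rewrite -PJ mulmxA CP mul0mx.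
  have JC : J *m (1%:M - P) = 0 by rewrite mulmxBr mulmx1 JP subrr.
  have -> : (1%:M - P + J)^T = 1%:M - P - J by rewrite linearD /= CT JT.
  by rewrite mulmxDl mulmxDr [X in _ + X]mulmxDr CC CJ mulNmx JC mulNmx JJ opprK oppr0 addr0 add0r subrK.
have JK' : J *m K' = K' *m J.
  have := cK' _ EJ; rewrite mulmxDl mulmxDr mulmxBl mulmxBr mul1mx mulmx1 PK' K'P.
  by move/addrI.
have [|||y yE] := @schur_sym P (J *m K') aP.
- by rewrite trmx_mul K'T JT mulNmx mulmxN opprK JK'.
- exact: centM.
- by rewrite -mulmxA K'P.
exists x, (- y); congr (_ + _).
have : J *m (J *m K') = J *m (y *: P) by rewrite yE.
by rewrite mulmxA JJ mulNmx PK' -scalemxAr JP => /(congr1 -%R); rewrite opprK scaleNr.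
Qed.

End MaximalCommuting.

(** * The commutant on the minimal central projections *)

Section Frame.
Local Open Scope ring_scope.
Variables (R : rcfType) (n : nat) (E : 'M[R]_n -> Prop).
Hypothesis hE : max_commuting E.
Implicit Types (A B M S T : 'M[R]_n).

(** A complete system of atoms, each with the imaginary unit of its commutant.
    Taking J a = 0 when that commutant is R allows the two types of eigenspace
    to be treated together. *)
Record frame (I : finType) (P J : I -> 'M[R]_n) : Prop := Frame {
  fr_atom a : atom E (P a);
  fr_orth a b : a != b -> P a *m P b = 0;
  fr_sum : \sum_a P a = 1%:M;
  fr_centJ a : cent E (J a);
  fr_JT a : (J a)^T = - J a;
  fr_PJ a : P a *m J a = J a;
  fr_JJ a : J a = 0 \/ J a *m J a = - P a;
  fr_comm a M : cent E M -> P a *m M = M -> exists x y, M = x *: P a + y *: J a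
}.

Variables (I : finType) (P J : I -> 'M[R]_n).
Hypothesis fr : frame P J.
Implicit Types a b : I.

Lemma fr_cproj a : cproj E (P a). Proof. by case: (fr_atom fr a). Qed.
Lemma fr_PT a : (P a)^T = P a. Proof. by case: (fr_cproj a). Qed.
Lemma fr_PP a : P a *m P a = P a. Proof. by case: (fr_cproj a). Qed.
Lemma fr_cent a : cent E (P a). Proof. by case: (fr_cproj a). Qed.
Lemma fr_neq0 a : P a != 0. Proof. by case: (fr_atom fr a). Qed.
Lemma fr_mem_comm A a : E A -> A *m P a = P a *m A.
Proof. exact: fr_cent. Qed.
Lemma fr_cent_comm M a : cent E M -> P a *m M = M *m P a.
Proof. move=> cM; exact: (cproj_cent hE (fr_cproj a) cM). Qed.
Lemma fr_JP a : J a *m P a = J a.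
Proof. by rewrite -(fr_cent_comm a (fr_centJ fr a)) (fr_PJ fr). Qed.

Lemma fr_inj a b : P a *m P b != 0 -> a = b.
Proof. by apply: contraNeq => /(fr_orth fr) ->. Qed.

Lemma frame_decomp M : M = \sum_a M *m P a.
Proof. by rewrite -mulmx_sumr (fr_sum fr) mulmx1. Qed.

Lemma frame_eq M N : (forall a, M *m P a = N *m P a) -> M = N.
Proof. by move=> MN; rewrite (frame_decomp M) (frame_decomp N); apply: eq_bigr. Qed.

Lemma frame_cent M : (forall a, cent E (M *m P a)) -> cent E M.
Proof. by move=> cM; rewrite (frame_decomp M); apply: cent_sum. Qed.

(** The complex number x + i y acting on the range of P a; in real type only x
    counts. *)
Definition cscal a (x y : R) := x *: P a + y *: J a.

Lemma cent_cscal a x y : cent E (cscal a x y).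
Proof.
by apply: centD; apply: centZ; [apply: fr_cent | apply: (fr_centJ fr)].
Qed.

Lemma cent_coord M a : cent E M -> exists x y, M *m P a = cscal a x y.
Proof.
move=> cM; apply: (fr_comm fr); first by apply: centM => //; apply: fr_cent.
by rewrite mulmxA fr_cent_comm // -mulmxA fr_PP.
Qed.

Lemma cscal_P a x y : cscal a x y *m P a = cscal a x y.
Proof. by rewrite mulmxDl -!scalemxAl fr_PP fr_JP. Qed.

Lemma P_cscal a x y : P a *m cscal a x y = cscal a x y.
Proof. by rewrite mulmxDr -!scalemxAr fr_PP (fr_PJ fr). Qed.

Lemma cscal_tr a x y : (cscal a x y)^T = cscal a x (- y).
Proof. by rewrite /cscal linearD !linearZ /= fr_PT (fr_JT fr) scalerN scaleNr. Qed.

Lemma cscalM a x y z t : J a *m J a = - P a ->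
  cscal a x y *m cscal a z t = cscal a (x * z - y * t) (x * t + y * z).
Proof.
move=> JJ; rewrite mulmxDl !mulmxDr -!scalemxAl -!scalemxAr !scalerA.
rewrite fr_PP fr_JP (fr_PJ fr) JJ scalerN /cscal scalerBl scalerDl.
by rewrite [RHS]addrACA [X in _ = _ + X]addrC.
Qed.

Lemma cscalC a x y z t : cscal a x y *m cscal a z t = cscal a z t *m cscal a x y.
Proof.
case: (fr_JJ fr a) => [J0|JJ]; last first.
  by rewrite !cscalM //; congr cscal; ring.
by rewrite /cscal J0 !scaler0 !addr0 -!scalemxAl -!scalemxAr !scalerA mulrC.
Qed.

Lemma cscal_gram a x y : x ^+ 2 + y ^+ 2 = 1 -> J a *m J a = - P a \/ y = 0 ->
  (cscal a x y)^T *m cscal a x y = P a.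
Proof.
move=> xy1 [JJ|y0].
  rewrite cscal_tr cscalM // mulNr opprK -!expr2 xy1 mulNr [y * x]mulrC subrr.
  by rewrite /cscal scale1r scale0r addr0.
rewrite cscal_tr y0 oppr0 /cscal scale0r addr0 -scalemxAl -scalemxAr scalerA fr_PP.
by rewrite -expr2 -[x ^+ 2]addr0 -[X in _ + X](expr0n _ 2) -y0 xy1 scale1r.
Qed.

Lemma cscal_sqrt a x y : x ^+ 2 + y ^+ 2 = 1 -> J a *m J a = - P a ->
  exists p r, p ^+ 2 + r ^+ 2 = 1 /\ cscal a p r *m cscal a p r = cscal a x y.
Proof.
(* The root is obtained from the half-angle formulas, (1 + x + i y) / s with
   s^2 = 2 (1 + x), which break down at x = - 1, where i is a root. *)
move=> xy1 JJ; have [x1|xn1] := eqVneq x (-1).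
  have y0 : y = 0.
    by move: xy1; rewrite x1 sqrrN expr1n -[RHS]addr0 => /addrI/eqP; rewrite sqrf_eq0 => /eqP.
  exists 0, 1; rewrite expr0n expr1n add0r; split=> //.
  by rewrite cscalM // x1 y0 !mul0r mulr1 mulr0 !add0r.
have x1 : 0 < 2%:R * (1 + x).
  have x2 : x ^+ 2 <= 1 by rewrite -xy1 lerDl sqr_ge0.
  have x3 : - 1 <= x by nra.
  by have x4 : - 1 < x by [rewrite lt_def xn1 x3]; lra.
pose s := Num.sqrt (2%:R * (1 + x)).
have s2 : s ^+ 2 = 2%:R * (1 + x) by rewrite sqr_sqrtr // ltW.
have sn0 : s != 0 by rewrite sqrtr_eq0 -ltNge.
have x1n0 : 1 + x != 0 by apply: contraTneq x1 => ->; rewrite mulr0 ltxx.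
have xE : x = s ^+ 2 / 2%:R - 1 by rewrite s2; field.
have y2 : y ^+ 2 = 1 - x ^+ 2 by rewrite -xy1; ring.
exists ((1 + x) / s), (y / s); split.
  by rewrite !expr_div_n y2 s2; field; rewrite x1n0.
rewrite cscalM //; congr cscal.
  rewrite -!expr2 !expr_div_n s2 y2; field; rewrite x1n0 //.
have -> : (1 + x) / s * (y / s) + y / s * ((1 + x) / s) = (1 + x) * y * 2%:R / s ^+ 2.
  by field.
by rewrite s2; field; rewrite x1n0.
Qed.

End Frame.

(** * Isometries intertwining two eigenspaces *)

Section Intertwiner.
Local Open Scope ring_scope.
Variables (R : rcfType) (n : nat) (E : 'M[R]_n -> Prop).
Hypothesis hE : max_commuting E.
Variables (I : finType) (P J : I -> 'M[R]_n).
Hypothesis fr : frame E P J.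
Implicit Types (a b : I) (A B M S T : 'M[R]_n).

Lemma fr_Jcscal a : J a = cscal P J a 0 1.
Proof. by rewrite /cscal scale0r add0r scale1r. Qed.

(** The sign by which A commutes with B enters twice in A A B. *)
Lemma cent_sqr A : E A -> cent E (A *m A).
Proof.
move=> EA B EB; have [e AB] := mc_comm hE EA EB; have [e' BA] := mc_comm hE EB EA.
rewrite mulmxA BA -scalemxAl -mulmxA BA -scalemxAr scalerA -expr2 sqrr_sign.
by rewrite scale1r mulmxA.
Qed.

Lemma mem_cent_coord A a : E A -> cent E A -> exists x y,
  [/\ A *m P a = cscal P J a x y, x ^+ 2 + y ^+ 2 = 1 & J a = 0 -> y = 0].
Proof.
move=> EA cA; have [x [y AE]] := cent_coord hE fr a cA.
have AA : (A *m P a)^T *m (A *m P a) = P a.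
  rewrite trmx_mul (fr_PT fr) !mulmxA -[_ *m A^T *m A]mulmxA (mc_orth hE EA) mulmx1.
  exact: fr_PP fr a.
case: (fr_JJ fr a) => [J0|JJ]; last first.
  exists x, y; split=> //; last first.
    move=> J0; case/eqP: (fr_neq0 fr a); move: JJ; rewrite J0 mul0mx => /esym/eqP.
    by rewrite oppr_eq0 => /eqP.
  move: AA; rewrite AE (cscal_tr fr) (cscalM hE fr) //.
  have -> : x * x - - y * y = x ^+ 2 + y ^+ 2 by ring.
  have -> : x * y + - y * x = 0 by ring.
  rewrite /cscal scale0r addr0 => /eqP; rewrite -subr_eq0 -{2}[P a]scale1r -scalerBl.
  by rewrite scaler_eq0 (negPf (fr_neq0 fr a)) orbF subr_eq0 => /eqP.
exists x, 0; split=> //; first by rewrite AE /cscal J0 !scaler0.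
move: AA; rewrite AE (cscal_tr fr) /cscal J0 !scaler0 !addr0 -scalemxAl.
rewrite -scalemxAr scalerA (fr_PP fr) => /eqP.
rewrite -subr_eq0 -{2}[P a]scale1r -scalerBl.
rewrite scaler_eq0 (negPf (fr_neq0 fr a)) orbF subr_eq0 => /eqP <-.
by rewrite expr0n addr0.
Qed.

(** In complex type A A acts on the range of P a by a unit complex number, and
    multiplying A by a unit complex number zeta changes it by the square of
    zeta; so its value can be prescribed. In real type there is nothing to
    adjust, which is why the value is then part of the hypotheses. *)
Lemma normalise_square A a (q : bool) : E A ->
    (J a = 0 -> A *m A *m P a = (-1) ^+ q *: P a) ->
  exists p r, let zeta := cscal P J a p r in
    zeta^T *m zeta = P a /\ (A *m zeta) *m (A *m zeta) = (-1) ^+ q *: P a.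
Proof.
move=> EA sqA; case: (fr_JJ fr a) => [J0|JJ].
  exists 1, 0; rewrite /cscal scale0r addr0 scale1r /= (fr_PT fr) (fr_PP fr); split=> //.
  by rewrite mulmxA -[_ *m A]mulmxA -(fr_mem_comm fr) // -sqA // -!mulmxA (fr_PP fr).
have [x [y [AE xy1 _]]] := mem_cent_coord a (mc_mul hE EA EA) (cent_sqr EA).
have [|p [r [pr1 prE]]] := @cscal_sqrt _ _ _ hE _ _ _ fr a ((-1) ^+ q * x) (- ((-1) ^+ q * y)) _ JJ.
  by rewrite sqrrN !exprMn sqrr_sign !mul1r.
exists p, r => zeta; split; first by apply: (cscal_gram hE fr) => //; left.
rewrite mulmxA -[_ *m zeta *m A]mulmxA -(cent_cscal fr) // mulmxA -mulmxA.
rewrite -(P_cscal fr) -[P a *m _ *m _]mulmxA mulmxA prE AE (cscalM hE fr) //.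
have -> : x * ((-1) ^+ q * x) - y * - ((-1) ^+ q * y) = (-1) ^+ q * (x ^+ 2 + y ^+ 2) by ring.
have -> : x * - ((-1) ^+ q * y) + y * ((-1) ^+ q * x) = 0 by ring.
by rewrite xy1 mulr1 /cscal scale0r addr0.
Qed.

Variables (K : finType) (X Y : K -> 'M[R]_n).
Hypothesis EX : forall u, E (X u).
Hypothesis EY : forall u, E (Y u).
Hypothesis genX : forall A, E A -> exists u z, cent E z /\ A = X u *m z.
Hypothesis comXY : forall u v, exists e : bool,
  X u *m X v = (-1) ^+ e *: (X v *m X u) /\ Y u *m Y v = (-1) ^+ e *: (Y v *m Y u).

(** Twisting a rank one matrix v w^T by J_a and J_b makes it linear or
    antilinear according to eps. It stays nonzero, since its value at w is a
    positive multiple of v: the correction term contains w^T J_a w, which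
    vanishes because J_a is skew. *)
Lemma nonzero_twist a b (eps : bool) : (J a = 0 <-> J b = 0) ->
  exists2 T, [/\ P b *m T = T, T *m P a = T & T *m J a = (-1) ^+ eps *: (J b *m T)] & T != 0.
Proof.
have vec c : exists2 v : 'cV[R]_n, v != 0 & P c *m v = v.
  have [v vn0] : exists v : 'cV[R]_n, P c *m v != 0.
    apply: contrapT => nv; case/eqP: (fr_neq0 fr c); apply: eq_mulmx_col => v.
    by rewrite mul0mx; apply: contrapT => /eqP vn0; apply: nv; exists v.
  by exists (P c *m v); rewrite // mulmxA (fr_PP fr).
have [v vn0 Pv] := vec b; have [w wn0 Pw] := vec a => Jab.
have wP : w^T *m P a = w^T by rewrite -{1}(fr_PT fr) -trmx_mul Pw.
have wJw : w^T *m J a *m w = 0.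
  have : (w^T *m J a *m w)^T = - (w^T *m J a *m w).
    by rewrite !trmx_mul trmxK (fr_JT fr) mulNmx mulmxN mulmxA.
  have -> : (w^T *m J a *m w)^T = w^T *m J a *m w.
    by apply/matrixP => i j; rewrite mxE !ord1.
  move/eqP; rewrite -subr_eq0 opprK -mulr2n -scaler_nat scaler_eq0 pnatr_eq0 /=.
  by move/eqP.
exists (v *m w^T - (-1) ^+ eps *: (J b *m v *m w^T *m J a)); last first.
  apply/eqP => /(congr1 (fun M => M *m w)); rewrite mul0mx mulmxBl -scalemxAl.
  rewrite -!mulmxA (mulmxA w^T) wJw !mulmx0 scaler0 subr0 mulmxA => /eqP.
  have -> : v *m w^T *m w = \tr (w^T *m w) *: v.
    by rewrite -mulmxA {1}[w^T *m w]mx11_scalar mul_mx_scalar trace_mx11.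
  by rewrite scaler_eq0 mxtrace_gram_eq0 (negPf wn0) (negPf vn0).
split.
- by rewrite mulmxBr -scalemxAr !mulmxA Pv (fr_PJ fr).
- by rewrite mulmxBl -scalemxAl -!mulmxA wP (fr_JP hE fr).
rewrite mulmxBl mulmxBr -scalemxAl -scalemxAr scalerBr signZK -!mulmxA.
case: (fr_JJ fr a) (fr_JJ fr b) => [Ja0|JJa] [Jb0|JJb].
- by rewrite Ja0 Jb0 !mulmx0 !mul0mx !scaler0.
- by have := Jab.1 Ja0 => Jb0; rewrite Ja0 Jb0 !mulmx0 !mul0mx !scaler0.
- by have := Jab.2 Jb0 => Ja0; rewrite Ja0 Jb0 !mulmx0 !mul0mx !scaler0.
rewrite JJa !mulmxN wP !mulmxA JJb !mulNmx Pv scalerN !opprK addrC.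
by [].
Qed.

(** The families X and Y stand for lifts to E of the elements of F / ker m and
    of their images under an isometry for m: hypothesis comXY says that m is
    preserved. The operators T |-> +- Y_u T X_u, for lifts normalised to have
    equal squares, are commuting involutions on the space of matrices T from
    the range of P a to that of P b that are linear or antilinear; a joint
    eigenvector T satisfies the intertwining relations, T^T T then lies in the
    commutant, and T is a multiple of an isometry by Schur's lemma. *)
Lemma intertwiner_exists a b (eps : bool) :
    (J a = 0 <-> J b = 0) ->
    (forall u, J a = 0 -> exists q : bool,
      X u *m X u *m P a = (-1) ^+ q *: P a /\ Y u *m Y u *m P b = (-1) ^+ q *: P b) ->
  exists T, [/\ P b *m T = T, T *m P a = T, T^T *m T = P a,
    T *m J a = (-1) ^+ eps *: (J b *m T) &
    forall u, exists2 z, cent E z & T *m X u = Y u *m z *m T].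
Proof.
move=> Jab sqXY.
(* The data attached to u: the common sign q of the squares and the
   coordinates of the normalising scalars ze on the side of a and zb on the
   side of b. *)
have /choice[zz zzP] u : exists w : (bool * R * R) * (R * R),
    [/\ (cscal P J a w.1.1.2 w.1.2)^T *m cscal P J a w.1.1.2 w.1.2 = P a,
     (cscal P J b w.2.1 w.2.2)^T *m cscal P J b w.2.1 w.2.2 = P b,
     (X u *m cscal P J a w.1.1.2 w.1.2) *m (X u *m cscal P J a w.1.1.2 w.1.2) = (-1) ^+ w.1.1.1 *: P a &
     (Y u *m cscal P J b w.2.1 w.2.2) *m (Y u *m cscal P J b w.2.1 w.2.2) = (-1) ^+ w.1.1.1 *: P b].
  have [q qP] : exists q : bool, J a = 0 ->
      X u *m X u *m P a = (-1) ^+ q *: P a /\ Y u *m Y u *m P b = (-1) ^+ q *: P b.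
    by have [/(sqXY u)[q]|nJ] := pselect (J a = 0); [exists q | exists false].
  have [|p [r [pr1 pr2]]] := @normalise_square (X u) a q (EX u); first by case/qP.
  have [|p' [r' [pr1' pr2']]] := @normalise_square (Y u) b q (EY u); first by case/Jab/qP.
  by exists ((q, p, r), (p', r')).
pose q u := (zz u).1.1.1.
pose ze u := cscal P J a (zz u).1.1.2 (zz u).1.2.
pose zb u := cscal P J b (zz u).2.1 (zz u).2.2.
have [X' X'E] : exists X' : K -> 'M[R]_n, forall u, X' u = X u *m ze u.
  by exists (fun u => X u *m ze u).
have [Y' Y'E] : exists Y' : K -> 'M[R]_n, forall u, Y' u = Y u *m zb u.
  by exists (fun u => Y u *m zb u).
have zeT u : (ze u)^T *m ze u = P a by case: (zzP u).
have zbT u : (zb u)^T *m zb u = P b by case: (zzP u).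
have X'2 u : X' u *m X' u = (-1) ^+ q u *: P a by rewrite X'E; case: (zzP u).
have Y'2 u : Y' u *m Y' u = (-1) ^+ q u *: P b by rewrite Y'E; case: (zzP u).
have X'P u : X' u *m P a = X' u by rewrite X'E -mulmxA (cscal_P hE fr).
have PX' u : P a *m X' u = X' u by rewrite X'E mulmxA -(fr_mem_comm fr) // -mulmxA (P_cscal fr).
have Y'P u : Y' u *m P b = Y' u by rewrite Y'E -mulmxA (cscal_P hE fr).
have PY' u : P b *m Y' u = Y' u by rewrite Y'E mulmxA -(fr_mem_comm fr) // -mulmxA (P_cscal fr).
have cross A z z' B : E A -> cent E z' -> cent E z -> z *m z' = z' *m z ->
  E B -> (B *m z') *m (A *m z) = (B *m A) *m (z *m z').
  move=> EA cz' cz zz' EB.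
  by rewrite mulmxA -[_ *m z' *m A]mulmxA -cz' // zz' !mulmxA.
have com' u v : exists e : bool, X' u *m X' v = (-1) ^+ e *: (X' v *m X' u) /\
     Y' u *m Y' v = (-1) ^+ e *: (Y' v *m Y' u).
  have [e [Xuv Yuv]] := comXY u v; exists e; rewrite !X'E !Y'E.
  rewrite (cross (X v)) ?(cross (X u)) ?(cross (Y v)) ?(cross (Y u)) //;
    try by [apply: (cent_cscal fr) | apply: (cscalC hE fr)].
  by rewrite Xuv Yuv -!scalemxAl !(cscalC hE fr a (zz u).1.1.2) !(cscalC hE fr b (zz u).2.1).
have X'J u : X' u *m J a = J a *m X' u.
  rewrite X'E mulmxA -(fr_centJ fr) // -!mulmxA; congr (_ *m _).
  rewrite (fr_Jcscal a); exact: (cscalC hE fr).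
have Y'J u : Y' u *m J b = J b *m Y' u.
  rewrite Y'E mulmxA -(fr_centJ fr) // -!mulmxA; congr (_ *m _).
  rewrite (fr_Jcscal b); exact: (cscalC hE fr).
(* On the range of P b the inverse of Y' is (-1)^q Y', so L u fixes T exactly
   when T X' = Y' T, and maps it to - T exactly when T X' = - Y' T. *)
pose L u : {linear 'M[R]_n -> 'M[R]_n} := (mulmx ((-1) ^+ q u *: Y' u) \o mulmxr (X' u)).
have LE u T : L u T = (-1) ^+ q u *: (Y' u *m T *m X' u).
  by rewrite /L /= -scalemxAl mulmxA.
pose U T := [/\ P b *m T = T, T *m P a = T & T *m J a = (-1) ^+ eps *: (J b *m T)].
have [w0 Uw0 w0n0] : exists2 T, U T & T != 0.
  exact: nonzero_twist.
have [|||u v T _|T Tn0 [[PT TP TJ] LT]] :=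
  joint_sign_eigenvector (L := L) (enum K) _ _ _ _ Uw0 w0n0.
- move=> c S T [PS SP SJ] [PT TP TJ]; split.
  + by rewrite mulmxDr -scalemxAr PS PT.
  + by rewrite mulmxDl -scalemxAl SP TP.
  + by rewrite mulmxDl mulmxDr -scalemxAl -scalemxAr SJ TJ scalerDr !scalerA mulrC.
- move=> u T [PT TP TJ]; rewrite LE; split.
  + by rewrite -scalemxAr !mulmxA PY'.
  + by rewrite -scalemxAl -!mulmxA X'P.
  + rewrite -scalemxAl -mulmxA X'J mulmxA -[_ *m T *m _]mulmxA TJ -!scalemxAr.
    by rewrite -scalemxAl !scalerA mulrC !mulmxA Y'J.
- move=> u T [PT TP TJ]; rewrite !LE -scalemxAr -scalemxAl signZK.
  rewrite -!mulmxA X'2 !mulmxA Y'2 -scalemxAr -!scalemxAl signZK PT.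
  by rewrite TP.
- have [e [Xuv Yuv]] := com' u v.
  rewrite !LE -!scalemxAr -!scalemxAl !scalerA mulrC; congr (_ *: _).
  rewrite !mulmxA Yuv -!scalemxAl -!mulmxA.
  by rewrite Xuv -!scalemxAr.
(* Multiplying the eigenvector equation by X' on the right turns it into an
   intertwining relation. *)
have {}LT u : exists d : bool, T *m X' u = (-1) ^+ d *: (Y' u *m T).
  have [|d] := LT u; first by rewrite mem_enum.
  rewrite LE => /(congr1 (fun M => M *m X' u)); rewrite -!scalemxAl -mulmxA X'2.
  rewrite -scalemxAr signZK -mulmxA TP => YT; exists d.
  by rewrite YT signZK.
have Tcscal x y : T *m cscal P J a x y = cscal P J b x ((-1) ^+ eps * y) *m T.
  rewrite mulmxDr mulmxDl -!scalemxAr -!scalemxAl TP PT TJ scalerA mulrC.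
  by [].
have zezeT u : ze u *m (ze u)^T = P a.
  by rewrite -(zeT u) (cscal_tr fr) (cscalC hE fr).
have [S SE] : exists S : 'M[R]_n, S = T^T *m T by exists (T^T *m T).
have SP : S *m P a = S by rewrite SE -mulmxA TP.
have PS : P a *m S = S by rewrite SE mulmxA -{1}(fr_PT fr) -trmx_mul TP.
have SX' u : S *m X' u = X' u *m S.
  have X'T : (X' u)^T = (-1) ^+ q u *: X' u.
    have X'TX' : (X' u)^T *m X' u = P a.
      by rewrite X'E trmx_mul -mulmxA (mulmxA _ (X u)) (mc_orth hE (EX u)) mul1mx zeT.
    rewrite -[in RHS](PX' u) -X'TX' -mulmxA X'2 -scalemxAr signZK.
    by rewrite -{1}(PX' u) trmx_mul (fr_PT fr).
  have Y'TY' : (Y' u)^T *m Y' u = P b.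
    by rewrite Y'E trmx_mul -mulmxA (mulmxA _ (Y u)) (mc_orth hE (EY u)) mul1mx zbT.
  have XSX : (X' u)^T *m S *m X' u = S.
    have [d TX'] := LT u; rewrite SE mulmxA -trmx_mul -mulmxA TX' trmxZ -scalemxAl.
    by rewrite -scalemxAr signZK trmx_mul -mulmxA (mulmxA _ (Y' u)) Y'TY' PT.
  have XX : X' u *m (X' u)^T = P a by rewrite X'T -scalemxAr X'2 signZK.
  by rewrite -[in RHS]XSX !mulmxA XX PS.
have SJ : S *m J a = J a *m S.
  rewrite SE -mulmxA TJ -scalemxAr mulmxA -[J a]opprK -(fr_JT fr) mulNmx mulmxA.
  rewrite -trmx_mul TJ trmxZ -scalemxAl trmx_mul (fr_JT fr) mulmxN mulNmx.
  by rewrite scalerN opprK.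
have Scscal x y : S *m cscal P J a x y = cscal P J a x y *m S.
  by rewrite mulmxDr mulmxDl -!scalemxAr -!scalemxAl SP PS SJ.
(* E is generated by the X u and the commutant, and S commutes with both on
   the range of P a. *)
have cS : cent E S.
  move=> A EA; have [u [z [cz AE]]] := genX EA.
  have [x [y zE]] := cent_coord hE fr a cz.
  have APE : A *m P a = X' u *m ((ze u)^T *m cscal P J a x y).
    rewrite AE -mulmxA zE X'E -mulmxA (mulmxA (ze u)) zezeT.
    by rewrite (P_cscal fr).
  have AP := fr_mem_comm fr a EA.
  rewrite -{1}PS mulmxA -{2}SP -(mulmxA S) -AP APE /ze (cscal_tr fr).
  by rewrite [RHS]mulmxA SX' -!mulmxA (mulmxA S) Scscal -!mulmxA Scscal.
have [c TT] : exists c, S = c *: P a.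
  by apply: (schur_sym hE (fr_atom fr a)) => //; rewrite SE trmx_mul trmxK.
have c0 : 0 < c.
  have : 0 < \tr S by rewrite SE mxtrace_gram_gt0.
  by rewrite TT mxtraceZ pmulr_lgt0 // -(fr_PP fr) -{1}(fr_PT fr) mxtrace_gram_gt0 (fr_neq0 fr).
pose s := (Num.sqrt c)^-1.
exists (s *: T); split.
- by rewrite -scalemxAr PT.
- by rewrite -scalemxAl TP.
- rewrite trmxZ -scalemxAl -scalemxAr -SE TT !scalerA /s.
  rewrite -[X in _ * _ * X]sqr_sqrtr ?ltW // expr2 mulrA mulfVK ?mulVf ?scale1r //.
    by rewrite sqrtr_eq0 -ltNge.
  by rewrite sqrtr_eq0 -ltNge.
- by rewrite -scalemxAl TJ -scalemxAr !scalerA mulrC.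
- move=> u; have [d TX] := LT u.
  (* The relation for X' = X ze becomes one for X by moving the inverse of ze
     across T. *)
  pose z := cscal P J b (zz u).1.1.2 ((-1) ^+ eps * - (zz u).1.2).
  have TXu : T *m X u = (-1) ^+ d *: (Y u *m (zb u *m z) *m T).
    have -> : T *m X u = T *m (P a *m X u) by rewrite mulmxA TP.
    rewrite -(fr_mem_comm fr a (EX u)) -(zezeT u) (mulmxA (X u)) -X'E.
    rewrite (mulmxA T) TX Y'E -scalemxAl -!mulmxA; congr (_ *: (_ *m (_ *m _))).
    by rewrite (cscal_tr fr) Tcscal.
  exists ((-1) ^+ d *: (zb u *m z)).
    by apply/centZ/centM; apply: (cent_cscal fr).
  by rewrite -scalemxAl TXu -!scalemxAr -!scalemxAl !scalerA mulrC.
Qed.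

End Intertwiner.

(** * Gluing isometries into elements of the normaliser *)

Section Glue.
Local Open Scope ring_scope.
Variables (R : rcfType) (n : nat) (E : 'M[R]_n -> Prop).
Hypothesis hE : max_commuting E.
Variables (I : finType) (P J : I -> 'M[R]_n).
Hypothesis fr : frame E P J.
Implicit Types (a b : I) (A B M S T : 'M[R]_n).

(** Conjugating by g^T is not known to preserve E, but g^T A g commutes with B
    up to sign because A commutes with g B g^T up to sign; maximality
    concludes. *)
Lemma conj_mem_sym (g : 'M[R]_n) : g^T *m g = 1%:M ->
    (forall A, E A -> E (g *m A *m g^T)) -> forall A, E A -> E (g^T *m A *m g).
Proof.
move=> gO gE A EA; have gO' := mulmx1C gO.
apply: (mc_max hE) => [|B EB].
  rewrite !trmx_mul trmxK !mulmxA -[_ *m g *m g^T]mulmxA gO' mulmx1.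
  by rewrite -[_ *m A^T *m A]mulmxA (mc_orth hE EA) mulmx1.
have [e AB] := mc_comm hE EA (gE _ EB); exists e.
move/(congr1 (fun M => g^T *m M *m g)): AB.
rewrite -scalemxAr -scalemxAl !mulmxA -!(mulmxA _ g^T g) gO !mulmx1.
by rewrite mul1mx.
Qed.

Section GlueFamily.
Variables (pi : {perm I}) (T : I -> 'M[R]_n).
Hypothesis PT : forall a, P (pi a) *m T a = T a.
Hypothesis TP : forall a, T a *m P a = T a.
Hypothesis TT : forall a, (T a)^T *m T a = P a.
Let g := \sum_a T a.

Lemma glue_P a : g *m P a = T a.
Proof.
rewrite mulmx_suml (bigD1 a) //= TP big1 ?addr0 // => b ba.
by rewrite -TP -mulmxA (fr_orth fr) ?mulmx0.
Qed.

Lemma P_glue a : P (pi a) *m g = T a.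
Proof.
rewrite mulmx_sumr (bigD1 a) //= PT big1 ?addr0 // => b ba.
by rewrite -PT mulmxA (fr_orth fr) ?mul0mx // (inj_eq perm_inj) eq_sym.
Qed.

Lemma glue_orth : g^T *m g = 1%:M.
Proof.
apply: (frame_eq fr) => a; rewrite mul1mx -mulmxA glue_P -PT mulmxA.
by rewrite -{1}(fr_PT fr) -trmx_mul P_glue TT.
Qed.

Lemma glue_conjP a : g *m P a *m g^T = P (pi a).
Proof.
have gg := mulmx1C glue_orth.
by rewrite glue_P -P_glue -mulmxA gg mulmx1.
Qed.

Lemma glue_conjJ a (eps : bool) : T a *m J a = (-1) ^+ eps *: (J (pi a) *m T a) ->
  g *m J a *m g^T = (-1) ^+ eps *: J (pi a).
Proof.
move=> TJ; rewrite -(fr_PJ fr) mulmxA glue_P TJ -scalemxAl -glue_P -!mulmxA.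
by rewrite (mulmxA g) glue_conjP (fr_JP hE fr).
Qed.

(** Conjugation by g maps P a and J a to P (pi a) and +- J (pi a), and these
    span the commutant blockwise. *)
Lemma glue_conj_cent M :
  (forall a, exists eps : bool, T a *m J a = (-1) ^+ eps *: (J (pi a) *m T a)) ->
  cent E M -> cent E (g *m M *m g^T).
Proof.
move=> TJ cM; apply: (frame_cent fr) => b; rewrite -[b](permKV pi).
set a := (pi^-1)%g b; have [x [y Mxy]] := cent_coord hE fr a cM.
have -> : g *m M *m g^T *m P (pi a) = x *: P (pi a) + y *: (g *m J a *m g^T).
  rewrite -glue_conjP !mulmxA -!(mulmxA _ g^T g) glue_orth mulmx1.
  rewrite -(mulmxA g) Mxy mulmxDr mulmxDl -!scalemxAr -!scalemxAl.
  by rewrite glue_conjP.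
have [eps /glue_conjJ ->] := TJ a.
by do !apply: centD || apply: centZ; [apply: (fr_cent fr) | apply: (fr_centJ fr)].
Qed.

(** The blocks of g each intertwine A with B up to the commutant; the
    corrections of the different blocks assemble into one element of the
    commutant, which is block diagonal. *)
Lemma glue_conj A B : E A -> E B ->
  (forall a, exists2 z, cent E z & T a *m A = B *m z *m T a) ->
  exists2 z, cent E z & g *m A *m g^T = B *m z.
Proof.
move=> EA EB TA; exists (B^T *m g *m A *m g^T); last first.
  by rewrite !mulmxA (mc_orthT hE EB) mul1mx.
apply: (frame_cent fr) => b; rewrite -[b](permKV pi); set a := (pi^-1)%g b.
have [z cz Tz] := TA a.
suff -> : B^T *m g *m A *m g^T *m P (pi a) = z *m P (pi a).
  by apply: centM => //; apply: (fr_cent fr).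
rewrite -(glue_conjP a) !mulmxA -!(mulmxA _ g^T g) glue_orth mulmx1.
rewrite -!(mulmxA _ _ (P a)) (fr_mem_comm fr a EA) !glue_P.
rewrite mulmxA -(mulmxA _ g) glue_P -(mulmxA _ (T a)) Tz.
by rewrite !mulmxA (mc_orth hE EB) mul1mx.
Qed.

End GlueFamily.

(** Up to an element of the commutant, g X_u g^T is Y_u, which lies in E; an
    orthogonal element of the commutant is in E by maximality. *)
Lemma mem_conj (pi : {perm I}) (T : I -> 'M[R]_n) (K : Type) (X Y : K -> 'M[R]_n) :
    (forall a, P (pi a) *m T a = T a) -> (forall a, T a *m P a = T a) ->
    (forall a, (T a)^T *m T a = P a) ->
    (forall a, exists eps : bool, T a *m J a = (-1) ^+ eps *: (J (pi a) *m T a)) ->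
    (forall u, E (X u)) -> (forall u, E (Y u)) ->
    (forall A, E A -> exists u z, cent E z /\ A = X u *m z) ->
    (forall u a, exists2 z, cent E z & T a *m X u = Y u *m z *m T a) ->
  forall A, E A -> E ((\sum_a T a) *m A *m (\sum_a T a)^T).
Proof.
move=> PT TP TT TJ EX EY genX TXY A EA; set g := \sum_a T a.
have gO : g^T *m g = 1%:M by apply: (glue_orth PT TP TT).
have [u [z [cz AE]]] := genX A EA.
have [w cw gX] := glue_conj PT TP TT (EX u) (EY u) (TXY u).
have cz' := glue_conj_cent PT TP TT TJ cz.
have gAE : g *m A *m g^T = Y u *m (w *m (g *m z *m g^T)).
  rewrite mulmxA -gX AE !mulmxA -!(mulmxA _ g^T g) gO mulmx1.
  by [].
have EY' := EY u.
have -> : g *m A *m g^T = Y u *m ((Y u)^T *m (g *m A *m g^T)).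
  by rewrite mulmxA (mc_orthT hE EY') mul1mx.
apply: (mc_mul hE EY'); apply: (cent_orth_mem hE).
  rewrite !trmx_mul !trmxK !mulmxA -[_ *m Y u *m _]mulmxA (mc_orthT hE EY') mulmx1.
  rewrite -[_ *m g^T *m g]mulmxA gO mulmx1 -[_ *m A^T *m A]mulmxA (mc_orth hE EA) mulmx1.
  exact: mulmx1C.
rewrite gAE mulmxA (mc_orth hE EY') mul1mx.
exact: centM.
Qed.

End Glue.

(** * Action of the normaliser on the central projections *)

Section Normalizer.
Local Open Scope ring_scope.
Variables (R : rcfType) (n : nat) (E : 'M[R]_n -> Prop).
Hypothesis hE : max_commuting E.
Variables (I : finType) (P J : I -> 'M[R]_n).
Hypothesis fr : frame E P J.
Implicit Types (a b : I) (A B M S T : 'M[R]_n).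

Lemma cent_conj (g : 'M[R]_n) M : g^T *m g = 1%:M ->
  (forall A, E A -> E (g^T *m A *m g)) -> cent E M -> cent E (g *m M *m g^T).
Proof.
move=> gO gE cM A EA; have gO' := mulmx1C gO.
have := cM _ (gE _ EA) => /(congr1 (fun M => g *m M *m g^T)).
by rewrite !mulmxA gO' mul1mx -!(mulmxA _ g g^T) gO' mulmx1.
Qed.

(** Conjugation by g permutes the minimal elements of [cproj]. The formula has
    the permutation on the source side so that a product of matrices
    corresponds to the product of permutations, composed from left to right. *)
Lemma normalizer_perm (g : 'M[R]_n) : g^T *m g = 1%:M ->
    (forall A, E A -> E (g *m A *m g^T)) ->
  exists pi : {perm I}, forall a, g *m P (pi a) *m g^T = P a.
Proof.
move=> gO gE; have gO' := mulmx1C gO; have gE' := conj_mem_sym hE gO gE.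
have ccj (h : 'M[R]_n) Q : h^T *m h = 1%:M -> (forall A, E A -> E (h^T *m A *m h)) ->
    cproj E Q -> cproj E (h *m Q *m h^T).
  move=> hO hEE [QT QQ cQ]; split; last exact: cent_conj.
    by rewrite !trmx_mul trmxK QT mulmxA.
  by rewrite !mulmxA -!(mulmxA _ h^T h) hO mulmx1 -(mulmxA _ Q Q) QQ.
have /choice[f fP] a : exists b, g *m P b *m g^T = P a.
  have [b bn0] : exists b, P a *m (g *m P b *m g^T) != 0.
    apply: contrapT => nb; case/eqP: (fr_neq0 fr a).
    have : P a *m (g *m (\sum_b P b) *m g^T) = 0.
      rewrite mulmx_sumr mulmx_suml mulmx_sumr big1 // => b _.
      by apply: contrapT => /eqP bn0; apply: nb; exists b.
    by rewrite (fr_sum fr) mulmx1 gO' mulmx1.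
  (* The conjugate of P b is minimal and meets P a, so it is equal to P a. *)
  exists b; have [_ _ amin] := fr_atom fr a; have [_ _ bmin] := fr_atom fr b.
  have hQ := ccj g (P b) gO gE' (fr_cproj fr b).
  have hQ' : cproj E (g^T *m P a *m g).
    rewrite -{2}[g]trmxK; apply: ccj; rewrite ?trmxK //; exact: (fr_cproj fr a).
  have QP : g *m P b *m g^T *m P a = P a *m (g *m P b *m g^T).
    by rewrite (cproj_cent hE (fr_cproj fr a)) //; case: hQ.
  have [Q0|QPa] := amin _ hQ; first by rewrite -QP Q0 eqxx in bn0.
  have [Q0|QPb] := bmin _ hQ'.
    case/eqP: bn0; rewrite !mulmxA -[P a]mul1mx -gO' -!mulmxA.
    by rewrite (mulmxA (P a) g) (mulmxA g^T) (mulmxA g^T) (mulmxA _ (P b)) Q0 mul0mx mulmx0.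
  by rewrite -QPa QP -QPb !mulmxA gO' mul1mx -(mulmxA (P a) g g^T) gO' mulmx1 (fr_PP fr).
have finj : injective f.
  move=> a a' faa'; apply: (fr_inj fr); rewrite -(fP a) faa' fP (fr_PP fr).
  exact: fr_neq0 fr a'.
by exists (perm finj) => a; rewrite permE.
Qed.

(** The conjugate of J b is skew and in the commutant of the range of P a,
    hence a real multiple of J a; comparing squares, the multiple is 1 or - 1. *)
Lemma normalizer_J (g : 'M[R]_n) a b : g^T *m g = 1%:M ->
    (forall A, E A -> E (g *m A *m g^T)) -> g *m P b *m g^T = P a ->
  (J a = 0 <-> J b = 0) /\ exists eps : bool, g *m J b *m g^T = (-1) ^+ eps *: J a.
Proof.
move=> gO gE gP; have gO' := mulmx1C gO; have gE' := conj_mem_sym hE gO gE.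
have key h c d : h^T *m h = 1%:M -> (forall A, E A -> E (h^T *m A *m h)) ->
    h *m P d *m h^T = P c -> exists y, h *m J d *m h^T = y *: J c.
  move=> hO hEE hP.
  have cM := cent_conj hO hEE (fr_centJ fr d).
  have [|x [y xyE]] := fr_comm fr cM (a := c).
    by rewrite -hP !mulmxA -!(mulmxA _ h^T h) hO mulmx1 -(mulmxA _ (P d)) (fr_PJ fr).
  exists y; rewrite xyE; suff -> : x = 0 by rewrite scale0r add0r.
  have : (h *m J d *m h^T)^T = - (h *m J d *m h^T).
    by rewrite !trmx_mul trmxK (fr_JT fr) mulNmx mulmxN mulmxA.
  rewrite xyE -/(cscal P J c x y) (cscal_tr fr) /cscal opprD scaleNr => /addIr.
  move/eqP; rewrite -addr_eq0 -scalerDl scaler_eq0 (negPf (fr_neq0 fr c)) orbF.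
  by rewrite -mulr2n mulrn_eq0 => /eqP.
have [y yE] := key g a b gO gE' gP.
have [y' y'E] : exists y', g^T *m J a *m g^T^T = y' *: J b.
  apply: key; rewrite ?trmxK //.
  by rewrite -gP !mulmxA gO mul1mx -mulmxA gO mulmx1.
have Jb : J b = y *: (g^T *m J a *m g).
  rewrite scalemxAl scalemxAr -yE !mulmxA gO mul1mx -mulmxA gO mulmx1 //.
have Jab : J a = 0 <-> J b = 0.
  split=> [Ja|Jb0]; first by rewrite Jb Ja mulmx0 mul0mx scaler0.
  move: y'E; rewrite trmxK Jb0 scaler0 => /(congr1 (fun M => g *m M *m g^T)).
  by rewrite !mulmxA gO' mul1mx -mulmxA gO' mulmx1 mulmx0 mul0mx.
split=> //; case: (fr_JJ fr a) => [Ja|JJa].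
  by exists false; rewrite yE Ja !scaler0.
have Ja0 : J a <> 0.
  move=> Ja; move: JJa; rewrite Ja mul0mx => /esym/eqP; rewrite oppr_eq0.
  by rewrite (negPf (fr_neq0 fr a)).
have JJb : J b *m J b = - P b by case: (fr_JJ fr b) => // /Jab.
have : (g *m J b *m g^T) *m (g *m J b *m g^T) = - P a.
  by rewrite -gP !mulmxA -!(mulmxA _ g^T g) gO mulmx1 -(mulmxA g (J b)) JJb mulmxN mulNmx.
rewrite yE -scalemxAl -scalemxAr JJa scalerA scalerN => /oppr_inj.
rewrite -[RHS]scale1r => /eqP; rewrite -subr_eq0 -scalerBl scaler_eq0.
rewrite (negPf (fr_neq0 fr a)) orbF.
have -> : y * y - 1 = (y - 1) * (y + 1) by ring.
rewrite mulf_eq0 subr_eq0 addr_eq0 => /orP[]/eqP ->; [exists false | exists true].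
  by rewrite expr0.
by rewrite expr1.
Qed.

End Normalizer.

(** * Schur orthogonality and the dimensions of the eigenspaces *)

Section Counting.
Local Open Scope ring_scope.
Variables (R : rcfType) (n : nat) (E : 'M[R]_n -> Prop).
Hypothesis hE : max_commuting E.
Implicit Types (A B M S T : 'M[R]_n).

(** Some B in E anticommutes with A, and conjugating A M by B changes its sign
    but not its trace. *)
Lemma mxtrace_noncentral A M : E A -> ~ cent E A -> cent E M -> \tr (A *m M) = 0.
Proof.
move=> EA nA cM.
have [B EB AB] : exists2 B, E B & B *m A <> A *m B.
  by apply: contrapT => nB; apply: nA => B EB; apply: contrapT => AB; apply: nB; exists B.
have [[] BA] := mc_comm hE EB EA; last by case: AB; rewrite BA expr0 scale1r.
have tE : \tr (B *m (A *m M) *m B^T) = \tr (A *m M).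
  by rewrite (mxtrace_mulC _ B^T) (mulmxA B^T) (mc_orth hE EB) mul1mx.
move: tE; rewrite mulmxA BA -!scalemxAl -!mulmxA (mulmxA B) (cM _ EB) -mulmxA.
rewrite (mc_orthT hE EB) mulmx1 mxtraceZ expr1 mulN1r => /eqP.
by rewrite eq_sym -addr_eq0 -mulr2n mulrn_eq0 => /eqP.
Qed.

Variables (K : finType) (X : K -> 'M[R]_n).
Hypothesis EX : forall u, E (X u).
Hypothesis Xinj : forall u v, cent E ((X u)^T *m X v) -> u = v.

(** Matrices of E that are pairwise distinct modulo the commutant are
    orthogonal for the trace form, by [mxtrace_noncentral]. *)
Lemma card_transversal : (0 < n)%N -> (#|K| <= n * n)%N.
Proof.
move=> n0; pose Y := \matrix_(i < #|K|) mxvec (X (enum_val i)).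
(* Up to the factor n, the rows of Y are orthonormal, so their number is at
   most n * n. *)
have YY : Y *m (n%:R^-1 *: Y^T) = 1%:M.
  rewrite -scalemxAr; apply/matrixP => i j; rewrite mxE.
  have -> : (Y *m Y^T) i j = \tr ((X (enum_val i))^T *m X (enum_val j)).
    rewrite mxE (reindex _ (curry_mxvec_bij _ _)) /=.
    transitivity (\sum_l \sum_k X (enum_val i) k l * X (enum_val j) k l).
      rewrite exchange_big pair_bigA; apply: eq_bigr => [[k l]] _.
      by rewrite !mxE /= !mxvecE.
    by apply: eq_bigr => l _; rewrite mxE; apply: eq_bigr => k _; rewrite mxE.
  rewrite mxE; have [<-|ij] := eqVneq i j.
    by rewrite (mc_orth hE (EX _)) mxtrace1 mulVf // pnatr_eq0 -lt0n.
  rewrite -[X in \tr X]mulmx1 mxtrace_noncentral ?mulr0 //; last 2 first.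
  - by move/Xinj/enum_val_inj/eqP; rewrite (negPf ij).
  - exact: cent1.
  by apply: (mc_mul hE) => //; apply: mc_tr.
exact: mulmx1_min YY.
Qed.

Hypothesis genX : forall A, E A -> exists u z, cent E z /\ A = X u *m z.
Variables (I : finType) (P J : I -> 'M[R]_n).
Hypothesis fr : frame E P J.

(** Left multiplication by A permutes the chosen lifts X u up to elements of E
    in the commutant, which do not change Psi. *)
Lemma average_cent (Psi : 'M[R]_n) :
    (forall z, cent E z -> E z -> z *m Psi *m z^T = Psi) ->
  cent E (\sum_u X u *m Psi *m (X u)^T).
Proof.
move=> zPsi A EA; set Phi := \sum_u _.
have trans u : exists v, exists z, [/\ cent E z, E z & A *m X u = X v *m z].
  have EAX := mc_mul hE EA (EX u); have [v [z [cz AX]]] := genX EAX.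
  exists v, z; split=> //; apply: (cent_orth_mem hE) => //.
  have -> : z = (X v)^T *m (A *m X u) by rewrite AX mulmxA (mc_orth hE (EX v)) mul1mx.
  by apply: (mc_orth hE); apply: (mc_mul hE) => //; apply: (mc_tr hE).
have /choice[f /choice[zz zP]] := trans.
have finj : injective f.
  move=> u v fuv; apply: Xinj; have [cu Eu Au] := zP u; have [cv Ev Av] := zP v.
  have -> : (X u)^T *m X v = (zz u)^T *m zz v.
    transitivity ((A *m X u)^T *m (A *m X v)).
      by rewrite trmx_mul -mulmxA (mulmxA A^T) (mc_orth hE EA) mul1mx.
    by rewrite Au Av fuv trmx_mul -mulmxA (mulmxA (X (f v))^T) (mc_orth hE (EX _)) mul1mx.
  by apply: centM => //; apply: (centT hE).
have APA : A *m Phi *m A^T = Phi.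
  rewrite mulmx_sumr mulmx_suml [RHS](reindex_inj finj) /=; apply: eq_bigr => u _.
  have [cu Eu Au] := zP u.
  rewrite !mulmxA Au -!mulmxA -trmx_mul Au trmx_mul !mulmxA.
  by rewrite -[in RHS](zPsi _ cu Eu) !mulmxA.
by rewrite -[in RHS]APA -mulmxA (mc_orth hE EA) mulmx1.
Qed.

Let m (a : I) : R := if J a == 0 then 1 else 2%:R.

Lemma mxtrace_J a : \tr (J a) = 0.
Proof.
have := mxtrace_tr (J a); rewrite (fr_JT fr) linearN => /eqP.
by rewrite eq_sym -addr_eq0 -mulr2n mulrn_eq0 => /eqP.
Qed.

Lemma mxtrace_P_gt0 a : 0 < \tr (P a).
Proof. by rewrite -(fr_PP fr) -{1}(fr_PT fr) mxtrace_gram_gt0 (fr_neq0 fr). Qed.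

(** Here m a is the real dimension of the commutant on the range of P a. *)
Lemma fr_JTJ a : (J a)^T *m J a = (m a - 1) *: P a.
Proof.
rewrite (fr_JT fr) mulNmx /m; case: eqP => [->|J0].
  by rewrite mul0mx oppr0 subrr scale0r.
case: (fr_JJ fr a) => // ->; rewrite opprK.
by have -> : 2%:R - 1 = 1 :> R; [ring | rewrite scale1r].
Qed.

(** Replacing M by Psi = P a M P a + J a M J a^T makes it invariant under the
    unit scalars of the commutant. Its average over the lifts X u is then in
    the commutant, so it is c P a + e J a; taking traces against P a and J a
    gives c and e. *)
Lemma schur_orthogonality a (M : 'M[R]_n) :
  \sum_u (X u *m P a *m M *m (X u *m P a)^T + X u *m J a *m M *m (X u *m J a)^T) =
  (#|K|%:R * m a / \tr (P a)) *: (\tr (P a *m M) *: P a - \tr (J a *m M) *: J a).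
Proof.
set Psi := P a *m M *m P a - J a *m M *m J a.
have -> : \sum_u (X u *m P a *m M *m (X u *m P a)^T + X u *m J a *m M *m (X u *m J a)^T)
   = \sum_u X u *m Psi *m (X u)^T.
  apply: eq_bigr => u _; rewrite !trmx_mul (fr_PT fr) (fr_JT fr) /Psi.
  by rewrite mulNmx mulmxN mulmxBr mulmxBl !mulmxA.
have cPhi : cent E (\sum_u X u *m Psi *m (X u)^T).
  apply: average_cent => z cz Ez.
  have [x [y [zE xy1 Jy]]] := mem_cent_coord hE fr a Ez cz.
  have zJ : z *m J a = x *: J a - y *: ((m a - 1) *: P a).
    rewrite -(fr_PJ fr) mulmxA zE /cscal mulmxDl -!scalemxAl (fr_PJ fr).
    by rewrite -fr_JTJ (fr_JT fr) mulNmx scalerN opprK.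
  have zPT : P a *m z^T = x *: P a - y *: J a.
    by rewrite -{1}(fr_PT fr) -trmx_mul zE (cscal_tr fr) /cscal scaleNr.
  have zJT : J a *m z^T = x *: J a + y *: ((m a - 1) *: P a).
    have -> : J a *m z^T = - (z *m J a)^T by rewrite trmx_mul (fr_JT fr) mulNmx opprK.
    rewrite zJ linearB /= !trmxZ (fr_PT fr) (fr_JT fr) opprB scalerN opprK addrC.
    by [].
  rewrite /Psi mulmxBr mulmxBl -!(mulmxA _ _ z^T) zPT zJT !mulmxA zE zJ /cscal.
  rewrite !(mulmxDr, mulmxDl, mulmxBr, mulmxBl, mulmxN, mulNmx) -?scalemxAl -?scalemxAr -?scalemxAl -?scalemxAr.
  (* In real type the scalar z is a sign. In complex type the invariance is
     the identity (x + i y)(x - i y) = 1, checked entrywise. *)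
  have [m1|m2] : (m a = 1 /\ y = 0) \/ m a = 2%:R.
    by rewrite /m; case: eqP => [J0|_]; [left; split=> //; apply: Jy | right].
  - have [-> y0] := m1; rewrite y0 !(scale0r, subrr, scaler0, subr0, addr0).
    move: xy1; rewrite y0 expr0n addr0 => x2; rewrite !scalerA -expr2 x2 !scale1r.
    by [].
  rewrite m2 (_ : 2%:R - 1 = 1) ?scale1r; last by ring.
  have y2 : y ^+ 2 = 1 - x ^+ 2 by rewrite -xy1; ring.
  apply/matrixP => i j; rewrite !mxE.
  move: ((P a *m M *m P a) i j) ((P a *m M *m J a) i j) ((J a *m M *m P a) i j) ((J a *m M *m J a) i j).
  by move=> p q r t; ring: y2.
have [|c [e PhiE]] := fr_comm fr cPhi (a := a).
  rewrite mulmx_sumr; apply: eq_bigr => u _.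
  rewrite !mulmxA -(fr_mem_comm fr a (EX u)) -(mulmxA (X u) (P a)) /Psi mulmxBr !mulmxA.
  by rewrite (fr_PP fr) (fr_PJ fr).
have trX (Q : 'M[R]_n) u : \tr (X u *m Q *m (X u)^T) = \tr Q.
  by rewrite mxtrace_mulC mulmxA (mc_orth hE (EX u)) mul1mx.
have JJ : J a *m J a = - ((m a - 1) *: P a).
  by rewrite -fr_JTJ (fr_JT fr) mulNmx opprK.
have d0 := mxtrace_P_gt0 a.
have cE : c * \tr (P a) = #|K|%:R * m a * \tr (P a *m M).
  have := congr1 mxtrace PhiE; rewrite mxtraceD !mxtraceZ mxtrace_J mulr0 addr0 => <-.
  rewrite raddf_sum /= (eq_bigr (fun _ => \tr Psi)) // sumr_const -[LHS]mulr_natl -[RHS]mulrA.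
  congr (_ * _); rewrite /Psi raddfB /= mxtrace_mulC mulmxA (fr_PP fr).
  rewrite [X in _ - X]mxtrace_mulC mulmxA JJ mulNmx raddfN /= -scalemxAl mxtraceZ.
  ring.
(* When J a = 0 the coefficient e is not determined, but the term is 0 anyway. *)
have eE : e *: J a = - (#|K|%:R * m a / \tr (P a) * \tr (J a *m M)) *: J a.
  have [->|J0] := eqVneq (J a) 0; first by rewrite !scaler0.
  congr (_ *: _); have := congr1 (fun Q => \tr (Q *m J a)) PhiE.
  rewrite mulmxDl -!scalemxAl (fr_PJ fr) JJ mxtraceD !mxtraceZ mxtrace_J mulr0 add0r.
  have -> : \tr ((\sum_u X u *m Psi *m (X u)^T) *m J a) = #|K|%:R * (m a * \tr (J a *m M)).
    rewrite mulmx_suml raddf_sum /= (eq_bigr (fun _ => \tr (Psi *m J a))); last first.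
      move=> u _; rewrite -mulmxA (fr_centJ fr a (mc_tr hE (EX u))) mulmxA -(mulmxA (X u)).
      exact: trX.
    rewrite sumr_const -[LHS]mulr_natl; congr (_ * _).
    rewrite /Psi mulmxBl -!mulmxA JJ (fr_PJ fr) mulmxN -scalemxAr mulmxN -scalemxAr.
    have t1 : \tr (P a *m (M *m J a)) = \tr (J a *m M).
      by rewrite mxtrace_mulC -mulmxA (fr_JP hE fr) mxtrace_mulC.
    have t2 : \tr (J a *m (M *m P a)) = \tr (J a *m M).
      by rewrite mulmxA mxtrace_mulC mulmxA (fr_PJ fr).
    by rewrite opprK mxtraceD mxtraceZ t1 t2; ring.
  have -> : m a = 2%:R by rewrite /m (negPf J0).
  rewrite raddfN /= mxtraceZ => E1; have dn0 : \tr (P a) != 0 by rewrite gt_eqF.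
  apply: (mulIf dn0); have -> : e * \tr (P a) = - (#|K|%:R * (2%:R * \tr (J a *m M))).
    by rewrite E1; ring.
  by field.
rewrite PhiE eE scalerBr !scalerA scaleNr; congr (_ *: _ - _).
by rewrite mulrAC -cE mulfK // gt_eqF.
Qed.

(** Apply [schur_orthogonality] to the matrix units M = delta_kl, take the
    entry (k, l), and sum over k and l. On the left this gives the sum over u
    of the squares of the traces of X_u P a and X_u J a, where only the
    trivial class contributes by [mxtrace_noncentral]; on the right it gives a
    multiple of the trace of P a. *)
Lemma sqr_mxtrace_atom a : \tr (P a) ^+ 2 = #|K|%:R * m a ^+ 2.
Proof.
have d0 := mxtrace_P_gt0 a.
(* u0 is the index of the trivial class. *)
have [u0 [z0 [cz0 u0E]]] := genX (mc_one hE).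
have cX : cent E (X u0).
  have -> : X u0 = z0^T.
    rewrite -[LHS]trmxK -[(X u0)^T]mulmx1 u0E mulmxA (mc_orth hE (EX u0)) mul1mx.
    by [].
  exact: (centT hE cz0).
have mJ : J a *m J a = - ((m a - 1) *: P a).
  by rewrite -fr_JTJ (fr_JT fr) mulNmx opprK.
have sumE (M N : 'M[R]_n) : \sum_k \sum_l M l k * N k l = \tr (M *m N).
  by rewrite exchange_big; apply: eq_bigr => l _; rewrite mxE.
have lhs : \sum_k \sum_l (\sum_u (X u *m P a *m delta_mx k l *m (X u *m P a)^T +
     X u *m J a *m delta_mx k l *m (X u *m J a)^T)) k l = \tr (P a) ^+ 2.
  transitivity (\sum_u (\tr (X u *m P a) ^+ 2 + \tr (X u *m J a) ^+ 2)).
    transitivity (\sum_k \sum_l \sum_u ((X u *m P a) k k * (X u *m P a) l l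
        + (X u *m J a) k k * (X u *m J a) l l)).
      apply: eq_bigr => k _; apply: eq_bigr => l _; rewrite summxE; apply: eq_bigr => u _.
      by rewrite [LHS]mxE !mul_delta_mxE; congr (_ * _ + _ * _); rewrite mxE.
    under eq_bigr do rewrite exchange_big; rewrite exchange_big; apply: eq_bigr => u _ /=.
    rewrite !expr2 !big_distrlr -big_split /=; apply: eq_bigr => k _.
    by rewrite -big_split.
  rewrite (bigD1 u0) //= big1 ?addr0; last first.
    move=> u uu0; have nc : ~ cent E (X u).
      move=> cu; case/eqP: uu0; apply: Xinj; apply: centM => //.
      exact: (centT hE).
    rewrite !mxtrace_noncentral ?expr0n ?addr0 //.
      exact: (fr_centJ fr a).
    exact: (fr_cent fr a).
  have [x [y [zE xy1 Jy]]] := mem_cent_coord hE fr a (EX u0) cX.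
  have zJ : X u0 *m J a = x *: J a - y *: ((m a - 1) *: P a).
    rewrite -(fr_PJ fr) mulmxA zE /cscal mulmxDl -!scalemxAl (fr_PJ fr) mJ.
    by rewrite scalerN.
  rewrite zE zJ /cscal !linearD linearN /= !mxtraceZ mxtrace_J.
  have [[m1 y0]|m2] : (m a = 1 /\ y = 0) \/ m a = 2%:R.
    by rewrite /m; case: eqP => [J0|_]; [left; split=> //; apply: Jy | right].
    rewrite y0 expr0n addr0 in xy1; rewrite y0 -[RHS]mul1r -[X in _ = X * _]xy1; ring.
  rewrite m2 -[RHS]mul1r -[X in _ = X * _]xy1; ring.
rewrite -lhs.
transitivity (\sum_k \sum_l #|K|%:R * m a / \tr (P a) *
     (P a l k * P a k l - J a l k * J a k l)).
  apply: eq_bigr => k _; apply: eq_bigr => l _.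
  by rewrite schur_orthogonality !mxE !mxtrace_mul_delta.
transitivity (#|K|%:R * m a / \tr (P a) * (\tr (P a *m P a) - \tr (J a *m J a))).
  rewrite -!sumE -sumrB mulr_sumr; apply: eq_bigr => k _.
  by rewrite -sumrB mulr_sumr.
rewrite mJ (fr_PP fr) raddfN /= mxtraceZ.
have dn0 : \tr (P a) != 0 by rewrite gt_eqF.
by field.
Qed.

End Counting.

(** * The preimage of a maximal abelian subgroup in O(n) *)

Section Bicentralizer.
Local Open Scope group_scope.
Variables (G : groupType) (S : abelianClosed G) (x : G).
Hypothesis xS : forall y, y \in S -> x * y = y * x.

Definition adjoin_cent (z : G) := forall t, t = x \/ t \in S -> z * t = t * z.

(** The double centraliser of S together with x. Unlike the subgroup generated
    by S and x, it is closed under the group operations and abelian for formal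
    reasons. The proof that x centralises S is an argument so that the
    structure of abelian subgroup can be attached to the predicate. *)
Definition adjoin (_ : forall y, y \in S -> x * y = y * x) : {pred G} :=
  [pred z | `[< forall t, adjoin_cent t -> z * t = t * z >]].

Fact adjoin_mul : mulg_closed (adjoin xS).
Proof.
move=> y z /asboolP yC /asboolP zC; apply/asboolP => t tC.
by rewrite -mulgA (zC t tC) mulgA (yC t tC) -mulgA.
Qed.
Fact adjoin_one : 1 \in adjoin xS.
Proof. by apply/asboolP => t _; rewrite mul1g mulg1. Qed.
Fact adjoin_inv : invg_closed (adjoin xS).
Proof.
move=> y /asboolP yC; apply/asboolP => t tC.
by apply: (mulgI y); rewrite mulVKg mulgA (yC t tC) mulgK.
Qed.
Fact adjoin_sub t : t = x \/ t \in S -> t \in adjoin xS.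
Proof. by move=> tS; apply/asboolP => z zC; rewrite zC. Qed.
Fact adjoin_comm y z : y \in adjoin xS -> z \in adjoin xS -> y * z = z * y.
Proof.
move=> /asboolP yC /asboolP zC; apply: yC => t tS; apply: zC => w wS.
case: tS => [->|tS]; case: wS => [->|wS] //; first exact: xS.
  by rewrite xS.
exact: (@gpredC _ S).
Qed.

HB.instance Definition _ := isMulClosed.Build G (adjoin xS) adjoin_mul.
HB.instance Definition _ := isMul1Closed.Build G (adjoin xS) adjoin_one.
HB.instance Definition _ := isInvClosed.Build G (adjoin xS) adjoin_inv.
HB.instance Definition _ := isCommClosed.Build G (adjoin xS) adjoin_comm.

(** Otherwise [adjoin] would be a larger abelian subgroup. *)
Lemma maximal_abelian_cent : maximal_abelian S -> x \in S.
Proof.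
move=> /(_ (adjoin xS)) Smax; apply: Smax; last by apply: adjoin_sub; left.
by move=> t tS; apply: adjoin_sub; right.
Qed.

End Bicentralizer.

Section Lifted.
Local Open Scope ring_scope.
Variables (R : realType) (n : nat) (F : abelianClosed (PO R n)).
Implicit Types (A B : orth R n).

Definition lifted (M : 'M[R]_n) : Prop := exists2 A : orth R n, omx A = M & po_proj A \in F.

Lemma liftedE A : lifted A <-> po_proj A \in F.
Proof. by split=> [[B /val_inj ->]|AF] //; exists A. Qed.

Lemma orthE (M : 'M[R]_n) : M^T *m M = 1%:M -> exists A : orth R n, omx A = M.
Proof. by move=> /eqP MO; exists (Orth MO). Qed.

Lemma mform_comm (x y : subgrp F) A B : po_proj A = sgval x -> po_proj B = sgval y ->
  A *m B = (-1) ^+ (mform x y) *: (B *m A).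
Proof.
move=> Ax By; have := mform_signP Ax By.
move/(congr1 (fun M => M *m (B *m A))); rewrite mul_scalar_mx => <-.
by rewrite !omxM !omxV !mulmxA -!(mulmxA _ B^T) omxTK mulmx1 -!(mulmxA _ A^T) omxTK mulmx1.
Qed.

Lemma comm_sign A B : po_proj A \in F -> po_proj B \in F ->
  exists e : bool, A *m B = (-1) ^+ e *: (B *m A).
Proof.
move=> AF BF; exists (mform (SubGrp AF) (SubGrp BF)).
exact: (@mform_comm (SubGrp AF) (SubGrp BF)).
Qed.

(** Equality up to sign in O(n) is equality modulo - I, which is how
    commutation in G becomes commutation up to sign. *)
Lemma sign_comm A B (e : bool) : A *m B = (-1) ^+ e *: (B *m A) ->
  (po_proj A * po_proj B = po_proj B * po_proj A)%g.
Proof.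
move=> AB; rewrite -!po_projM; apply/po_projP.
have Zo : (((-1) ^+ e)%:M : 'M[R]_n)^T *m ((-1) ^+ e)%:M = 1%:M.
  by rewrite tr_scalar_mx -scalar_mxM -expr2 sqrr_sign.
have [Z ZE] := orthE Zo; exists Z; first by apply/pmIP; exists e.
apply: val_inj; rewrite /= ZE AB mul_mx_scalar scalerA -expr2 sqrr_sign scale1r.
by [].
Qed.

Lemma lifted_max : maximal_abelian F -> max_commuting lifted.
Proof.
move=> Fmax; split.
- by move=> _ [A <- _]; apply: omxTK.
- by exists 1%g => //; apply: (@gpred1 _ F).
- by move=> _ _ [A <- AF] [B <- BF]; exists (A * B)%g; rewrite // po_projM gpredM.
- by move=> _ [A <- AF]; exists A^-1%g; rewrite // po_projV gpredV.
- by move=> _ _ [A <- AF] [B <- BF]; apply: comm_sign.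
move=> M /orthE[A <-] AC; apply/liftedE; apply: maximal_abelian_cent => // y yF.
have [e AB] : exists e : bool, A *m qrepr y = (-1) ^+ e *: (qrepr y *m A).
  by apply/AC/liftedE; rewrite [po_proj _]qreprK.
by have := sign_comm AB; rewrite [po_proj (qrepr y)]qreprK.
Qed.

Lemma kerm_cent (x : subgrp F) A : po_proj A = sgval x ->
  x \in kerm F <-> cent lifted A.
Proof.
move=> Ax; rewrite (kermP Ax); split=> [AC _ [B <- BF] | AC B BF].
  by have /(congr1 (@omx R n)) := AC B BF.
by apply: val_inj; rewrite /= AC //; apply/liftedE.
Qed.

Lemma BF_liftP A : BF_lift F A <->
  [/\ lifted A, cent lifted A & A *m A = 1%:M].
Proof.
split=> [[x xB Ax]|[/liftedE AF cA AA]].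
  have [xK AA] := (BFP Ax).1 xB; split.
  - by apply/liftedE; rewrite Ax sgvalP.
  - exact/(kerm_cent Ax).
  - by have := congr1 (@omx R n) AA.
exists (SubGrp AF) => //; apply/(@BFP _ _ _ (SubGrp AF) A erefl); split.
  exact/(@kerm_cent (SubGrp AF) A).
exact: val_inj.
Qed.

Hypothesis Fmax : maximal_abelian F.
Let hE := lifted_max Fmax.

Lemma cproj_refl_lift P : cproj lifted P ->
  exists2 A : orth R n, omx A = 1%:M - P - P & BF_lift F A.
Proof.
move=> hP; have EA := cproj_refl hE hP; have [A AE] := orthE (mc_orth hE EA).
exists A => //; apply/BF_liftP; rewrite AE; have [PT PP cP] := hP; split=> //.
  by do 2!apply: centB => //; apply: cent1.
by rewrite !mulmxBl !mulmxBr !mul1mx mulmx1 PP !subrr !sub0r !opprK !subrK.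
Qed.

Lemma BF_lift_cproj A : BF_lift F A ->
  cproj lifted (2%:R^-1 *: (1%:M - omx A)) /\
  omx A = 1%:M - 2%:R^-1 *: (1%:M - omx A) - 2%:R^-1 *: (1%:M - omx A).
Proof.
move=> /BF_liftP[EA cA AA]; split; last first.
  by rewrite -addrA -opprD -scalerDr half2 opprB addrCA subrr addr0.
have AT : A^T = A by rewrite -[LHS]mulmx1 -AA mulmxA omxTK mul1mx.
split.
- by rewrite trmxZ linearB /= tr_scalar_mx AT.
- rewrite -scalemxAl -scalemxAr !mulmxBl !mulmxBr !mul1mx mulmx1 AA opprB.
  by rewrite half2.
- by apply/centZ/centB => //; apply: cent1.
Qed.

Variables (s0 s1 : nat) (V : 'I_(s0 + s1) -> {vspace 'cV[R]_n}).
Hypothesis V_ord : eigenspace_ordering F V.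

(** The reflection in Q belongs to the preimage of B_F, hence acts as a scalar
    on U; so does Q, and an idempotent scalar is 0 or 1. *)
Lemma eigenspace_atom Q (U : {vspace 'cV[R]_n}) P :
  cproj lifted Q -> simult_eigenspace (BF_lift F) U ->
  (forall v, v \in U <-> P *m v = v) -> P *m P = P -> P != 0 ->
  Q *m P = 0 \/ Q *m P = P.
Proof.
move=> hQ [_ [chi Uchi]] UP PP Pn0; have [A AE AB] := cproj_refl_lift hQ.
have QP : Q *m P = (2%:R^-1 * (1 - chi A)) *: P.
  apply: eq_mulmx_col => x; have /Uchi/(_ A AB) : P *m x \in U by apply/UP; rewrite mulmxA PP.
  rewrite -scalemxAl -mulmxA AE !mulmxBl mul1mx => h.
  by rewrite -scalerA scalerBl scale1r -h -addrA -opprD opprB addrCA subrr addr0 half2.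
have [_ QQ _] := hQ; move: QP; set c := _ * _ => QP.
have : Q *m (Q *m P) = Q *m P by rewrite mulmxA QQ.
rewrite !QP -scalemxAr QP scalerA => /eqP.
rewrite -subr_eq0 -scalerBl scaler_eq0 (negPf Pn0) orbF -{3}[c]mulr1 -mulrBr mulf_eq0.
case/orP; first by move/eqP ->; left; rewrite scale0r.
by rewrite subr_eq0 => /eqP ->; right; rewrite scale1r.
Qed.

(** Each eigenspace is stable under E, because E commutes with the preimage of
    B_F, so its projection is in [cproj], and it is minimal by
    [eigenspace_atom]. If the projections did not add up to 1, there would be
    a minimal projection below the complement; its range is itself a
    simultaneous eigenspace, a contradiction. *)
Lemma frame_exists : exists P J : 'I_(s0 + s1) -> 'M[R]_n,
  [/\ frame lifted P J, forall a v, v \in V a <-> P a *m v = v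
    & forall a, \tr (P a) = (\dim (V a))%:R].
Proof.
have [Vinj Vall _ _] := V_ord.
have /choice[P PV] a := orth_projection_exists (V a).
have Veig a : simult_eigenspace (BF_lift F) (V a) by apply/Vall; exists a.
have VP a v : v \in V a <-> P a *m v = v by case: (PV a).
have PT a : (P a)^T = P a by case: (PV a).
have PP a : P a *m P a = P a by case: (PV a).
have Pn0 a : P a != 0.
  have [Vn0 _] := Veig a; apply: contraNneq Vn0 => P0; rewrite -subv0; apply/subvP => v.
  by move/VP; rewrite P0 mul0mx => <-; apply: mem0v.
have PAP a (A : 'M[R]_n) : lifted A -> P a *m A *m P a = A *m P a.
  move=> EA; apply: eq_mulmx_col => x; rewrite -!mulmxA; apply/VP.
  have [_ [chi Uchi]] := Veig a; apply/Uchi => B BB; have [EB cB _] := (BF_liftP B).1 BB.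
  have /Uchi/(_ B BB) PxB : P a *m x \in V a by apply/VP; rewrite mulmxA PP.
  by rewrite (mulmxA (omx B)) -(cB _ EA) -mulmxA PxB -scalemxAr.
have hP a : cproj lifted (P a).
  split=> // A EA; rewrite -PAP // -[RHS]trmxK trmx_mul PT -(PAP a _ (mc_tr hE EA)).
  by rewrite !trmx_mul trmxK PT mulmxA.
have aP a : atom lifted (P a).
  by split=> // Q hQ; apply: eigenspace_atom (Veig a) _ _ _.
have Porth a b : a != b -> P a *m P b = 0.
  move=> ab; have [_ _ amin] := aP a; have [_ _ bmin] := aP b.
  have [//|Pb] := bmin _ (hP a); have PC : P a *m P b = P b *m P a.
    by rewrite (cproj_cent hE (hP a)) //; case: (hP b).
  have [Q0|Pa] := amin _ (hP b); first by rewrite PC.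
  case/eqP: ab; apply: Vinj; apply/vspaceP => v.
  have PE : P a = P b by rewrite -Pa -PC Pb.
  by apply/idP/idP => /VP h; apply/VP; rewrite ?PE // -PE.
have Psum : \sum_a P a = 1%:M.
  apply/eqP; rewrite eq_sym -subr_eq0; apply/eqP; apply: contrapT => /eqP Qn0.
  have hS : cproj lifted (\sum_a P a).
    split; last by apply: cent_sum => a; case: (hP a).
      by rewrite linear_sum; apply: eq_bigr => a _; apply: PT.
    rewrite mulmx_suml; apply: eq_bigr => a _; rewrite mulmx_sumr (bigD1 a) //= PP big1 ?addr0 //.
    by move=> b ba; rewrite Porth // eq_sym.
  have hQ := cprojC hS; have [P' aP' QP'] := atom_below hE hQ Qn0.
  have [hP' P'n0 P'min] := aP'; have [P'T P'P' cP'] := hP'.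
  pose U := lker (linfun (mulmx (P' - 1%:M))) : {vspace 'cV[R]_n}.
  have UP v : v \in U <-> P' *m v = v.
    rewrite memv_ker lfunE /= mulmxBl mul1mx subr_eq0.
    by split=> [/eqP|->].
  (* U is the eigenspace of the character by which the preimage of B_F acts on
     the range of P'. *)
  have [a Va] : exists a, V a = U.
    apply/Vall; split.
      apply: contraNneq P'n0 => U0; apply/eqP/eq_mulmx_col => x; rewrite mul0mx.
      by apply/eqP; rewrite -memv0 -U0; apply/UP; rewrite mulmxA P'P'.
    exists (fun A => if `[< A *m P' = P' >] then 1 else -1) => v; split.
      move=> /UP vE A AB; rewrite -vE !mulmxA; case: asboolP => AP'.
        by rewrite AP' scale1r.
      have [hQA AE] := BF_lift_cproj AB.
      rewrite AE !mulmxBl mul1mx; have [Q0|->] := P'min _ hQA.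
        by case: AP'; rewrite AE !mulmxBl mul1mx Q0 !subr0.
      by rewrite subrr sub0r scaleN1r.
    have [A AE AB] := cproj_refl_lift hP'.
    move/(_ A AB); case: asboolP => [AP'|_].
      case/eqP: P'n0; move: AP'; rewrite AE !mulmxBl mul1mx P'P' subrr sub0r => /esym/eqP.
      rewrite -addr_eq0 => /eqP P2; by rewrite -[P']half2 P2 scaler0.
    rewrite AE !mulmxBl mul1mx scaleN1r => vE; apply/UP.
    rewrite -[LHS]half2 -[RHS]half2; congr (_ *: _).
    move/eqP: vE; rewrite -addrA -opprD subr_eq addrC -subr_eq opprK => /eqP.
    by [].
  have PaP' : P a *m P' = P'.
    by apply: eq_mulmx_col => x; rewrite -mulmxA; apply/VP; rewrite Va; apply/UP; rewrite mulmxA P'P'.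
  case/eqP: P'n0; rewrite -PaP' -QP' mulmxA mulmxBr mulmx1 mulmx_sumr (bigD1 a) //= PP big1.
    by rewrite addr0 subrr mul0mx.
  by move=> b ba; rewrite Porth // eq_sym.
have /choice[J JP] a := commutant_atom hE (aP a).
exists P, J; split; [split=> // a | by [] | by move=> a; case: (PV a)].
all: by case: (JP a).
Qed.

End Lifted.

(** * Bases of elementary abelian 2-groups *)

Section ElementaryAbelian.
Local Open Scope group_scope.
Variable G : groupType.
Hypothesis GC : forall x y : G, x * y = y * x.
Hypothesis G2 : forall x : G, x * x = 1.

Definition F2_comb r (e : 'I_r -> G) (c : {ffun 'I_r -> bool}) : G :=
  \prod_(i < r) e i ^+ c i.

Lemma prod_commM (I : Type) (s : seq I) (f g : I -> G) :
  (\prod_(i <- s) f i) * (\prod_(i <- s) g i) = \prod_(i <- s) (f i * g i).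
Proof.
elim: s => [|i s IHs]; first by rewrite !big_nil mulg1.
rewrite !big_cons -IHs -!mulgA; congr (_ * _); rewrite !mulgA; congr (_ * _).
exact: GC.
Qed.

Lemma expg_addb (x : G) (b c : bool) : x ^+ b * x ^+ c = x ^+ (b (+) c).
Proof. by case: b c => [] []; rewrite /= ?expg1 ?expg0 ?mulg1 ?mul1g. Qed.

Lemma F2_combM r (e : 'I_r -> G) c d :
  F2_comb e c * F2_comb e d = F2_comb e [ffun i => c i (+) d i].
Proof.
rewrite /F2_comb prod_commM; apply: eq_bigr => i _.
by rewrite ffunE expg_addb.
Qed.

Lemma F2_basisP r (e : 'I_r -> G) :
  F2_basis e <-> injective (F2_comb e) /\ forall x, exists c, F2_comb e c = x.
Proof.
split=> [eB|[einj esurj] x].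
  split=> [c d cd|x]; last by have [c [cE _]] := eB x; exists c.
  by have [c' [_ c'u]] := eB (F2_comb e c); rewrite -(c'u c) // -(c'u d).
by have [c cE] := esurj x; exists c; split=> // d dE; apply: einj; rewrite cE dE.
Qed.

(** The bound on the size of finite subsets of G makes a linearly independent
    family of maximal length exist; by maximality it generates. *)
Lemma F2_basis_exists (N : nat) :
    (forall (K : finType) (f : K -> G), injective f -> (#|K| <= N)%N) ->
  exists r (e : 'I_r -> G), F2_basis e.
Proof.
move=> cardN; pose indep r := exists e : 'I_r -> G, injective (F2_comb e).
have indep0 : indep 0.
  by exists (fun=> 1) => c d _; apply/ffunP => -[].
have indepN r : indep r -> (r <= N)%N.
  case=> e /cardN; rewrite card_ffun card_bool card_ord; apply: leq_trans.
  exact: ltnW (ltn_expl _ _).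
have exP : exists r, `[< indep r >] by exists 0; apply/asboolP.
have bP r : `[< indep r >] -> (r <= N)%N by move/asboolP/indepN.
have [r /asboolP[e einj] rmax] := ex_maxnP exP bP.
exists r, e; apply/F2_basisP; split=> // x; apply: contrapT => nx.
have /asboolP/rmax : indep r.+1; last by rewrite ltnn.
(* If x is not a combination of e, then e followed by x is still independent. *)
pose e' (i : 'I_r.+1) := if unlift ord_max i is Some j then e j else x.
have e'E c : F2_comb e' c = F2_comb e [ffun j => c (lift ord_max j)] * x ^+ c ord_max.
  rewrite /F2_comb big_ord_recr /= /e' unlift_none; congr (_ * _).
  apply: eq_bigr => j _; rewrite ffunE.
  have -> : widen_ord (leqnSn r) j = lift ord_max j by apply/val_inj/esym/lift_max.
  by rewrite liftK.
exists e' => c d; rewrite !e'E.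
have [cd|/negP ncd] := boolP (c ord_max == d ord_max).
  rewrite (eqP cd) => /mulIg/einj/ffunP cdE; apply/ffunP => i.
  have [j ->|->] := unliftP ord_max i; last exact/eqP.
  by have := cdE j; rewrite !ffunE.
set c' := [ffun j => _]; set d' := [ffun j => _] => E; case: nx.
(* A relation in which x occurs can be solved for x. *)
exists [ffun j => c' j (+) d' j]; rewrite -F2_combM.
have ncd' : x ^+ c ord_max * x ^+ d ord_max = x.
  by rewrite expg_addb; case: (c _) (d _) ncd => [] [] //= _; rewrite expg1.
have : F2_comb e c' * x ^+ c ord_max * x ^+ d ord_max = F2_comb e d'.
  by rewrite E -mulgA G2 mulg1.
rewrite -mulgA ncd' => <-.
by rewrite mulgA G2 mul1g.
Qed.

(** The rank is defined by a choice of basis; two bases have the same length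
    because 2^r counts the elements of G. *)
Lemma F2_rankE r (e : 'I_r -> G) : F2_basis e -> F2_rank G = r.
Proof.
move=> eB; have : exists e' : 'I_(F2_rank G) -> G, F2_basis e'.
  apply: (@xgetPex _ 0 [set r | exists e : 'I_r -> G, F2_basis e]%classic).
  by exists r, e.
move=> [e' /F2_basisP[einj' esurj']]; have /F2_basisP[einj esurj] := eB.
have [f fK] := choice esurj; have [f' fK'] := choice esurj'.
have le a b (g : {ffun 'I_a -> bool} -> {ffun 'I_b -> bool}) : injective g -> (a <= b)%N.
  by move=> /leq_card; rewrite !card_ffun card_bool !card_ord leq_exp2l.
apply/eqP; rewrite eqn_leq; apply/andP; split.
  by apply: (le _ _ (f \o F2_comb e')) => c d /= /(congr1 (F2_comb e)); rewrite !fK => /einj'.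
by apply: (le _ _ (f' \o F2_comb e)) => c d /= /(congr1 (F2_comb e')); rewrite !fK' => /einj.
Qed.

End ElementaryAbelian.

(** * The quotient F / ker m and its symplectic form *)

Section Fbar.
Local Open Scope ring_scope.
Variables (R : realType) (n : nat) (F : abelianClosed (PO R n)).
Hypothesis Fmax : maximal_abelian F.
Hypothesis n_gt0 : (0 < n)%N.
Let hE := lifted_max Fmax.
Implicit Types (A B : orth R n) (x y : subgrp F) (u v : Fbar F).

(** Classes of F / ker m. Together with [lft], which picks one orthogonal
    matrix in each class, this turns statements on F / ker m into statements
    on matrices. *)
Definition cls x : Fbar F := qproj (kerm F) x.
Definition lft u : orth R n := qrepr (sgval (qrepr u)).

Lemma lft_proj u : po_proj (lft u) = sgval (qrepr u).
Proof. exact: qreprK. Qed.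

Lemma lft_mem u : lifted F (lft u).
Proof. by apply/liftedE; rewrite lft_proj sgvalP. Qed.

Lemma lft_cls u : cls (qrepr u) = u.
Proof. exact: qreprK. Qed.

Lemma cls_eq x y A B : po_proj A = sgval x -> po_proj B = sgval y ->
  cls x = cls y <-> cent (lifted F) (A^T *m B).
Proof.
move=> Ax By; rewrite /cls qprojP (kerm_cent (A := A^-1 * B)%g) //.
by rewrite po_projM po_projV Ax By.
Qed.

Lemma clsM x y : cls (x * y)%g = (cls x * cls y)%g.
Proof. exact: qprojM. Qed.

Lemma lft_gen (M : 'M[R]_n) : lifted F M -> exists u z, cent (lifted F) z /\ M = lft u *m z.
Proof.
move=> [A <- AF]; exists (cls (SubGrp AF)), ((lft (cls (SubGrp AF)))^T *m A); split.
  apply/(@cls_eq (qrepr (cls (SubGrp AF))) (SubGrp AF)) => //; first exact: lft_proj.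
  exact: lft_cls.
by rewrite mulmxA omxKT mul1mx.
Qed.

Lemma lft_inj u v : cent (lifted F) ((lft u)^T *m lft v) -> u = v.
Proof. by move/(cls_eq (lft_proj u) (lft_proj v)); rewrite !lft_cls. Qed.

Lemma FbarC u v : (u * v = v * u)%g.
Proof. by rewrite -(lft_cls u) -(lft_cls v) -!clsM abmulgC. Qed.

(** Squares of elements of E are in the commutant by [cent_sqr]. *)
Lemma Fbar2 u : (u * u = 1)%g.
Proof.
rewrite -(lft_cls u) -clsM; apply: (@cls_eq _ 1%g (lft u * lft u)%g 1%g _ _).2.
- by rewrite po_projM lft_proj.
- by [].
rewrite omx1 mulmx1; apply: (centT hE); apply: (cent_sqr hE); exact: lft_mem.
Qed.

(** This is how F / ker m is seen to be finite: distinct classes have lifts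
    that are orthogonal for the trace form. *)
Lemma Fbar_card (K : finType) (f : K -> Fbar F) : injective f -> (#|K| <= n * n)%N.
Proof.
move=> finj; apply: (card_transversal hE (X := fun k => lft (f k))) => // [k|k l].
  exact: lft_mem.
by move/lft_inj/finj.
Qed.

Lemma Fbar_basis : exists r (e : 'I_r -> Fbar F), F2_basis e.
Proof. exact: (F2_basis_exists FbarC Fbar2 Fbar_card). Qed.

Lemma omx_neq0 A : omx A != 0.
Proof.
apply/eqP => A0; have := omxTK A; rewrite A0 mulmx0 => /matrixP/(_ (Ordinal n_gt0) (Ordinal n_gt0)).
by rewrite !mxE eqxx => /eqP; rewrite eq_sym oner_eq0.
Qed.

Lemma signZ_inj (M : 'M[R]_n) (b c : bool) : M != 0 -> (-1) ^+ b *: M = (-1) ^+ c *: M -> b = c.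
Proof.
move=> Mn0 /eqP; rewrite -subr_eq0 -scalerBl scaler_eq0 (negPf Mn0) orbF subr_eq0.
by move/eqP/signr_inj.
Qed.

Lemma mform_eq x y A B (e : bool) : po_proj A = sgval x -> po_proj B = sgval y ->
  A *m B = (-1) ^+ e *: (B *m A) -> mform x y = e.
Proof.
move=> Ax By; rewrite (mform_comm Ax By); apply: signZ_inj.
exact: (omx_neq0 (B * A)%g).
Qed.

Lemma mformM x x' y : mform (x * x')%g y = mform x y (+) mform x' y.
Proof.
have [[Ax Ax'] By] := (qreprK (sgval x), qreprK (sgval x'), qreprK (sgval y)).
apply: (@mform_eq _ _ (qrepr (sgval x) * qrepr (sgval x'))%g (qrepr (sgval y))) => //.
move: (qrepr (sgval x)) (qrepr (sgval x')) (qrepr (sgval y)) Ax Ax' By => A A' B Ax Ax' By.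
rewrite omxM -(mulmxA A A') (mform_comm Ax' By) -scalemxAr (mulmxA (omx A)) (mform_comm Ax By).
by rewrite -scalemxAl scalerA signr_addb mulrC mulmxA.
Qed.

Lemma mformC x y : mform x y = mform y x.
Proof.
have [Ax By] := (qreprK (sgval x), qreprK (sgval y)).
apply: (mform_eq Ax By); rewrite (mform_comm By Ax) signZK //.
Qed.

Lemma mform_barM u v w : mform_bar (u * v)%g w = mform_bar u w (+) mform_bar v w.
Proof.
rewrite -(lft_cls u) -(lft_cls v) -(lft_cls w) -clsM !mform_barE.
exact: mformM.
Qed.

Lemma mform_barC u v : mform_bar u v = mform_bar v u.
Proof. exact: mformC. Qed.

Lemma mform_barMr w u v : mform_bar w (u * v)%g = mform_bar w u (+) mform_bar w v.
Proof. by rewrite mform_barC mform_barM mform_barC [mform_bar v w]mform_barC. Qed.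

Lemma mform_bar_nondeg u : (forall v, mform_bar u v = false) -> u = 1%g.
Proof.
move=> u0; rewrite -(lft_cls u); apply/qprojP; rewrite mulg1 gpredV.
apply/asboolP => y; rewrite -mform_barE.
have := u0 (cls y); by rewrite -{1}(lft_cls u).
Qed.

(** By nondegeneracy, c |-> (m(c, e_i))_i is injective on F / ker m, and both
    sides have 2^r elements; so there is a c matching chi on the basis. *)
Lemma character_mform (chi : Fbar F -> bool) :
  (forall u v, chi (u * v)%g = chi u (+) chi v) -> exists c, forall u, mform_bar c u = chi u.
Proof.
move=> chiM; have [r [e eB]] := Fbar_basis; have [einj esurj] := (F2_basisP e).1 eB.
have char_eq (f g : Fbar F -> bool) : (forall u v, f (u * v)%g = f u (+) f v) ->
    (forall u v, g (u * v)%g = g u (+) g v) -> (forall i, f (e i) = g (e i)) -> f =1 g.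
  move=> fM gM fg u; have [c <-] := esurj u.
  have one (h : Fbar F -> bool) : (forall u v, h (u * v)%g = h u (+) h v) -> h 1%g = false.
    by move=> hM; have := hM 1%g 1%g; rewrite mulg1; case: (h 1%g).
  rewrite /F2_comb; elim: (index_enum _) => [|i s IHs]; first by rewrite !big_nil !one.
  by rewrite !big_cons fM gM IHs; case: (c i); rewrite ?expg1 ?expg0 ?fg // !one.
pose phi (c : {ffun 'I_r -> bool}) := [ffun i => mform_bar (F2_comb e c) (e i)].
have phiinj : injective phi.
  move=> c d /ffunP cd; apply: einj.
  have : (F2_comb e c * F2_comb e d = 1)%g.
    apply: mform_bar_nondeg; apply: (char_eq _ (fun=> false)) => //.
      by move=> u v; rewrite mform_barMr.
    by move=> i; rewrite mform_barM; have := cd i; rewrite !ffunE => ->; rewrite addbb.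
  by move=> h; rewrite -[LHS]mulg1 -(Fbar2 (F2_comb e d)) mulgA h mul1g.
have [g _ gK] := injF_bij phiinj.
exists (F2_comb e (g [ffun i => chi (e i)])); apply: char_eq => //.
  by move=> u v; rewrite mform_barMr.
move=> i; have /ffunP/(_ i) := gK [ffun i => chi (e i)].
by rewrite !ffunE.
Qed.

End Fbar.

(** * Real and complex eigenspaces *)

Section Types.
Local Open Scope ring_scope.
Variables (R : realType) (n : nat) (F : abelianClosed (PO R n)).
Hypothesis Fmax : maximal_abelian F.
Hypothesis n_gt0 : (0 < n)%N.
Let hE := lifted_max Fmax.
Implicit Types (A B : orth R n) (x y : subgrp F) (u v : Fbar F).

Variables (s0 s1 : nat) (V : 'I_(s0 + s1) -> {vspace 'cV[R]_n}).
Hypothesis V_ord : eigenspace_ordering F V.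
Variables (P J : 'I_(s0 + s1) -> 'M[R]_n).
Hypothesis fr : frame (lifted F) P J.
Hypothesis VP : forall a (v : 'cV[R]_n), v \in V a <-> P a *m v = v.
Hypothesis dimP : forall a, \tr (P a) = (\dim (V a))%:R.

Definition idx0 (i : 'I_s0) : 'I_(s0 + s1) := lshift s1 i.
Definition idx1 (j : 'I_s1) : 'I_(s0 + s1) := rshift s0 j.

(** [sqr_mxtrace_atom] for the lifts of the 2^r elements of F / ker m. *)
Lemma dim_eigenspace r (e : 'I_r -> Fbar F) a : F2_basis e ->
  ((\dim (V a)) ^ 2 = 2 ^ r * (if J a == 0%R then 1 else 4))%N.
Proof.
move=> eB; have [einj esurj] := (F2_basisP e).1 eB.
have := @sqr_mxtrace_atom _ _ _ hE _ (fun c => lft (F2_comb e c)) _ _ _ _ P J fr a.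
rewrite dimP card_ffun card_bool card_ord => cnt.
apply/eqP; rewrite -(eqr_nat R) natrX natrM; apply/eqP; rewrite cnt.
- by case: eqP => _; rewrite ?expr1n // -natrX.
- by move=> c; apply: lft_mem.
- by move=> c d /lft_inj/einj.
- move=> A /lft_gen[u [z [cz AE]]]; have [c cE] := esurj u.
  by exists c, z; rewrite cE.
Qed.

(** With dim V_a equal to 2^k or 2^(k+1) and k the integer part of r / 2, the
    equation of [dim_eigenspace] leaves only one type for each dimension. *)
Lemma frame_J : (forall i, J (idx0 i) = 0) /\ (forall j, J (idx1 j) <> 0).
Proof.
have [r [e eB]] := Fbar_basis Fmax n_gt0.
have [_ _ dim0 dim1] := V_ord.
have kE : k_of F = r./2 by rewrite /k_of (F2_rankE eB).
split=> [a|j].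
  apply: contrapT => /eqP Jn0; have := dim_eigenspace (idx0 a) eB.
  rewrite dim0 (negPf Jn0) -(expnD 2 r 2) -expnM => /eqP; rewrite eqn_exp2l // => /eqP kr.
  have := odd_double_half r; rewrite -kE -muln2 kr => rE.
  have : (r < odd r + (r + 2))%N by rewrite addnCA -[X in (X < _)%N]addn0 ltn_add2l addn2.
  by rewrite rE ltnn.
move=> J0; have := dim_eigenspace (idx1 j) eB.
rewrite dim1 J0 eqxx muln1 -expnM => /eqP; rewrite eqn_exp2l // => /eqP kr.
have := half_double (k_of F).+1; rewrite -muln2 kr -kE => /eqP.
by rewrite eqn_leq ltnn andbF.
Qed.

(** On a real eigenspace A A is an orthogonal scalar, that is, a sign, and
    [mu_of] records this sign whatever the lift A. *)
Lemma mu_ofP i x A : po_proj A = sgval x ->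
  A *m A *m P (idx0 i) = (-1) ^+ mu_of V i x *: P (idx0 i).
Proof.
move=> Ax; set p := P (idx0 i).
have EA : lifted F A by apply/liftedE; rewrite Ax sgvalP.
have [z [t [AE zt Jt]]] := mem_cent_coord hE fr (idx0 i) (mc_mul hE EA EA) (cent_sqr hE EA).
have J0 := frame_J.1 i; rewrite (Jt J0) expr0n addr0 in zt.
have {}AE : A *m A *m p = z *: p by rewrite AE /cscal J0 scaler0 addr0.
have [e zE] : exists e : bool, z = (-1) ^+ e.
  move/eqP: zt; rewrite sqrf_eq1 => /orP[]/eqP ->; [by exists false | by exists true].
rewrite AE zE; congr (_ ^+ _ *: _); congr nat_of_bool.
rewrite /mu_of; case: asboolP => [h|nh] /=; last first.
  case: e zE => // z1; case: nh => B Bx v /VP; rewrite -/(idx0 i) -/p => vE.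
  have /po_projP[Z ZI BE] : po_proj A = po_proj B by rewrite Ax Bx.
  have [b ZE] := pmIP _ ZI.
  rewrite -vE !mulmxA BE !omxM ZE !mul_mx_scalar -!scalemxAl -!scalemxAr -!scalemxAl.
  by rewrite scalerA -expr2 sqrr_sign scale1r AE z1 expr0 scale1r.
case: e zE => // z1; move: AE; rewrite z1 expr1 scaleN1r => AE.
have : p = - p.
  rewrite -AE; apply: eq_mulmx_col => v; rewrite -!mulmxA; apply/esym/(h A Ax)/VP.
  by rewrite mulmxA (fr_PP fr).
move/eqP; rewrite -addr_eq0 -mulr2n -scaler_nat scaler_eq0 pnatr_eq0 /=.
by rewrite (negPf (fr_neq0 fr (idx0 i))).
Qed.

Lemma mu_of_eq i x A (e : bool) : po_proj A = sgval x ->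
  A *m A *m P (idx0 i) = (-1) ^+ e *: P (idx0 i) -> mu_of V i x = e.
Proof. by move=> /mu_ofP ->; apply: signZ_inj; apply: fr_neq0 fr _. Qed.

(** Two lifts of a class differ by an element of the commutant, which acts on
    a real eigenspace as a sign; its square is 1. *)
Lemma mu_barE i x : mu_bar V i (cls x) = mu_of V i x.
Proof.
rewrite /mu_bar; apply/esym; set y := qrepr _; have Ax := qreprK (sgval x).
set A := qrepr (sgval x) in Ax; have [By] := qreprK (sgval y).
set B := qrepr (sgval y) in By; apply: (mu_of_eq Ax).
have /(cls_eq Ax By) cZ : cls x = cls y by rewrite [cls y]lft_cls.
rewrite -(mu_ofP i By).
have EA : lifted F A by apply/liftedE; rewrite [po_proj A]Ax sgvalP.
have EB : lifted F B by apply/liftedE; rewrite [po_proj B]By sgvalP.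
have EZ := mc_mul hE (mc_tr hE EA) EB; have [z [t [ZE zt Jt]]] := mem_cent_coord hE fr (idx0 i) EZ cZ.
have J0 := frame_J.1 i; rewrite (Jt J0) expr0n addr0 in zt.
have BE : omx B = A *m (A^T *m B) by rewrite mulmxA omxKT mul1mx.
have ZP : A^T *m B *m P (idx0 i) = z *: P (idx0 i) by rewrite ZE /cscal J0 scaler0 addr0.
move: (A^T *m B) EZ cZ ZE BE ZP => Z EZ cZ ZE BE ZP.
rewrite BE !mulmxA -(mulmxA (omx A) Z) -(cZ _ EA) -!mulmxA ZP -[Z *m _]scalemxAr ZP.
by rewrite scalerA -expr2 zt scale1r.
Qed.

End Types.

(** * Automorphisms induced by the normaliser *)

Section GroupGeneralities.
Local Open Scope group_scope.

Section ConjAut.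
Variables (G : groupType) (S : abelianClosed G).
Implicit Types (w : subgrp (normg S)) (y : subgrp S).

Fact conj_mem w y : sgval y ^ (sgval w)^-1 \in S.
Proof. by have /asboolP -> := sgvalP w^-1; apply: sgvalP. Qed.

Definition conj_by w y : subgrp S := SubGrp (conj_mem w y).

Lemma conj_byE w y : sgval (conj_by w y) = sgval w * sgval y * (sgval w)^-1.
Proof. by rewrite /= /conjg invgK mulgA. Qed.

Fact conj_byK w : cancel (conj_by w) (conj_by w^-1).
Proof. by move=> y; apply: val_inj; rewrite /= invgK conjgKV. Qed.
Fact conj_byVK w : cancel (conj_by w^-1) (conj_by w).
Proof. by move=> y; apply: val_inj; rewrite /= invgK conjgK. Qed.
Fact conj_byM w : {morph conj_by w : x y / x * y}.
Proof. by move=> x y; apply: val_inj; rewrite /= conjMg. Qed.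

Definition conj_aut w : autgrp (subgrp S) := AutGrp (conj_byK w) (conj_byVK w) (@conj_byM w).

Fact conj_aut_morph : {morph conj_aut : w w' / w * w'}.
Proof. by move=> w w'; apply: autgrpP => y; apply: val_inj; rewrite /= invgM conjgM. Qed.

HB.instance Definition _ := monoid.isMultiplicative.Build _ _ conj_aut conj_aut_morph.

Lemma weyl_eq w w' : qproj (@cent_in_norm G S) w = qproj (@cent_in_norm G S) w' <->
  forall y, conj_aut w y = conj_aut w' y.
Proof.
have key (a b z : G) : (a^-1 * b * z = z * (a^-1 * b)) <-> a * z * a^-1 = b * z * b^-1.
  split=> E.
    apply: (mulIg b); rewrite mulgKV -[RHS](mulKVg a) [a^-1 * (b * z)]mulgA E.
    by rewrite !mulgA.
  apply: (mulgI a); rewrite !mulgA mulgV mul1g; apply: (mulIg b^-1).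
  by rewrite mulgK -E.
rewrite qprojP; split=> [/asboolP wC y|wC].
  apply: val_inj; change (sgval (conj_by w y) = sgval (conj_by w' y)).
  by rewrite !conj_byE; apply/key/wC/sgvalP.
apply/asboolP => z zS; apply/key; have /(congr1 (@sgval _ _)) := wC (SubGrp zS).
by rewrite !conj_byE /=.
Qed.

End ConjAut.

Lemma multiplicative_exists (G H : groupType) (f : G -> H) : {morph f : x y / x * y} ->
  exists h : {multiplicative G -> H}, forall x, h x = f x.
Proof.
move=> fM; pose fm := monoid.isMultiplicative.Build G H f fM.
by exists (HB.pack_for {multiplicative G -> H} f fm).
Qed.

Lemma multiplicative_inj (G H : groupType) (h : {multiplicative G -> H}) :
  (forall x, h x = 1 -> x = 1) -> injective h.
Proof.
move=> h1 x y hxy; apply: (mulIg y^-1); rewrite mulgV; apply: h1.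
by apply: (mulIg (h y)); rewrite -gmulfM mulgKV mul1g.
Qed.

Lemma quot_multiplicative_exists (G H : groupType) (K : normalClosed G) (h : {multiplicative G -> H}) :
  (forall x, x \in K -> h x = 1) ->
  exists hb : {multiplicative quot K -> H}, forall x, hb (qproj K x) = h x.
Proof.
move=> hK; pose f (u : quot K) := h (qrepr u).
have fE x : f (qproj K x) = h x.
  by rewrite /f -[RHS]mulg1 -(hK _ (qrepr_qproj K x)) -gmulfM mulVKg.
have fM : {morph f : u v / u * v}.
  by move=> u v; rewrite -(qreprK u) -(qreprK v) -gmulfM !fE gmulfM.
have [hb hbE] := multiplicative_exists fM.
by exists hb => x; rewrite hbE.
Qed.

End GroupGeneralities.

Section NormalizerAction.
Local Open Scope ring_scope.
Variables (R : realType) (n : nat) (F : abelianClosed (PO R n)).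
Hypothesis Fmax : maximal_abelian F.
Hypothesis n_gt0 : (0 < n)%N.
Let hE := lifted_max Fmax.
Implicit Types (A B g h : orth R n) (x y : subgrp F) (u v : Fbar F).
Implicit Types (w : subgrp (normg F)).

Lemma conj_lift w y g A : po_proj g = sgval w -> po_proj A = sgval y ->
  po_proj (g * A * g^-1)%g = sgval (conj_aut w y).
Proof. by move=> gw Ay; rewrite conj_byE !po_projM po_projV gw Ay. Qed.

Lemma normg_lift w g (M : 'M[R]_n) : po_proj g = sgval w ->
  lifted F M -> lifted F (g *m M *m g^T).
Proof.
move=> gw [A <- AF]; exists (g * A * g^-1)%g => //.
by rewrite (@conj_lift w (SubGrp AF)) // sgvalP.
Qed.

(** The condition defining the normaliser is an equivalence; half of it is
    enough by [conj_mem_sym]. *)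
Lemma normg_of g : (forall M, lifted F M -> lifted F (g *m M *m g^T)) ->
  po_proj g \in normg F.
Proof.
move=> gE; have gE' := conj_mem_sym hE (omxTK g) gE.
apply/asboolP => y; rewrite -(qreprK y) -/(po_proj _); move: (qrepr y) => A.
have -> : (po_proj A ^ po_proj g)%g = po_proj (A ^ g)%g.
  by rewrite /conjg !po_projM po_projV.
have AgE : omx (A ^ g)%g = g^T *m A *m g by rewrite -mulmxA.
apply/idP/idP => /liftedE EA; apply/liftedE; last by rewrite AgE; apply: gE'.
have := gE _ EA; rewrite AgE !mulmxA omxKT mul1mx -mulmxA omxKT mulmx1.
by [].
Qed.

Lemma mform_conj w x y : mform (conj_aut w x) (conj_aut w y) = mform x y.
Proof.
have [[gw Ax] By] := (qreprK (sgval w), qreprK (sgval x), qreprK (sgval y)).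
move: (qrepr (sgval w)) (qrepr (sgval x)) (qrepr (sgval y)) gw Ax By => g A B gw Ax By.
apply: (mform_eq n_gt0 (conj_lift gw Ax) (conj_lift gw By)).
rewrite !omxM !omxV !mulmxA -!(mulmxA _ g^T g) omxTK !mulmx1.
by rewrite -(mulmxA _ A) (mform_comm Ax By) -scalemxAr -scalemxAl !mulmxA.
Qed.

Lemma cls_conj w x y : cls x = cls y -> cls (conj_aut w x) = cls (conj_aut w y).
Proof.
move=> /qprojP/asboolP xy; apply/qprojP/asboolP => z.
have -> : ((conj_aut w x)^-1 * conj_aut w y)%g = conj_aut w (x^-1 * y)%g.
  by apply: (mulgI (conj_aut w x)); rewrite mulVKg -(aut_morph (conj_aut w)) mulVKg.
by rewrite -(aut_invK (conj_aut w) z) mform_conj; apply: xy.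
Qed.

Definition fbar_fun w u : Fbar F := cls (conj_aut w (qrepr u)).

Lemma fbar_funE w x : fbar_fun w (cls x) = cls (conj_aut w x).
Proof. by apply: cls_conj; rewrite lft_cls. Qed.

Fact fbar_funM w : {morph fbar_fun w : u v / (u * v)%g}.
Proof.
move=> u v; rewrite -(lft_cls u) -(lft_cls v) -clsM !fbar_funE -clsM.
by rewrite (aut_morph (conj_aut w)).
Qed.

Fact fbar_funK w : cancel (fbar_fun w) (fbar_fun w^-1%g).
Proof.
move=> u; rewrite -(lft_cls u) !fbar_funE; congr cls.
exact: (aut_funK (conj_aut w)).
Qed.

Fact fbar_funVK w : cancel (fbar_fun w^-1%g) (fbar_fun w).
Proof.
move=> u; rewrite -(lft_cls u) !fbar_funE; congr cls.
exact: (aut_invK (conj_aut w)).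
Qed.

Definition fbar_aut w : autgrp (Fbar F) :=
  AutGrp (fbar_funK w) (fbar_funVK w) (@fbar_funM w).

Lemma fbar_autE w x : fbar_aut w (cls x) = cls (conj_aut w x).
Proof. exact: fbar_funE. Qed.

Lemma fbar_autM w w' : fbar_aut (w * w')%g = (fbar_aut w * fbar_aut w')%g.
Proof.
apply: autgrpP => u; rewrite -(lft_cls u) fbar_autE [RHS]/= !fbar_funE.
by rewrite gmulfM.
Qed.

Lemma mform_bar_fbar w u v : mform_bar (fbar_aut w u) (fbar_aut w v) = mform_bar u v.
Proof.
by rewrite -(lft_cls u) -(lft_cls v) !fbar_autE !mform_barE mform_conj.
Qed.

End NormalizerAction.

(** * The quotient map of the exact sequence *)

Section WeylAction.
Local Open Scope ring_scope.
Variables (R : realType) (n : nat) (F : abelianClosed (PO R n)).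
Hypothesis Fmax : maximal_abelian F.
Hypothesis n_gt0 : (0 < n)%N.
Let hE := lifted_max Fmax.
Implicit Types (A B g h : orth R n) (x y : subgrp F) (u v : Fbar F).
Implicit Types (w : subgrp (normg F)).

Variables (s0 s1 : nat) (V : 'I_(s0 + s1) -> {vspace 'cV[R]_n}).
Hypothesis V_ord : eigenspace_ordering F V.
Variables (P J : 'I_(s0 + s1) -> 'M[R]_n).
Hypothesis fr : frame (lifted F) P J.
Hypothesis VP : forall a (v : 'cV[R]_n), v \in V a <-> P a *m v = v.
Hypothesis dimP : forall a, \tr (P a) = (\dim (V a))%:R.
Notation idx0 := (@idx0 s0 s1).
Notation idx1 := (@idx1 s0 s1).

Let J_idx0 i : J (idx0 i) = 0.
Proof. by have [] := frame_J Fmax n_gt0 V_ord fr dimP. Qed.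

Let J_idx1 j : J (idx1 j) <> 0.
Proof. by have [_] := frame_J Fmax n_gt0 V_ord fr dimP; apply. Qed.

(** The permutations are on the source side, so that [frame_actionM] holds for
    permutations composed from left to right and the product of the signs is
    the one of the signed permutation group. *)
Definition frame_action (g : 'M[R]_n) (rho : {perm 'I_s0}) (tau : {perm 'I_s1})
    (eps : {ffun 'I_s1 -> bool}) :=
  [/\ forall i, g *m P (idx0 (rho i)) *m g^T = P (idx0 i),
      forall j, g *m P (idx1 (tau j)) *m g^T = P (idx1 j)
    & forall j, g *m J (idx1 (tau j)) *m g^T = (-1) ^+ eps j *: J (idx1 j)].

Lemma conj_inj (g M N : 'M[R]_n) : g^T *m g = 1%:M ->
  g *m M *m g^T = g *m N *m g^T -> M = N.
Proof.
move=> gO /(congr1 (fun X => g^T *m X *m g)).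
by rewrite !mulmxA gO !mul1mx -!mulmxA gO !mulmx1.
Qed.

Lemma fr_P_inj a b : P a = P b -> a = b.
Proof. by move=> ab; apply: (fr_inj fr); rewrite ab (fr_PP fr) (fr_neq0 fr). Qed.

Lemma frame_action_uniq g rho tau eps rho' tau' eps' : g^T *m g = 1%:M ->
  frame_action g rho tau eps -> frame_action g rho' tau' eps' -> [/\ rho = rho', tau = tau' & eps = eps'].
Proof.
move=> gO [g0 g1 g2] [g0' g1' g2'].
have tE : tau = tau'.
  apply/permP => j; apply: (@rshift_inj s0); apply: fr_P_inj.
  by apply: (conj_inj gO); rewrite g1 g1'.
split=> //.
  apply/permP => i; apply: (@lshift_inj _ s1); apply: fr_P_inj.
  by apply: (conj_inj gO); rewrite g0 g0'.
apply/ffunP => j; apply: (@signZ_inj _ _ (J (idx1 j))); first exact/eqP/J_idx1.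
by rewrite -g2 -g2' tE.
Qed.

Lemma frame_actionM (g h : 'M[R]_n) rho tau eps rho' tau' eps' :
  frame_action g rho tau eps -> frame_action h rho' tau' eps' ->
  frame_action (g *m h) (rho * rho')%g (tau * tau')%g [ffun j => eps j (+) eps' (tau j)].
Proof.
move=> [g0 g1 g2] [h0 h1 h2].
have assoc M : g *m h *m M *m (g *m h)^T = g *m (h *m M *m h^T) *m g^T.
  by rewrite trmx_mul !mulmxA.
split=> [i|j|j]; rewrite assoc permM.
- by rewrite h0 g0.
- by rewrite h1 g1.
by rewrite h2 -scalemxAr -scalemxAl g2 scalerA ffunE signr_addb mulrC.
Qed.

Lemma frame_action_lifted (M : 'M[R]_n) : lifted F M -> frame_action M 1%g 1%g [ffun=> false].
Proof.
move=> EM; have MC N : cent (lifted F) N -> M *m N *m M^T = N.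
  by move=> cN; rewrite cN // -mulmxA (mc_orthT hE EM) mulmx1.
split=> [i|j|j]; rewrite perm1 MC ?ffunE ?expr0 ?scale1r //;
  [exact: (fr_cent fr) | exact: (fr_cent fr) | exact: (fr_centJ fr)].
Qed.

(** A permutation of the P a that is compatible with the types of the
    eigenspaces, as in [normalizer_J], is a pair of permutations. *)
Lemma frame_action_exists (g : 'M[R]_n) : g^T *m g = 1%:M ->
    (forall M, lifted F M -> lifted F (g *m M *m g^T)) ->
  exists rho tau eps, frame_action g rho tau eps.
Proof.
move=> gO gE; have [pi piP] := normalizer_perm hE fr gO gE.
have typ a := normalizer_J hE fr gO gE (piP a).
have /choice[f0 f0P] i : exists i', pi (idx0 i) = idx0 i'.
  case: (splitP (pi (idx0 i))) (typ (idx0 i)).1 => [i' e _|j e [/(_ (J_idx0 i)) J0 _]].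
    by exists i'; apply: val_inj.
  by case: (@J_idx1 j); rewrite -J0; congr J; apply: val_inj.
have /choice[f1 f1P] j : exists j', pi (idx1 j) = idx1 j'.
  case: (splitP (pi (idx1 j))) (typ (idx1 j)).1 => [i e [_ Ji]|j' e _]; last first.
    by exists j'; apply: val_inj.
  case: (@J_idx1 j); apply: Ji; rewrite (_ : pi (idx1 j) = idx0 i) //; exact: val_inj.
have f0I : injective f0.
  move=> i i' E; apply: (@lshift_inj _ s1); apply: (@perm_inj _ pi).
  by rewrite -!/(idx0 _) !f0P E.
have f1I : injective f1.
  move=> i i' E; apply: (@rshift_inj s0); apply: (@perm_inj _ pi).
  by rewrite -!/(idx1 _) !f1P E.
have /choice[e eP] j := (typ (idx1 j)).2.
exists (perm f0I), (perm f1I), [ffun j => e j]; split=> [i|j|j]; rewrite permE.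
- by rewrite -f0P.
- by rewrite -f1P.
by rewrite -f1P ffunE.
Qed.

Lemma frame_action_exists_norm w g : po_proj g = sgval w ->
  exists rho tau eps, frame_action g rho tau eps.
Proof.
by move=> gw; apply: frame_action_exists (omxTK g) _ => M; apply: normg_lift gw.
Qed.

(** If A squares to a sign on V_(rho i), then its conjugate by g squares to
    the same sign on V_i. *)
Lemma frame_action_mu w g rho tau eps i x : po_proj g = sgval w -> frame_action g rho tau eps ->
  mu_of V i (conj_aut w x) = mu_of V (rho i) x.
Proof.
move=> gw [g0 _ _]; have Ax := qreprK (sgval x); move: (qrepr _) Ax => A Ax.
apply: (mu_of_eq Fmax n_gt0 V_ord fr VP dimP (conj_lift gw Ax)).
rewrite !omxM !omxV -g0 !mulmxA -!(mulmxA _ g^T g) omxTK !mulmx1.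
rewrite -!(mulmxA (omx g)) -!mulmxA (mulmxA (omx A)) (mulmxA _ _ g^T).
rewrite (mu_ofP Fmax n_gt0 V_ord fr VP dimP _ Ax) -scalemxAl -scalemxAr.
by [].
Qed.

Lemma fbar_aut_Aut_mu w : fbar_aut n_gt0 w \in Aut_mu F V.
Proof.
apply/asboolP; split; first exact: mform_bar_fbar.
have gw := qreprK (sgval w); move: (qrepr _) gw => g gw.
have [rho [tau [eps gA]]] := frame_action_exists_norm gw.
exists rho^-1%g => i u; rewrite -(lft_cls u) [fbar_aut _ _ _]fbar_autE.
rewrite !(mu_barE Fmax n_gt0 V_ord fr VP dimP) (frame_action_mu _ _ gw gA).
by rewrite permKV.
Qed.

Lemma frame_action_po (g h : orth R n) rho tau eps : po_proj g = po_proj h ->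
  frame_action g rho tau eps -> frame_action h rho tau eps.
Proof.
move=> /po_projP[Z /pmIP[b ZE] ->] gA; rewrite omxM ZE.
have conjE M : g *m ((-1) ^+ b)%:M *m M *m (g *m ((-1) ^+ b)%:M)^T = g *m M *m g^T.
  rewrite mul_mx_scalar trmxZ -!scalemxAl -scalemxAr scalerA -expr2 sqrr_sign.
  by rewrite scale1r.
by case: gA => g0 g1 g2; split=> [i|j|j]; rewrite conjE.
Qed.

(** Two lifts of an element of the normaliser differ by a sign and act in the
    same way on the P a and J a, by [frame_action_po]; elements centralising F
    belong to F by maximality, and act trivially by [frame_action_lifted]. So
    the action is defined on N(F) / C(F). *)
Lemma weyl_action_exists : exists p : {multiplicative weyl F ->
      (subgrp (Aut_mu F V) * signed_perm s1)%type},
  forall w g rho tau eps, po_proj g = sgval w -> frame_action g rho tau eps ->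
    sgval (p (qproj (@cent_in_norm _ F) w)).1 = fbar_aut n_gt0 w /\
    (p (qproj (@cent_in_norm _ F) w)).2 = SdProd eps tau.
Proof.
have /choice[sp spP] w : exists x : signed_perm s1, forall g rho tau eps,
    po_proj g = sgval w -> frame_action g rho tau eps -> x = SdProd eps tau.
  have gw := qreprK (sgval w); move: (qrepr _) gw => g gw.
  have [rho [tau [eps gA]]] := frame_action_exists_norm gw.
  exists (SdProd eps tau) => h rho' tau' eps' hw hA.
  have {hA} hA := frame_action_po (etrans hw (esym gw)) hA.
  by have [_ -> ->] := frame_action_uniq (omxTK g) gA hA.
pose f w : (subgrp (Aut_mu F V) * signed_perm s1)%type :=
  (SubGrp (fbar_aut_Aut_mu w), sp w).
have fM : {morph f : w w' / (w * w')%g}.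
  move=> w w'; apply/pair_eqP/andP; split; apply/eqP.
    by apply: val_inj; apply: fbar_autM.
  have gw := qreprK (sgval w); have gw' := qreprK (sgval w').
  move: (qrepr (sgval w)) (qrepr (sgval w')) gw gw' => g g' gw gw'.
  have [rho [tau [eps gA]]] := frame_action_exists_norm gw.
  have [rho' [tau' [eps' gA']]] := frame_action_exists_norm gw'.
  have gwM : po_proj (g * g')%g = sgval (w * w')%g.
    by rewrite po_projM [po_proj g]gw [po_proj g']gw'.
  rewrite /= (spP _ _ _ _ _ gwM (frame_actionM gA gA')) (spP _ _ _ _ _ gw gA) (spP _ _ _ _ _ gw' gA').
  congr SdProd; apply/ffunP => j; rewrite !ffunE /=.
  by [].
have [fm fmE] := multiplicative_exists fM.
have fK w : w \in @cent_in_norm _ F -> fm w = 1%g.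
  move=> wC; rewrite fmE; have wF : sgval w \in F.
    by apply: (maximal_abelian_cent _ Fmax) => y yF; have /asboolP := wC; apply.
  have gw := qreprK (sgval w); move: (qrepr _) gw => g gw.
  have Eg : lifted F g by apply/liftedE; rewrite [po_proj g]gw.
  apply/pair_eqP/andP; split; apply/eqP.
    apply: val_inj; apply: autgrpP => u; change (cls (conj_aut w (qrepr u)) = u).
    rewrite -[RHS]lft_cls; congr cls; apply: val_inj.
    change (sgval (conj_by w (qrepr u)) = sgval (qrepr u)).
    by rewrite conj_byE (@gpredC _ F _ _ wF (sgvalP _)) mulgK.
  rewrite /= (spP _ _ _ _ _ gw (frame_action_lifted Eg)).
  congr SdProd; apply/ffunP => j; rewrite !ffunE //.
have [p pE] := quot_multiplicative_exists fK.
exists p => w g rho tau eps gw gA; rewrite pE fmE; split=> //=.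
exact: spP gw gA.
Qed.

End WeylAction.

(** * Surjectivity of the quotient map *)

Section PermSum.
Variables s0 s1 : nat.
Implicit Types (r : {perm 'I_s0}) (t : {perm 'I_s1}).

Definition perm_sum_fun r t (a : 'I_(s0 + s1)) : 'I_(s0 + s1) :=
  match split a with inl i => idx0 s1 (r i) | inr j => idx1 s0 (t j) end.

Lemma split_idx0 i : split (idx0 s1 i) = inl i :> 'I_s0 + 'I_s1.
Proof. exact: (unsplitK (inl i)). Qed.
Lemma split_idx1 j : split (idx1 s0 j) = inr j :> 'I_s0 + 'I_s1.
Proof. exact: (unsplitK (inr j)). Qed.

Lemma idx_ind (Q : 'I_(s0 + s1) -> Prop) :
  (forall i, Q (idx0 s1 i)) -> (forall j, Q (idx1 s0 j)) -> forall a, Q a.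
Proof.
by move=> Ql Qr a; rewrite -(splitK a); case: (split a) => i; [apply: Ql | apply: Qr].
Qed.

Fact perm_sum_inj r t : injective (perm_sum_fun r t).
Proof.
apply: (can_inj (g := perm_sum_fun r^-1 t^-1)); apply: idx_ind => i.
  by rewrite /perm_sum_fun split_idx0 split_idx0 permK.
by rewrite /perm_sum_fun split_idx1 split_idx1 permK.
Qed.

Definition perm_sum r t := perm (@perm_sum_inj r t).

Lemma perm_sum_idx0 r t i : perm_sum r t (idx0 s1 i) = idx0 s1 (r i).
Proof. by rewrite permE /perm_sum_fun split_idx0. Qed.
Lemma perm_sum_idx1 r t j : perm_sum r t (idx1 s0 j) = idx1 s0 (t j).
Proof. by rewrite permE /perm_sum_fun split_idx1. Qed.

End PermSum.

Section Elements.
Local Open Scope ring_scope.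
Variables (R : realType) (n : nat) (F : abelianClosed (PO R n)).
Hypothesis Fmax : maximal_abelian F.
Hypothesis n_gt0 : (0 < n)%N.
Let hE := lifted_max Fmax.
Implicit Types (A B g h : orth R n) (x y : subgrp F) (u v : Fbar F).
Implicit Types (w : subgrp (normg F)).

Variables (s0 s1 : nat) (V : 'I_(s0 + s1) -> {vspace 'cV[R]_n}).
Hypothesis V_ord : eigenspace_ordering F V.
Variables (P J : 'I_(s0 + s1) -> 'M[R]_n).
Hypothesis fr : frame (lifted F) P J.
Hypothesis VP : forall a (v : 'cV[R]_n), v \in V a <-> P a *m v = v.
Hypothesis dimP : forall a, \tr (P a) = (\dim (V a))%:R.
Notation idx0 := (@idx0 s0 s1).
Notation idx1 := (@idx1 s0 s1).

Let J_idx0 i : J (idx0 i) = 0.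
Proof. by have [] := frame_J Fmax n_gt0 V_ord fr dimP. Qed.

Let J_idx1 j : J (idx1 j) <> 0.
Proof. by have [_] := frame_J Fmax n_gt0 V_ord fr dimP; apply. Qed.

(** The sign of the square of a lift of u on the a-th eigenspace. In complex
    type this square can be adjusted at will, see [normalise_square], so no
    invariant is attached to it and the value is an arbitrary constant. *)
Definition sqsign (a : 'I_(s0 + s1)) u : bool :=
  match split a with inl i => mu_bar V i u | inr _ => false end.

Lemma fbar_intertwiner (f : Fbar F -> Fbar F) a b (eps : bool) :
    (forall u v, mform_bar (f u) (f v) = mform_bar u v) ->
    (J a = 0 <-> J b = 0) ->
    (J a = 0 -> forall u, sqsign b (f u) = sqsign a u) ->
  exists T, [/\ P b *m T = T, T *m P a = T, T^T *m T = P a,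
    T *m J a = (-1) ^+ eps *: (J b *m T) &
    forall u, exists2 z, cent (lifted F) z & T *m lft u = lft (f u) *m z *m T].
Proof.
move=> fm Jab sq; have [r [e eB]] := Fbar_basis Fmax n_gt0.
have [_ esurj] := (F2_basisP e).1 eB.
have sqP c u : J c = 0 -> lft u *m lft u *m P c = (-1) ^+ sqsign c u *: P c.
  elim/idx_ind: c => [i _|j /J_idx1//].
  rewrite /sqsign split_idx0 (mu_ofP Fmax n_gt0 V_ord fr VP dimP _ (lft_proj u)).
  by [].
have lftC u v : lft u *m lft v = (-1) ^+ mform_bar u v *: (lft v *m lft u).
  by rewrite (mform_comm (lft_proj u) (lft_proj v)).
have [|||||T [PT TP TT TJ TX]] := @intertwiner_exists _ _ _ hE _ _ _ fr
   _ (fun c => lft (F2_comb e c)) (fun c => lft (f (F2_comb e c))) _ _ _ _ a b eps Jab.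
- by move=> c; apply: lft_mem.
- by move=> c; apply: lft_mem.
- move=> A /lft_gen[u [z [cz AE]]]; have [c cE] := esurj u.
  by exists c, z; rewrite cE.
- by move=> c d; exists (mform_bar (F2_comb e c) (F2_comb e d)); rewrite -{2}fm; split; apply: lftC.
- move=> c Ja; exists (sqsign a (F2_comb e c)); rewrite sqP //; split=> //.
  by rewrite sqP ?sq //; apply/Jab.
exists T; split=> // u; have [c <-] := esurj u; exact: TX.
Qed.

Lemma normalizer_of_family (pi : {perm 'I_(s0 + s1)}) (T : 'I_(s0 + s1) -> 'M[R]_n)
    (f : Fbar F -> Fbar F) (eps : 'I_(s0 + s1) -> bool) :
    (forall a, P (pi a) *m T a = T a) -> (forall a, T a *m P a = T a) ->
    (forall a, (T a)^T *m T a = P a) ->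
    (forall a, T a *m J a = (-1) ^+ eps a *: (J (pi a) *m T a)) ->
    (forall u a, exists2 z, cent (lifted F) z & T a *m lft u = lft (f u) *m z *m T a) ->
  exists w g, [/\ po_proj g = sgval w, omx g = \sum_a T a, fbar_aut n_gt0 w =1 f,
    forall a, g *m P a *m g^T = P (pi a) &
    forall a, g *m J a *m g^T = (-1) ^+ eps a *: J (pi a)].
Proof.
move=> PT TP TT TJ TX; have gO := glue_orth fr PT TP TT.
have [g gE] := orthE gO.
have TJ' a : exists e : bool, T a *m J a = (-1) ^+ e *: (J (pi a) *m T a).
  by exists (eps a).
have gst M : lifted F M -> lifted F (g *m M *m g^T).
  rewrite gE; apply: (mem_conj hE fr PT TP TT TJ' _ _ (@lft_gen _ _ F) TX) => u;
  exact: lft_mem.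
have gN := normg_of Fmax gst; exists (SubGrp gN), g; split=> //.
- move=> u; change (fbar_fun (SubGrp gN) u = f u).
  rewrite -[RHS]lft_cls; apply/(cls_eq (conj_lift (w := SubGrp gN) erefl (lft_proj u)) (lft_proj _)).
  have [z cz gz] := glue_conj hE fr PT TP TT (lft_mem u) (lft_mem (f u)) (TX u).
  rewrite !omxM omxV gE gz trmx_mul -mulmxA (mc_orth hE (lft_mem _)) mulmx1.
  exact: (centT hE).
- by move=> a; rewrite gE; apply: (glue_conjP fr PT TP TT).
- by move=> a; rewrite gE; apply: (glue_conjJ hE fr PT TP TT).
Qed.

(** Every block V_a is sent to V_(pi a) by an isometry from
    [fbar_intertwiner], with eps prescribing the sign of its effect on J a.
    The inverse of tau appears because [frame_action] has the permutations on
    the source side. *)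
Lemma weyl_surjective (f : autgrp (Fbar F)) (eps : {ffun 'I_s1 -> bool}) (tau : {perm 'I_s1}) :
  f \in Aut_mu F V -> exists w g rho,
    [/\ po_proj g = sgval w, frame_action P J g rho tau eps & fbar_aut n_gt0 w = f].
Proof.
move=> /asboolP[fm [r fr0]].
pose pi := perm_sum r tau^-1.
pose ep (a : 'I_(s0 + s1)) := match split a with inl _ => false | inr j => eps (tau^-1 j)%g end.
have /choice[T TP] a : exists T, [/\ P (pi a) *m T = T, T *m P a = T, T^T *m T = P a,
    T *m J a = (-1) ^+ ep a *: (J (pi a) *m T) &
    forall u, exists2 z, cent (lifted F) z & T *m lft u = lft (f u) *m z *m T].
  apply: fbar_intertwiner => //; elim/idx_ind: a => i; rewrite /pi ?perm_sum_idx0 ?perm_sum_idx1 ?J_idx0 //.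
  - by split=> /J_idx1.
  - by move=> _ u; rewrite /sqsign !split_idx0 fr0.
  - by move=> /J_idx1.
have [|||||w [g [gw gE wf gP gJ]]] := @normalizer_of_family pi T f ep.
- by move=> a; case: (TP a).
- by move=> a; case: (TP a).
- by move=> a; case: (TP a).
- by move=> a; case: (TP a).
- by move=> u a; case: (TP a).
exists w, g, r^-1%g; split=> //; last exact: autgrpP.
split=> [i|j|j].
- by rewrite gP /pi perm_sum_idx0 permKV.
- by rewrite gP /pi perm_sum_idx1 permK.
by rewrite gJ /pi perm_sum_idx1 permK /ep split_idx1 permK.
Qed.

End Elements.

(** * Sections over Hom(F / ker m, B_F) and over S_mu *)

Section KernelElements.
Local Open Scope ring_scope.
Variables (R : realType) (n : nat) (F : abelianClosed (PO R n)).
Hypothesis Fmax : maximal_abelian F.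
Hypothesis n_gt0 : (0 < n)%N.
Let hE := lifted_max Fmax.
Implicit Types (A B g h : orth R n) (x y : subgrp F) (u v : Fbar F).
Implicit Types (w : subgrp (normg F)).

Variables (s0 s1 : nat) (V : 'I_(s0 + s1) -> {vspace 'cV[R]_n}).
Hypothesis V_ord : eigenspace_ordering F V.
Variables (P J : 'I_(s0 + s1) -> 'M[R]_n).
Hypothesis fr : frame (lifted F) P J.
Hypothesis VP : forall a (v : 'cV[R]_n), v \in V a <-> P a *m v = v.
Hypothesis dimP : forall a, \tr (P a) = (\dim (V a))%:R.
Notation idx0 := (@idx0 s0 s1).
Notation idx1 := (@idx1 s0 s1).

Notation mu := (@mu_of R n F s0 s1 V).

Let J_idx0 i : J (idx0 i) = 0.
Proof. by have [] := frame_J Fmax n_gt0 V_ord fr dimP. Qed.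

Let J_idx1 j : J (idx1 j) <> 0.
Proof. by have [_] := frame_J Fmax n_gt0 V_ord fr dimP; apply. Qed.

(** In real type the corrections in [fbar_intertwiner] are scalars of modulus
    1, hence signs; T is onto since the two eigenspaces have the same
    dimension. *)
Lemma real_intertwiner i i' : (forall u, mu_bar V i' u = mu_bar V i u) ->
  exists T, [/\ P (idx0 i') *m T = T, T *m P (idx0 i) = T, T^T *m T = P (idx0 i),
    T *m T^T = P (idx0 i') &
    forall u, exists d : bool, T *m lft u = (-1) ^+ d *: (lft u *m T)].
Proof.
move=> mu_eq.
have [|||T [PT TP TT _ TX]] := fbar_intertwiner Fmax n_gt0 V_ord fr VP dimP (f := id) (a := idx0 i) (b := idx0 i') false.
- by [].
- by rewrite !J_idx0.
- by move=> _ u; rewrite /sqsign !split_idx0 mu_eq.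
exists T; split=> //.
  have QT : (P (idx0 i') - T *m T^T)^T = P (idx0 i') - T *m T^T.
    by rewrite linearB /= trmx_mul trmxK (fr_PT fr).
  have TTP : T *m T^T *m P (idx0 i') = T *m T^T.
    by rewrite -mulmxA -{1}(fr_PT fr) -trmx_mul PT.
  have TTT : T *m T^T *m (T *m T^T) = T *m T^T.
    by rewrite mulmxA -(mulmxA T) TT TP.
  have QQ : (P (idx0 i') - T *m T^T) *m (P (idx0 i') - T *m T^T) = P (idx0 i') - T *m T^T.
    rewrite mulmxBl !mulmxBr (fr_PP fr) TTP TTT mulmxA PT subrr subr0.
    by [].
  apply/esym/eqP; rewrite -subr_eq0 -mxtrace_gram_eq0 QT QQ raddfB /= mxtrace_mulC TT !dimP.
  by have [_ _ dim0 _] := V_ord; rewrite !dim0 subrr.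
move=> u; have [z cz zT] := TX u.
have [x [y zE]] := cent_coord hE fr (idx0 i') cz; rewrite /cscal J_idx0 scaler0 addr0 in zE.
have TXx : T *m lft u = x *: (lft u *m T).
  by rewrite zT -{1}PT mulmxA -(mulmxA (omx (lft u))) zE -scalemxAr -scalemxAl -mulmxA PT.
have x2 : x ^+ 2 = 1.
  have E1 : (T *m lft u)^T *m (T *m lft u) = P (idx0 i).
    rewrite trmx_mul -mulmxA (mulmxA T^T) TT -(fr_mem_comm fr _ (lft_mem u)) mulmxA.
    by rewrite omxTK mul1mx.
  move: E1; rewrite TXx trmxZ -scalemxAl -scalemxAr scalerA -expr2 trmx_mul -mulmxA.
  rewrite (mulmxA (omx (lft u))^T) omxTK mul1mx TT => /eqP.
  rewrite -subr_eq0 -{2}[P _]scale1r -scalerBl scaler_eq0 (negPf (fr_neq0 fr _)) orbF.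
  by rewrite subr_eq0 => /eqP.
move/eqP: x2; rewrite sqrf_eq1 => /orP[]/eqP xE; rewrite TXx xE.
  by exists false.
by exists true; rewrite expr1.
Qed.

Lemma mu_of_bar i i' : mu i = mu i' -> forall u, mu_bar V i u = mu_bar V i' u.
Proof. by move=> e u; rewrite /mu_bar e. Qed.

(** The function c selects one eigenspace in each class of equal mu_i, and
    leaves the complex eigenspaces alone; Th a is an isometry from the
    selected one to the a-th. *)
Lemma transport_exists : exists (c : 'I_(s0 + s1) -> 'I_(s0 + s1)) (Th : 'I_(s0 + s1) -> 'M[R]_n),
  [/\ forall j, c (idx1 j) = idx1 j,
      forall i i', mu i = mu i' -> c (idx0 i) = c (idx0 i') &
      forall a, [/\ P a *m Th a = Th a, Th a *m P (c a) = Th a,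
        (Th a)^T *m Th a = P (c a), Th a *m (Th a)^T = P a &
        Th a *m J (c a) = J a *m Th a /\
        forall u, exists d : bool, Th a *m lft u = (-1) ^+ d *: (lft u *m Th a)]].
Proof.
pose c0 i := choose (fun j => `[< mu j = mu i >]) i.
have c0P i : mu (c0 i) = mu i.
  by apply/asboolP/(@chooseP _ (fun j => `[< mu j = mu i >])); apply/asboolP.
pose c a := match split a with inl i => idx0 (c0 i) | inr j => idx1 j end.
have /choice[Th ThP] a : exists T, [/\ P a *m T = T, T *m P (c a) = T,
    T^T *m T = P (c a), T *m T^T = P a & T *m J (c a) = J a *m T /\
        forall u, exists d : bool, T *m lft u = (-1) ^+ d *: (lft u *m T)].
  elim/idx_ind: a => i; rewrite /c ?split_idx0 ?split_idx1.
    have [T [PT TP TT TT' TX]] := real_intertwiner (mu_of_bar (esym (c0P i))).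
    by exists T; split=> //; split=> //; rewrite !J_idx0 mulmx0 mul0mx.
  exists (P (idx1 i)); rewrite (fr_PT fr) (fr_PP fr) (fr_PJ fr) (fr_JP hE fr).
  split=> //; split=> // u; exists false.
  by rewrite expr0 scale1r (fr_mem_comm fr _ (lft_mem u)).
exists c, Th; split=> // [j|i i' ii']; first by rewrite /c split_idx1.
rewrite /c !split_idx0; congr idx0; rewrite /c0 ii'.
by apply: choose_id; apply/asboolP.
Qed.

(** The element attached to s has the blocks Th (pi s a) (Th a)^T. Routing
    every block through the selected eigenspace makes the product of two such
    matrices exact, with no leftover signs, since the middle factors (Th b)^T
    (Th b) cancel. *)
Lemma S_mu_section_exists : exists be : {multiplicative subgrp (S_mu F V) -> subgrp (normg F)},
  forall s, fbar_aut n_gt0 (be s) =1 id /\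
    exists2 g, po_proj g = sgval (be s) & frame_action P J g (sgval s) 1%g [ffun=> false].
Proof.
have [c [Th [cr cl ThP]]] := transport_exists.
pose pi (s : {perm 'I_s0}) := perm_sum s^-1 (1%g : {perm 'I_s1}).
pose T (s : {perm 'I_s0}) a := Th (pi s a) *m (Th a)^T.
have cpi (s : {perm 'I_s0}) a : s \in S_mu F V -> c (pi s a) = c a.
  move=> sS; elim/idx_ind: a => i; rewrite /pi ?perm_sum_idx0 ?perm_sum_idx1 ?perm1 //.
  have /asboolP/(_ i) := S_mu_inv sS; exact: cl.
have PTh a : P a *m Th a = Th a by case: (ThP a).
have ThPc a : Th a *m P (c a) = Th a by case: (ThP a).
have ThTh a : (Th a)^T *m Th a = P (c a) by case: (ThP a).
have ThThT a : Th a *m (Th a)^T = P a by case: (ThP a).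
have ThJ a : Th a *m J (c a) = J a *m Th a by case: (ThP a) => _ _ _ _ [].
have ThX a u : exists d : bool, Th a *m lft u = (-1) ^+ d *: (lft u *m Th a).
  by case: (ThP a) => _ _ _ _ [].
have ThTP a : (Th a)^T *m P a = (Th a)^T by rewrite -(fr_PT fr) -trmx_mul PTh.
have PThT a : P (c a) *m (Th a)^T = (Th a)^T by rewrite -(fr_PT fr) -trmx_mul ThPc.
have ThTJ a : (Th a)^T *m J a = J (c a) *m (Th a)^T.
  apply: trmx_inj; rewrite !trmx_mul trmxK !(fr_JT fr) mulNmx mulmxN ThJ.
  by [].
have fam (s : {perm 'I_s0}) : s \in S_mu F V -> exists w g, [/\ po_proj g = sgval w, omx g = \sum_a T s a,
    fbar_aut n_gt0 w =1 id, forall a, g *m P a *m g^T = P (pi s a) &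
    forall a, g *m J a *m g^T = (-1) ^+ false *: J (pi s a)].
  move=> sS; apply: (normalizer_of_family Fmax n_gt0 fr).
  - by move=> a; rewrite mulmxA PTh.
  - by move=> a; rewrite -mulmxA ThTP.
  - by move=> a; rewrite trmx_mul trmxK -mulmxA (mulmxA _ (Th (pi s a))) ThTh cpi // PThT ThThT.
  - by move=> a; rewrite expr0 scale1r -mulmxA ThTJ -(cpi s a) // !mulmxA ThJ.
  move=> u a; have [d Xa] := ThX a u; have [e Xpa] := ThX (pi s a) u.
  have XTa : (Th a)^T *m lft u = (-1) ^+ d *: (lft u *m (Th a)^T).
    have E1 : (Th a)^T *m (Th a *m lft u) *m (Th a)^T = lft u *m (Th a)^T.
      by rewrite (mulmxA (Th a)^T) ThTh -(fr_mem_comm fr _ (lft_mem u)) -mulmxA PThT.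
    have E2 : (Th a)^T *m (lft u *m Th a) *m (Th a)^T = (Th a)^T *m lft u.
      rewrite -mulmxA -(mulmxA (omx (lft u))) ThThT (fr_mem_comm fr _ (lft_mem u)).
      by rewrite mulmxA ThTP.
    by rewrite -E1 Xa -scalemxAr -scalemxAl E2 signZK.
  exists ((-1) ^+ d *: ((-1) ^+ e *: 1%:M)); first by do 2!apply: centZ; apply: cent1.
  have -> : T s a *m lft u = (-1) ^+ d *: ((-1) ^+ e *: (lft u *m T s a)).
    rewrite /T -mulmxA XTa -scalemxAr (mulmxA (Th (pi s a)) (omx (lft u))) Xpa.
    by rewrite -scalemxAl -mulmxA.
  by rewrite -!scalemxAr mulmx1 -!scalemxAl.
have /choice[fw fwP] (s : subgrp (S_mu F V)) := fam (sgval s) (sgvalP s).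
have fwM : {morph fw : s t / (s * t)%g}.
  move=> s t; apply: val_inj; change (sgval (fw (s * t)%g) = sgval (fw s) * sgval (fw t))%g.
  have [g [<- gE _ _ _]] := fwP s; have [h [<- hE' _ _ _]] := fwP t.
  have [k [<- kE _ _ _]] := fwP (s * t)%g; rewrite -po_projM; congr po_proj.
  have TP r a : T r a *m P a = T r a by rewrite -mulmxA ThTP.
  apply: val_inj; rewrite /= gE hE' kE; apply: (frame_eq fr) => a.
  rewrite -mulmxA !(glue_P fr (TP _)).
  have -> : T (sgval t) a = P (pi (sgval t) a) *m T (sgval t) a by rewrite /T mulmxA PTh.
  rewrite mulmxA (glue_P fr (TP _)) /T -mulmxA (mulmxA _ (Th (pi (sgval t) a))) ThTh.
  rewrite cpi ?sgvalP // PThT; congr (Th _ *m _).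
  elim/idx_ind: a => i; rewrite /pi ?perm_sum_idx0 ?perm_sum_idx1 ?perm1 //.
  by rewrite invMg permM.
have [be beE] := multiplicative_exists fwM; exists be => s; rewrite beE.
have [g [gw gE wf gP gJ]] := fwP s; split=> //; exists g => //.
split=> [i|j|j].
- by rewrite gP /pi perm_sum_idx0 permK.
- by rewrite gP /pi perm_sum_idx1 !perm1.
- by rewrite gJ /pi perm_sum_idx1 !perm1 ffunE.
Qed.

(** On the a-th eigenspace let g act as a lift of the element c_a such that
    chi_a = m(c_a, -); then g A g^T differs from A there by the sign chi_a. *)
Lemma character_element (chi : 'I_(s0 + s1) -> Fbar F -> bool) :
    (forall a u v, chi a (u * v)%g = chi a u (+) chi a v) ->
  exists w g, [/\ po_proj g = sgval w, fbar_aut n_gt0 w =1 id,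
    frame_action P J g 1%g 1%g [ffun=> false] &
    forall x A a, po_proj A = sgval x ->
      g *m A *m g^T *m P a = (-1) ^+ chi a (cls x) *: (A *m P a)].
Proof.
move=> chiM; have /choice[c cP] a := character_mform Fmax n_gt0 (chiM a).
pose T a := lft (c a) *m P a; pose pi : {perm 'I_(s0 + s1)} := 1%g.
have comm a x A : po_proj A = sgval x ->
    lft (c a) *m A = (-1) ^+ chi a (cls x) *: (A *m lft (c a)).
  by move=> Ax; rewrite (mform_comm (lft_proj _) Ax) -cP -mform_barE [qproj _ _]lft_cls.
have TA a x A : po_proj A = sgval x -> T a *m A = (-1) ^+ chi a (cls x) *: (A *m T a).
  move=> Ax; have EA : lifted F A by apply/liftedE; rewrite Ax sgvalP.
  rewrite /T -mulmxA -(fr_mem_comm fr _ EA) (mulmxA (omx (lft (c a))) (omx A)) (comm a x A Ax) -scalemxAl.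
  by rewrite -mulmxA.
have PT a : P (pi a) *m T a = T a.
  by rewrite /T perm1 mulmxA -(fr_mem_comm fr _ (lft_mem _)) -mulmxA (fr_PP fr).
have TP a : T a *m P a = T a by rewrite -mulmxA (fr_PP fr).
have TT a : (T a)^T *m T a = P a.
  rewrite trmx_mul -mulmxA (mulmxA (omx (lft (c a)))^T) omxTK mul1mx (fr_PT fr).
  exact: (fr_PP fr).
have [|u a|w [g [gw gE wf gP gJ]]] :=
    normalizer_of_family Fmax n_gt0 fr (f := id) (eps := fun=> false) PT TP TT.
- move=> a; rewrite expr0 scale1r perm1 -mulmxA (fr_PJ fr) /T mulmxA.
  by rewrite -(fr_centJ fr _ (lft_mem _)) -mulmxA (fr_JP hE fr).
- exists ((-1) ^+ chi a u *: 1%:M); first by apply/centZ/cent1.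
  by rewrite (TA a _ _ (lft_proj u)) lft_cls -scalemxAr mulmx1 -scalemxAl.
exists w, g; split=> //.
  by split=> [i|j|j]; rewrite perm1 ?gP ?gJ /pi perm1 ?ffunE.
move=> x A a Ax; have EA : lifted F A by apply/liftedE; rewrite Ax sgvalP.
have gPg : g *m P a *m g^T = P a by rewrite gP perm1.
have gPT : g *m P a = T a by rewrite gE (glue_P fr TP).
have -> : g *m A *m g^T *m P a = g *m (A *m P a) *m g^T.
  by rewrite -{1}gPg !mulmxA -(mulmxA _ g^T g) omxTK mulmx1.
rewrite (fr_mem_comm fr _ EA) mulmxA gPT (TA a x A Ax) -scalemxAl -mulmxA -gPT.
by rewrite gPg (fr_mem_comm fr _ EA).
Qed.

Definition sgn_mx (e : {ffun 'I_(s0 + s1) -> bool}) : 'M[R]_n := \sum_a (-1) ^+ e a *: P a.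

Lemma sgn_mxP e a : sgn_mx e *m P a = (-1) ^+ e a *: P a.
Proof.
rewrite mulmx_suml (bigD1 a) //= -scalemxAl (fr_PP fr) big1 ?addr0 // => b ba.
by rewrite -scalemxAl (fr_orth fr ba) scaler0.
Qed.

Lemma sgn_mxM e e' : sgn_mx e *m sgn_mx e' = sgn_mx [ffun a => e a (+) e' a].
Proof.
apply: (frame_eq fr) => a; rewrite -mulmxA !sgn_mxP -scalemxAr sgn_mxP scalerA.
by rewrite ffunE signr_addb mulrC.
Qed.

(** All sign patterns occur, since sgn_mx e is an orthogonal involution of the
    commutant, hence in E by maximality. *)
Lemma sgn_mx_BF e : exists2 A, omx A = sgn_mx e & BF_lift F A.
Proof.
have DT : (sgn_mx e)^T = sgn_mx e.
  rewrite /sgn_mx linear_sum; apply: eq_bigr => a _.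
  by rewrite /= trmxZ (fr_PT fr).
have DD : sgn_mx e *m sgn_mx e = 1%:M.
  by apply: (frame_eq fr) => a; rewrite sgn_mxM sgn_mxP ffunE addbb expr0 scale1r mul1mx.
have DO : (sgn_mx e)^T *m sgn_mx e = 1%:M by rewrite DT.
have cD : cent (lifted F) (sgn_mx e).
  by apply: cent_sum => a; apply: centZ; apply: (fr_cent fr).
have [A AE] := orthE DO; exists A => //; apply/BF_liftP; rewrite AE; split=> //.
exact: (cent_orth_mem hE).
Qed.

Lemma BF_sgn_mx A : BF_lift F A -> exists e, omx A = sgn_mx e.
Proof.
move=> AB; have [hQ AE] := BF_lift_cproj AB.
have /choice[e eP] a : exists b : bool, A *m P a = (-1) ^+ b *: P a.
  have [_ _ amin] := fr_atom fr a; rewrite AE !mulmxBl mul1mx.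
  have [->|->] := amin _ hQ; first by exists false; rewrite !subr0 expr0 scale1r.
  by exists true; rewrite subrr sub0r expr1 scaleN1r.
exists [ffun a => e a]; apply: (frame_eq fr) => a.
by rewrite sgn_mxP ffunE eP.
Qed.

Lemma acts_by_signsP e A : acts_by_signs V e A <-> omx A = sgn_mx e.
Proof.
split=> [AV|AE a v /VP vE].
  apply: (frame_eq fr) => a; rewrite sgn_mxP; apply: eq_mulmx_col => v.
  by rewrite -mulmxA (AV a) -?scalemxAl //; apply/VP; rewrite mulmxA (fr_PP fr).
by rewrite -vE mulmxA AE sgn_mxP -scalemxAl.
Qed.

Lemma eigenspace_index_exists : exists a : 'I_(s0 + s1), True.
Proof.
apply: contrapT => na; have := fr_sum fr; rewrite big1 => [|a _]; last by case: na; exists a.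
move/matrixP/(_ (Ordinal n_gt0) (Ordinal n_gt0))/eqP.
by rewrite !mxE eqxx eq_sym oner_eq0.
Qed.

(** Matrices with the same class in G differ by a global sign, which is fixed
    by any one coordinate. *)
Lemma sgn_mx_po e e' A A' a0 : omx A = sgn_mx e -> omx A' = sgn_mx e' ->
  po_proj A = po_proj A' -> e a0 = e' a0 -> e = e'.
Proof.
move=> AE AE' /po_projP[Z /pmIP[b ZE] A'E] ea.
have E a : (-1) ^+ e' a *: P a = (-1) ^+ (b (+) e a) *: P a.
  by rewrite -!sgn_mxP -AE' A'E omxM ZE mul_mx_scalar -scalemxAl AE sgn_mxP scalerA signr_addb.
have {}E a : e' a = b (+) e a by apply: signZ_inj (E a); apply: (fr_neq0 fr).
have b0 : b = false by have := E a0; rewrite ea; case: (b) (e' a0) => [] [].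
by apply/ffunP => a; rewrite E b0.
Qed.

End KernelElements.

Section BFAction.
Local Open Scope ring_scope.
Variables (R : realType) (n : nat) (F : abelianClosed (PO R n)).
Hypothesis Fmax : maximal_abelian F.
Hypothesis n_gt0 : (0 < n)%N.
Implicit Types (A B g h : orth R n) (x y : subgrp F) (u v : Fbar F).
Implicit Types (w : subgrp (normg F)) (b : subgrp (BF F)).

Lemma conj_kerm w x : x \in kerm F -> conj_aut w x \in kerm F.
Proof.
move=> /asboolP xK; apply/asboolP => z.
by rewrite -(aut_invK (conj_aut w) z) (mform_conj n_gt0); apply: xK.
Qed.

Lemma conj_BF w x : x \in BF F -> conj_aut w x \in BF F.
Proof.
have [gw Ax] := (qreprK (sgval w), qreprK (sgval x)).
move: (qrepr (sgval w)) (qrepr (sgval x)) gw Ax => g A gw Ax /(BFP Ax)[xK AA].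
apply/(BFP (conj_lift gw Ax)); split; first exact: conj_kerm.
by rewrite !mulgA mulgKV -(mulgA g A A) AA mulg1 mulgV.
Qed.

Definition bf_fun w b : subgrp (BF F) := SubGrp (conj_BF w (sgvalP b)).

Fact bf_funK w : cancel (bf_fun w) (bf_fun w^-1%g).
Proof. by move=> b; apply: val_inj; apply: (aut_funK (conj_aut w)). Qed.
Fact bf_funVK w : cancel (bf_fun w^-1%g) (bf_fun w).
Proof. by move=> b; apply: val_inj; apply: (aut_invK (conj_aut w)). Qed.
Fact bf_funM w : {morph bf_fun w : b b' / (b * b')%g}.
Proof. by move=> b b'; apply: val_inj; apply: (aut_morph (conj_aut w)). Qed.

Definition bf_aut w : autgrp (subgrp (BF F)) :=
  AutGrp (bf_funK w) (bf_funVK w) (@bf_funM w).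

Lemma bf_autM w w' : bf_aut (w * w')%g = (bf_aut w * bf_aut w')%g.
Proof.
apply: autgrpP => b; apply: val_inj.
change (conj_aut (w * w')%g (sgval b) = conj_aut w (conj_aut w' (sgval b))).
by rewrite gmulfM.
Qed.

(** Multiplication by B_F is invisible on F / ker m. For this reason composing
    two elements of the semidirect product needs no cross terms. *)
Lemma cls_BF b x : cls (sgval b * x)%g = cls x.
Proof.
apply/qprojP; rewrite invgM -mulgA [(_ * x)%g]abmulgC mulgA [(x^-1 * _)%g]abmulgC.
by rewrite mulgV mul1g gpredV; have /andP[] := sgvalP b.
Qed.

End BFAction.

(** * The kernel of the quotient map and the exact sequence *)

Section ExactSequence.
Local Open Scope ring_scope.
Variables (R : realType) (n : nat) (F : abelianClosed (PO R n)).
Hypothesis Fmax : maximal_abelian F.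
Hypothesis n_gt0 : (0 < n)%N.
Let hE := lifted_max Fmax.
Implicit Types (A B g h : orth R n) (x y : subgrp F) (u v : Fbar F).
Implicit Types (w : subgrp (normg F)) (b : subgrp (BF F)).

Variables (s0 s1 : nat) (V : 'I_(s0 + s1) -> {vspace 'cV[R]_n}).
Hypothesis V_ord : eigenspace_ordering F V.
Variables (P J : 'I_(s0 + s1) -> 'M[R]_n).
Hypothesis fr : frame (lifted F) P J.
Hypothesis VP : forall a (v : 'cV[R]_n), v \in V a <-> P a *m v = v.
Hypothesis dimP : forall a, \tr (P a) = (\dim (V a))%:R.
Notation idx0 := (@idx0 s0 s1).
Notation idx1 := (@idx1 s0 s1).
Notation mu := (@mu_of R n F s0 s1 V).

Lemma bf_aut_perm w g rho eps b : po_proj g = sgval w -> frame_action P J g rho 1%g eps ->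
  exists A A' e, [/\ po_proj A = sgval (sgval b), acts_by_signs V e A,
    po_proj A' = sgval (sgval (bf_aut n_gt0 w b)) & acts_by_signs V (perm_coords rho e) A'].
Proof.
move=> gw [g0 g1 _]; have Ab := qreprK (sgval (sgval b)).
set A := qrepr _ in Ab; have AB : BF_lift F A by exists (sgval b) => //; apply: sgvalP.
have [e AE] := BF_sgn_mx fr AB.
exists A, (g * A * g^-1)%g, e; split=> //.
- exact/(acts_by_signsP fr VP).
- exact: (conj_lift gw Ab).
apply/(acts_by_signsP fr VP); apply: (frame_eq fr) => a; rewrite (sgn_mxP fr) !omxM omxV AE.
have key c d : g *m P c *m g^T = P d -> g *m sgn_mx P e *m g^T *m P d = (-1) ^+ e c *: P d.
  move=> <-; rewrite !mulmxA -!(mulmxA _ g^T g) omxTK mulmx1 -(mulmxA (omx g)) (sgn_mxP fr).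
  by rewrite -scalemxAr -scalemxAl.
elim/idx_ind: a => i.
  by rewrite (key _ _ (g0 i)) ffunE split_idx0.
by have := g1 i; rewrite perm1 => /key ->; rewrite ffunE split_idx1.
Qed.

(** An element of B_F is a sign pattern up to a global sign. Normalising one
    coordinate to be + turns the pattern of eta(u) into a family of characters
    of F / ker m, realised by [character_element]. *)
Lemma hom_realized (eta : {multiplicative Fbar F -> subgrp (BF F)}) : exists w,
  [/\ forall x, conj_aut w x = (sgval (eta (cls x)) * x)%g,
      fbar_aut n_gt0 w =1 id &
      exists2 g, po_proj g = sgval w & frame_action P J g 1%g 1%g [ffun=> false]].
Proof.
have [a0 _] := eigenspace_index_exists n_gt0 fr.
(* sg b is the sign pattern of the lift of b that has sign + at a0. *)
have /choice[sg sgP] b : exists e : {ffun 'I_(s0 + s1) -> bool}, e a0 = false /\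
    exists2 A, po_proj A = sgval (sgval b) & omx A = sgn_mx P e.
  have Ab := qreprK (sgval (sgval b)); set A := qrepr _ in Ab.
  have AB : BF_lift F A by exists (sgval b) => //; apply: sgvalP.
  have [e AE] := BF_sgn_mx fr AB.
  exists [ffun a => e a0 (+) e a]; rewrite ffunE addbb; split=> //.
  have [A' A'E _] := sgn_mx_BF Fmax fr [ffun a => e a0 (+) e a].
  exists A' => //; rewrite -Ab; apply/po_projP.
  have ZO : (((-1) ^+ e a0)%:M : 'M[R]_n)^T *m ((-1) ^+ e a0)%:M = 1%:M.
    by rewrite tr_scalar_mx -scalar_mxM -expr2 sqrr_sign.
  have [Z ZE] := orthE ZO; exists Z; first by apply/pmIP; exists (e a0).
  apply: val_inj; rewrite /= AE A'E ZE mul_mx_scalar; apply: (frame_eq fr) => a.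
  by rewrite -scalemxAl !(sgn_mxP fr) ffunE signr_addb scalerA mulrA -expr2 sqrr_sign mul1r.
have sgM b b' : sg (b * b')%g = [ffun a => sg b a (+) sg b' a].
  have [e0 [A Ab AE]] := sgP b; have [e0' [A' Ab' AE']] := sgP b'.
  have [e0'' [A'' Ab'' AE'']] := sgP (b * b')%g.
  apply: (sgn_mx_po fr AE'' (A' := (A * A')%g) (a0 := a0)).
  - by rewrite omxM AE AE' (sgn_mxM fr).
  - by rewrite Ab'' po_projM Ab Ab'.
  - by rewrite ffunE e0 e0' e0''.
have [|w [g [gw wf gA gx]]] := character_element Fmax n_gt0 fr (chi := fun a u => sg (eta u) a).
  by move=> a u v; rewrite gmulfM sgM ffunE.
exists w; split=> //; last by exists g.
move=> x; have Ax := qreprK (sgval x); set A := qrepr _ in Ax.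
have EA : lifted F A by apply/liftedE; rewrite [po_proj A]Ax sgvalP.
have [_ [D Db DE]] := sgP (eta (cls x)).
apply: val_inj; change (sgval (conj_aut w x) = sgval (sgval (eta (cls x))) * sgval x)%g.
rewrite -(conj_lift gw Ax) -Db -[in RHS]Ax -[qproj _ _]/(po_proj A) -po_projM; congr po_proj.
apply: val_inj; rewrite /= DE; apply: (frame_eq fr) => a; rewrite (gx x A a Ax).
by rewrite (fr_mem_comm fr _ EA) -mulmxA (fr_mem_comm fr _ EA) mulmxA (sgn_mxP fr) scalemxAl.
Qed.

(** Conjugation by g fixes the commutant of E, in particular ker m and the
    square of every lift A. As the class of A in F / ker m is also fixed, g A
    g^T = Z A with Z in the commutant, and comparing squares Z Z = 1, so Z
    represents an element of B_F. *)
Lemma kernel_hom_exists w g : po_proj g = sgval w -> frame_action P J g 1%g 1%g [ffun=> false] ->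
    fbar_aut n_gt0 w =1 id ->
  exists eta : {multiplicative Fbar F -> subgrp (BF F)},
    forall x, conj_aut w x = (sgval (eta (cls x)) * x)%g.
Proof.
move=> gw [g0 g1 g2] wf.
have gP a : g *m P a *m g^T = P a.
  by elim/idx_ind: a => i; [have := g0 i | have := g1 i]; rewrite perm1.
have gJ a : g *m J a *m g^T = J a.
  elim/idx_ind: a => i; last by have := g2 i; rewrite perm1 ffunE expr0 scale1r.
  have [J_idx0 _] := frame_J Fmax n_gt0 V_ord fr dimP.
  by rewrite J_idx0 mulmx0 mul0mx.
have gcent M : cent (lifted F) M -> g *m M *m g^T = M.
  move=> cM; apply: (frame_eq fr) => a; have [z [t zE]] := cent_coord hE fr a cM.
  rewrite -{1}gP !mulmxA -!(mulmxA _ g^T g) omxTK mulmx1 -(mulmxA (omx g)) zE.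
  by rewrite /cscal mulmxDr mulmxDl -!scalemxAr -!scalemxAl gP gJ.
(* The factor by which g multiplies x. *)
have zBF x : (conj_aut w x * x^-1)%g \in BF F.
  have Ax := qreprK (sgval x); move: (qrepr _) Ax => A Ax.
  have EA : lifted F A by apply/liftedE; rewrite [po_proj A]Ax sgvalP.
  have gAx := conj_lift gw Ax.
  have cA : cent (lifted F) (A^T *m (g *m A *m g^T)).
    apply/(cls_eq Ax gAx); rewrite -[RHS](fbar_autE n_gt0).
    exact/esym/wf.
  have [M ME] : exists M, M = g *m A *m g^T by exists (g *m A *m g^T).
  rewrite -ME in cA; have [Z ZE] : exists Z, Z = M *m A^T by exists (M *m A^T).
  have {cA} cZ : cent (lifted F) Z.
    rewrite ZE; have -> : M *m A^T = A^T *m M; last by [].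
    by rewrite -[in LHS](mul1mx M) -(omxKT A) -(mulmxA (omx A)) (cA _ EA) -(mulmxA _ (omx A)) omxKT mulmx1.
  have MZ : M = Z *m A by rewrite ZE -mulmxA omxTK mulmx1.
  have zx : po_proj (g * A * g^-1 * A^-1)%g = sgval (conj_aut w x * x^-1)%g.
    by rewrite po_projM po_projV gAx [po_proj A]Ax.
  apply/(BFP zx); split; first by apply/(kerm_cent zx); rewrite ZE ME in cZ.
  apply: val_inj; change (g *m A *m g^T *m A^T *m (g *m A *m g^T *m A^T) = 1%:M); rewrite -ME -ZE.
  have MM : M *m M = A *m A.
    rewrite ME !mulmxA -(mulmxA _ g^T g) omxTK mulmx1 -(mulmxA (omx g)).
    exact: (gcent _ (cent_sqr hE EA)).
  have ZZ : Z *m Z *m (A *m A) = A *m A.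
    by rewrite -[RHS]MM MZ !mulmxA -(mulmxA Z (omx A)) (cZ _ EA) !mulmxA.
  have AAo := mc_orthT hE (mc_mul hE EA EA).
  by rewrite -[LHS]mulmx1 -AAo mulmxA ZZ.
pose z x : subgrp (BF F) := SubGrp (zBF x).
have zM : {morph z : x y / (x * y)%g}.
  move=> x y; apply: val_inj.
  change (conj_aut w (x * y) * (x * y)^-1 = (conj_aut w x * x^-1) * (conj_aut w y * y^-1))%g.
  rewrite (aut_morph (conj_aut w)) invgM -!mulgA; congr (_ * _)%g.
  by rewrite [RHS]abmulgC -mulgA.
have zker x : x \in kerm F -> z x = 1%g.
  move=> xK; have Ax := qreprK (sgval x); move: (qrepr _) Ax => A Ax.
  apply: val_inj; change (conj_aut w x * x^-1 = 1)%g.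
  have -> : conj_aut w x = x; last by rewrite mulgV.
  apply: val_inj; change (sgval (conj_aut w x) = sgval x); rewrite -(conj_lift gw Ax) -Ax.
  congr po_proj; apply: val_inj; rewrite /= gcent //.
  exact/(kerm_cent Ax).
have [z' z'E] := multiplicative_exists zM.
have [eta etaE] := quot_multiplicative_exists (h := z') (K := kerm F) (fun x xK => etrans (z'E x) (zker x xK)).
exists eta => x; rewrite [eta _]etaE z'E /= mulgKV.
by [].
Qed.

End ExactSequence.

Theorem proposition3p4 (R : realType) (n : nat) (n_gt0 : (0 < n)%N)
    (F : abelianClosed (PO R n)) (F_max : maximal_abelian F) (s0 s1 : nat)
    (V : 'I_(s0 + s1) -> {vspace 'cV[R]_n})
    (V_ord : eigenspace_ordering F V) :
  exists2 phi : {multiplicative subgrp (S_mu F V) -> autgrp (subgrp (BF F))},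
    permutes_coords phi
  & exists (i : {multiplicative extsdprod (hom_act (Fbar F) phi) -> weyl F})
           (p : {multiplicative weyl F ->
                   (subgrp (Aut_mu F V) * signed_perm s1)%type}),
      short_exact i p.
Proof.
have [P [J [fr VP dimP]]] := frame_exists F_max V_ord.
have [be beP] := S_mu_section_exists F_max n_gt0 V_ord fr VP dimP.
have phiM : {morph (fun s => bf_aut n_gt0 (be s)) : s t / (s * t)%g}.
  by move=> s t; rewrite gmulfM bf_autM.
have [phi phiE] := multiplicative_exists phiM; exists phi.
  move=> s b; rewrite phiE; have [_ [g gw gA]] := beP s.
  exact: (bf_aut_perm n_gt0 fr VP b gw gA).
have /choice[hw hwP] := hom_realized F_max n_gt0 fr.
have hwE eta x : conj_aut (hw eta) x = (sgval (eta (cls x)) * x)%g by case: (hwP eta).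
have cls_be s x : cls (conj_aut (be s) x) = cls x.
  by rewrite -(fbar_autE n_gt0); case: (beP s) => + _; apply.
have cjM (w w' : subgrp (normg F)) (x : subgrp F) : conj_aut (w * w')%g x = conj_aut w (conj_aut w' x) by rewrite gmulfM.
have conjE eta s x : conj_aut (hw eta * be s)%g x
    = (sgval (eta (cls x)) * conj_aut (be s) x)%g.
  by rewrite cjM hwE cls_be.
have be1 : be 1%g = 1%g by apply: (mulgI (be 1%g)); rewrite -gmulfM !mulg1.
have cj1 (x : subgrp F) : conj_aut (1%g : subgrp (normg F)) x = x.
  by apply: val_inj; rewrite /= invg1 conjg1.
have actM (eta eta' zeta : {multiplicative Fbar F -> subgrp (BF F)}) s t x :
    (forall u, zeta u = (eta u * phi s (eta' u))%g) ->
    conj_aut (hw zeta * be (s * t))%g x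
      = conj_aut (hw eta * be s * (hw eta' * be t))%g x.
  move=> zetaE; rewrite [RHS]cjM (conjE zeta) (conjE eta' t) (conjE eta s).
  have -> : cls (sgval (eta' (cls x)) * conj_aut (be t) x)%g = cls x.
    by rewrite cls_BF cls_be.
  rewrite (aut_morph (conj_aut (be s))) zetaE phiE mulgA.
  have -> : conj_aut (be (s * t)%g) x = conj_aut (be s) (conj_aut (be t) x).
    by rewrite gmulfM cjM.
  by [].
(* The element (eta, s) goes to the class of the product of a realisation of
   eta and of the section at s. The realisation hw is a mere choice, but
   classes in N(F) / C(F) are compared by their effect on F, given by conjE. *)
pose i0 (z : extsdprod (hom_act (Fbar F) phi)) : weyl F :=
  qproj (@cent_in_norm _ F) (hw (sdn z) * be (sdh z))%g.
have i0M : {morph i0 : z z' / (z * z')%g}.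
  move=> [eta s] [eta' t]; rewrite /i0 -[RHS]qprojM; apply/weyl_eq => x.
  by apply: actM.
have [i iE] := multiplicative_exists i0M.
have [p pP] := weyl_action_exists F_max n_gt0 V_ord fr VP dimP.
have gz (z : extsdprod (hom_act (Fbar F) phi)) : exists2 g, po_proj g = sgval (hw (sdn z) * be (sdh z))%g &
    frame_action P J g (sgval (sdh z)) 1%g 1%g.
  have [_ _ [g gw gA]] := hwP (sdn z); have [_ [h hw' hA]] := beP (sdh z).
  exists (g * h)%g; first by rewrite po_projM gw hw'.
  have := frame_actionM gA hA; rewrite !mul1g.
  by congr frame_action; apply/ffunP => j; rewrite !ffunE.
have fz (z : extsdprod (hom_act (Fbar F) phi)) : fbar_aut n_gt0 (hw (sdn z) * be (sdh z))%g = 1%g.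
  apply: autgrpP => u; rewrite -(lft_cls u) [LHS]fbar_autE conjE cls_BF cls_be.
  by [].
exists i, p; split.
(* An element of the kernel of i acts trivially on F; it belongs to F by
   maximality, so its permutation s is trivial, and then eta = 1. *)
- apply: multiplicative_inj => z; rewrite iE => /weyl_eq z1.
  set w := (hw (sdn z) * be (sdh z))%g in z1.
  have z1' x : conj_aut w x = x by rewrite z1 cj1.
  have wF : sgval w \in F.
    apply: (maximal_abelian_cent _ F_max) => y yF.
    have /(congr1 (@sgval _ _)) := z1' (SubGrp yF).
    change (sgval (conj_by w (SubGrp yF)) = y -> (sgval w * y = y * sgval w)%g).
    by rewrite conj_byE => E; rewrite -{2}E mulgKV.
  have [g gw gA] := gz z; have Eg : lifted F g by apply/liftedE; rewrite gw.
  have [sE _ _] := frame_action_uniq F_max n_gt0 V_ord fr dimP (omxTK g) gA (frame_action_lifted F_max fr Eg).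
  have {}sE : sdh z = 1%g by apply: val_inj.
  have etaE : sdn z = 1%g.
    apply: multiplicativeP => u; apply: val_inj.
    have := z1' (qrepr u); rewrite /w conjE sE be1 cj1 lft_cls => E.
    by apply: (mulIg (qrepr u)); rewrite [LHS]E mul1g.
  by case: z sE etaE {gz fz i0M iE z1 z1' w wF gw gA} => eta s /= -> ->.
- move=> b; split=> [pb1|[z <-]]; last first.
    have [g gw gA] := gz z; have [p1 p2] := pP _ _ _ _ _ gw gA.
    rewrite iE; apply/pair_eqP/andP; split; apply/eqP; last exact: p2.
    by apply: val_inj; rewrite /= p1 fz.
  have bE := qreprK b; move: (qrepr b) bE => w bE.
  have gw := qreprK (sgval w); move: (qrepr (sgval w)) gw => g gw.
  have [rho [tau [eps gA]]] := frame_action_exists_norm F_max n_gt0 V_ord fr dimP gw.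
  have [p1 p2] := pP _ _ _ _ _ gw gA; rewrite bE pb1 /= in p1 p2.
  case: p2 => epsE tauE; rewrite -{}epsE -{}tauE in gA.
  have wf u : fbar_aut n_gt0 w u = u by rewrite -p1.
  have rhoS : rho \in S_mu F V.
    apply/asboolP => j; apply: funext => x.
    rewrite -(frame_action_mu F_max n_gt0 V_ord fr VP dimP j x gw gA).
    rewrite -!(mu_barE F_max n_gt0 V_ord fr VP dimP) -(fbar_autE n_gt0).
    by rewrite -[in RHS](wf (cls x)).
  (* Dividing by the section at s removes the permutation rho and leaves an
     element to which kernel_hom_exists applies. *)
  pose s : subgrp (S_mu F V) := SubGrp rhoS.
  have [sf [h hw' hA]] := beP s^-1%g.
  have ghw : po_proj (g * h)%g = sgval (w * be s^-1)%g by rewrite po_projM [po_proj g]gw hw'.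
  have ghA : frame_action P J (g * h)%g 1%g 1%g [ffun=> false].
    have := frame_actionM gA hA; rewrite [sgval s^-1%g]/= mulgV mul1g.
    by congr frame_action; apply/ffunP => j; rewrite !ffunE.
  have ghf : fbar_aut n_gt0 (w * be s^-1)%g =1 id.
    by move=> u; rewrite [fbar_aut _ _]fbar_autM /=; rewrite [X in fbar_fun w X]sf; apply: wf.
  have [eta etaE] := kernel_hom_exists F_max V_ord fr dimP ghw ghA ghf.
  exists (SdProd eta s); rewrite iE -bE; apply/weyl_eq => x.
  change (conj_aut (hw eta * be s)%g x = conj_aut w x).
  by rewrite conjE -(cls_be s x) -etaE -cjM -mulgA -gmulfM mulVg be1 mulg1.
case=> f [eps tau].
have [w [g [rho [gw gA wf]]]] := weyl_surjective F_max n_gt0 V_ord fr VP dimP eps tau (sgvalP f).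
exists (qproj (@cent_in_norm _ F) w); have [p1 p2] := pP _ _ _ _ _ gw gA.
by apply/pair_eqP/andP; split; apply/eqP; [apply: val_inj; rewrite /= p1 | ].
Qed.
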